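(* Let $\phi_+,\phi_-:[0,\infty)\to\mathbb S^d$ be locally absolutely continuous (i.e. $\phi_+',\phi_-'\in L^1_{\mathrm{loc}}([0,\infty))$) with $\phi_+(0)=\phi_-(0)$, and let $\phi:[0,\infty)^2\to\mathbb S^d$ be the wave map with boundary data $\phi_\pm$. Then $$\lim_{N\to\infty}\Phi_N(\phi_+,\phi_-)=\phi$$ uniformly on every compact subset of $[0,\infty)^2$.
   Context: $d\ge1$ is an integer, $\mathbb S^d\subset\mathbb R^{d+1}$ is the unit sphere, $|\cdot|$ and $\cdot$ are the Euclidean norm and inner product. Wave map: for $u_0,v_0>0$ and continuous $\phi_+:[0,u_0]\to\mathbb S^d$, $\phi_-:[0,v_0]\to\mathbb S^d$ with $\phi_+(0)=\phi_-(0)$, a wave map on $[0,u_0]\times[0,v_0]$ with boundary data $\phi_\pm$ is a function $\phi:[0,u_0]\times[0,v_0]\to\mathbb S^d$ such that $\partial_u\phi,\partial_v\phi$ exist almost everywhere, $\partial_u\phi\cdot\partial_v\phi\in L^1([0,u_0]\times[0,v_0])$, and for all $(u,v)\in[0,u_0]\times[0,v_0]$ $$\phi(u,v)=\phi_+(u)+\phi_-(v)-\phi_+(0)-\int_0^u\int_0^v[(\partial_u\phi\cdot\partial_v\phi)\phi](w,z)\,dz\,dw.$$ For absolutely continuous boundary data on $[0,u_0]$ and $[0,v_0]$ such a wave map exists and is unique. For locally absolutely continuous boundary data on $[0,\infty)$, the wave map $\phi:[0,\infty)^2\to\mathbb S^d$ is the unique function whose restriction to every $[0,u_0]\times[0,v_0]$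 is the wave map with boundary data $\phi_+|_{[0,u_0]}$, $\phi_-|_{[0,v_0]}$. Reflections: for $Q\in\mathbb R^{d+1}\setminus\{0\}$, $\mathcal R_QP:=2|Q|^{-2}(Q\cdot P)Q-P$, and $\mathcal R_0P:=-P$. Discrete wave map: given $Y_+,Y_-:\mathbb N\to\mathbb S^d$ ($\mathbb N=\{0,1,2,\dots\}$) with $Y_+(0)=Y_-(0)$, the discrete wave map with boundary data $Y_\pm$ is the unique $Y:\mathbb N^2\to\mathbb S^d$ with $Y(m,0)=Y_+(m)$, $Y(0,n)=Y_-(n)$ and $Y(m+1,n+1)=\mathcal R_{Y(m+1,n)+Y(m,n+1)}Y(m,n)$ for all $m,n$. Extension: $\widetilde Y:[0,\infty)^2\to\mathbb R^{d+1}$ is the bilinear interpolation of $Y$ on each unit square: with $\{x\}=x-\lfloor x\rfloor$, $$\begin{aligned}\widetilde Y(u,v)={}&(1-\{u\})(1-\{v\})Y(\lfloor u\rfloor,\lfloor v\rfloor)+\{u\}(1-\{v\})Y(\lfloor u\rfloor+1,\lfloor v\rfloor)\\&+(1-\{u\})\{v\}Y(\lfloor u\rfloor,\lfloor v\rfloor+1)+\{u\}\{v\}Y(\lfloor u\rfloor+1,\lfloor v\rfloor+1).\end{aligned}$$ Numerical approximation: for $N\in\mathbb N$, let $Y$ be the discrete wave map with boundary data $Y_\pm(n):=\phi_\pm(2^{-N}n)$, and set $\Phi_N(\phi_+,\phi_-)(u,v):=\widetilde Y(2^Nu,2^Nv)$ for $(u,v)\in[0,\infty)^2$. *)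

(* Defs.v *)
From HB Require Import structures.
From mathcomp Require Import all_boot all_order all_algebra.
From mathcomp Require Import all_classical all_reals all_analysis.

Set Implicit Arguments.
Unset Strict Implicit.
Unset Printing Implicit Defensive.

Import Order.TTheory GRing.Theory Num.Theory.
Import numFieldNormedType.Exports.

Local Open Scope classical_set_scope.
Local Open Scope ring_scope.

Section Euclidean.
Context {R : realType} {n : nat}.
Implicit Types P Q : 'rV[R]_n.

Definition dot P Q : R := \sum_(i < n) P 0 i * Q 0 i.

(* The library norm on 'rV[R]_n is the maximum norm. *)
Definition enorm P : R := Num.sqrt (dot P P).

Definition unit_sphere : set 'rV[R]_n := [set P | enorm P = 1].

Definition reflection Q P : 'rV[R]_n :=
  if Q == 0 then - P else (2 * (enorm Q) ^- 2 * dot Q P) *: Q - P.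

Definition abs_continuous_on (a b : R) (f : R -> 'rV[R]_n) : Prop :=
  forall e : R, 0 < e -> exists2 delta : R, 0 < delta &
    forall (k : nat) (s t : 'I_k -> R),
      (forall i, [/\ a <= s i, s i <= t i & t i <= b]) ->
      trivIset [set: 'I_k] (fun i => `]s i, t i[%classic) ->
      \sum_(i < k) (t i - s i) < delta ->
      \sum_(i < k) enorm (f (t i) - f (s i)) < e.

Definition loc_abs_continuous (f : R -> 'rV[R]_n) : Prop :=
  forall b : R, 0 < b -> abs_continuous_on 0 b f.

End Euclidean.

Arguments unit_sphere {R} n.

Section WaveMap.
Context {R : realType} {n : nat}.
Local Notation V := 'rV[R]_n.+1.
Local Notation mu := (@lebesgue_measure R).
Implicit Types (phi : R * R -> V) (phip phim : R -> V).

Definition du phi (p : R * R) : V := derive1 (fun w : R => phi (w, p.2)) p.1.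
Definition dv phi (p : R * R) : V := derive1 (fun z : R => phi (p.1, z)) p.2.

(* Maps on [0, u0] x [0, v0] are represented by total functions on R * R, whose
   values elsewhere are arbitrary.  The partial derivatives are two-sided, so
   they depend on phi only through the rectangle at interior points; on the
   boundary, which is a null set, they may not even be measurable.  This is why
   integrability is required on the open rectangle: on the closed one it would
   depend on the arbitrary values. *)
Definition is_wave_map (u0 v0 : R) phip phim phi : Prop :=
  [/\ forall u v : R, 0 <= u <= u0 -> 0 <= v <= v0 -> unit_sphere n.+1 (phi (u, v)),
      {ae (mu \x mu)%E, forall p : R * R, (`[0, u0] `*` `[0, v0]) p ->
         derivable (fun w : R => phi (w, p.2)) p.1 1 /\
         derivable (fun z : R => phi (p.1, z)) p.2 1},
      (mu \x mu)%E.-integrable (`]0, u0[ `*` `]0, v0[)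
         (fun p => (dot (du phi p) (dv phi p))%:E) &
      forall u v : R, 0 <= u <= u0 -> 0 <= v <= v0 ->
        phi (u, v) = phip u + phim v - phip 0
          - \row_(i < n.+1) \int[mu]_(w in `[0, u]) \int[mu]_(z in `[0, v])
              (dot (du phi (w, z)) (dv phi (w, z)) * phi (w, z) 0 i)].

Definition is_global_wave_map phip phim phi : Prop :=
  forall u0 v0 : R, 0 < u0 -> 0 < v0 -> is_wave_map u0 v0 phip phim phi.

End WaveMap.

Section DiscreteWaveMap.
Context {R : realType} {n : nat}.
Local Notation V := 'rV[R]_n.
Implicit Types (Yp Ym : nat -> V) (Y : nat -> nat -> V).

Definition is_discrete_wave_map Yp Ym Y : Prop :=
  [/\ forall m, Y m 0%N = Yp m,
      forall k, Y 0%N k = Ym k &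
      forall m k, Y m.+1 k.+1 = reflection (Y m.+1 k + Y m k.+1) (Y m k)].

Fixpoint discrete_wave_map Yp Ym (m : nat) : nat -> V :=
  if m is m'.+1 then
    fix next_row (k : nat) : V :=
      if k is k'.+1 then
        reflection (next_row k' + discrete_wave_map Yp Ym m' k'.+1)
                   (discrete_wave_map Yp Ym m' k')
      else Yp m
  else Ym.

Lemma discrete_wave_mapP Yp Ym : Yp 0%N = Ym 0%N ->
  is_discrete_wave_map Yp Ym (discrete_wave_map Yp Ym).
Proof. by move=> Y0; split=> // -[|m]. Qed.

Lemma discrete_wave_map_unique Yp Ym Y : is_discrete_wave_map Yp Ym Y ->
  forall m k, Y m k = discrete_wave_map Yp Ym m k.
Proof.
case=> Yl Yr Yrec; elim=> [|m IHm] k; first exact: Yr.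
by elim: k => [|k IHk]; [exact: Yl | rewrite Yrec IHk !IHm].
Qed.

Definition frac (x : R) : R := x - (Num.floor x)%:~R.

(* Num.truncn x is the natural number floor of x for 0 <= x. *)
Definition bilinear_ext Y (p : R * R) : V :=
  let i := Num.truncn p.1 in let j := Num.truncn p.2 in
  let s := frac p.1 in let t := frac p.2 in
  ((1 - s) * (1 - t)) *: Y i j + (s * (1 - t)) *: Y i.+1 j
    + ((1 - s) * t) *: Y i j.+1 + (s * t) *: Y i.+1 j.+1.

Definition numerical_approx (N : nat) (phip phim : R -> V) (p : R * R) : V :=
  bilinear_ext (discrete_wave_map (fun k => phip (2 ^- N * k%:R))
                                  (fun k => phim (2 ^- N * k%:R)))
               (2 ^+ N * p.1, 2 ^+ N * p.2).

End DiscreteWaveMap.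

(* Main.v *)
Require Import Defs.
From HB Require Import structures.
From mathcomp Require Import all_boot all_order all_algebra.
From mathcomp Require Import ring lra.
From mathcomp Require Import all_classical all_reals all_analysis.

From mathcomp Require Import measurable_realfun.

Set Implicit Arguments.
Unset Strict Implicit.
Unset Printing Implicit Defensive.

Import Order.TTheory GRing.Theory Num.Theory.
Import numFieldNormedType.Exports.

Local Open Scope classical_set_scope.
Local Open Scope ring_scope.

(** The discrete wave map conserves the lengths of its grid increments and
    satisfies, on each grid cell with corner [P] and increments [a], [b],
    [box Y = - (a . b) P] up to an error [O(|a| |b| (|a| + |b|))].  The wave map
    satisfies the same recursion: its partial derivatives are, almost everywhere,
    densities of its restrictions to lines, and they vary along the transverse
    direction by at most the integral of [|du phi . dv phi|], so that on each cell
    [box phi = - (a . b) P] up to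
    [(\int_cell |du phi . dv phi|) * o(1)].  Both errors, summed over all cells of
    a square, tend to zero, and a two-dimensional discrete Gronwall inequality
    bounds the difference of the two maps at the grid points. *)

(** * Integrals of nonmeasurable functions *)

(** The obstacle is how little regularity a wave map is given: nothing says that it is measurable,
    continuous, or absolutely continuous along lines, so the integral equation has to supply all of
    this. Its right side is an iterated integral of a possibly nonmeasurable function. Treated as a
    lower integral, up to constant factors, it still yields continuity, hence measurability, and
    only then does it become an integral over the product. Almost everywhere derivability of the
    boundary data is in turn read off from the wave map on a typical line; uniform integrability of
    difference quotients then provides densities.

    The o(1) has one source. Increments of the wave map along a line are at most integrals of fixed
    integrable functions A(u) and B(v), the same for all parallel lines. Over a cell of side 2^-N
    these integrals tend to zero uniformly, by absolute continuity of the integral, whereas the sums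
    over all cells of (int A)(int B) and of int |du phi . dv phi| stay bounded. Each error term
    contains one small factor and one summable factor. *)

Section LowerIntegral.
Context (d : measure_display) (T : measurableType d) (R : realType).
Variable mu : {measure set T -> \bar R}.
Implicit Types (f g k : T -> \bar R).
Local Open Scope ereal_scope.
Import HBNNSimple.

(** The integral of a nonnegative function is the supremum of the integrals of the simple functions
    below it, and a larger function has more of them. *)
Lemma ge0_le_integral_nonmeas f g : (forall x, 0 <= f x) ->
  (forall x, f x <= g x) -> \int[mu]_x f x <= \int[mu]_x g x.
Proof.
move=> f0 fg; have g0 x : 0 <= g x by exact: le_trans (f0 x) (fg x).
rewrite !ge0_integralTE//; apply: ereal_sup_le => _ [h /= hf <-].
by exists h => // x; exact: le_trans (hf x) (fg x).
Qed.

(* A wave map is not assumed to be measurable.  The integral of a nonnegative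
   nonmeasurable function is a lower integral, which is still subadditive when
   one of the two terms is measurable. *)
Lemma le_integralD_nonmeas f f' g : (forall x, 0 <= f x) ->
  (forall x, 0 <= f' x) -> (forall x, 0 <= g x) -> measurable_fun setT g ->
  (forall x, f x <= f' x + g x) ->
  \int[mu]_x f x <= \int[mu]_x f' x + \int[mu]_x g x.
Proof.
move=> f0 f'0 g0 mg ffg; rewrite [leLHS]ge0_integralTE//.
apply: ge_ereal_sup => _ [h /= hf <-].
(* For a simple [h] below [f], the positive part of [h - g] is measurable, lies below [f'], and
   together with [g] dominates [h]. *)
pose s x := maxe ((h x)%:E - g x) 0.
have s0 x : 0 <= s x by rewrite /s le_max lexx orbT.
have mh : measurable_fun setT (fun x => (h x)%:E) by exact/measurable_EFinP.
have ms : measurable_fun setT s.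
  by apply: measurable_maxe => //; apply: emeasurable_funB.
rewrite -integralT_nnsfun; apply: (@le_trans _ _ (\int[mu]_x (s x + g x))).
  apply: ge0_le_integral_nonmeas => x; first by rewrite lee_fin.
  rewrite /s; have := g0 x; case: (g x) => [r| |] // r0.
  - by rewrite -leeBlDr// le_max lexx.
  - by rewrite addey ?leey// -ltNye; by rewrite lt_max ltNy0 orbT.
rewrite ge0_integralD//; apply: leeD => //.
apply: ge0_le_integral_nonmeas => // x.
rewrite /s ge_max f'0 andbT; have := le_trans (hf x) (ffg x); have := g0 x.
case: (g x) => [r| |] // r0; first by rewrite leeBlDr.
by rewrite addeNy leNye.
Qed.

(** A real integral is the difference of the lower integrals of the positive and negative parts.
    Each part is a 1-Lipschitz function of the value, so each lower integral moves by at most the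
    integral of [g]; hence the factor 2. The bound [k] keeps all four lower integrals finite, so
    that [fine] returns their true values. *)
Lemma Rintegral_close_nonmeas (f1 f2 : T -> R) g k :
  (forall x, 0 <= g x) -> measurable_fun setT g ->
  (forall x, `|f1 x|%:E <= k x) -> (forall x, `|f2 x|%:E <= k x) ->
  \int[mu]_x k x < +oo -> (forall x, `|f1 x - f2 x|%:E <= g x) ->
  `|Rintegral mu setT f1 - Rintegral mu setT f2|%:E <= 2%:E * \int[mu]_x g x.
Proof.
move=> g0 mg f1k f2k kfin fg.
have G0 : 0 <= \int[mu]_x g x by exact: integral_ge0.
have [->|Gfin] := eqVneq (\int[mu]_x g x) +oo.
  by rewrite muleC gt0_mulye ?leey// lte_fin.
have parts (f : T -> R) : (forall x, `|f x|%:E <= k x) ->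
    (\int[mu]_x (EFin \o f)^\+ x \is a fin_num) /\
    (\int[mu]_x (EFin \o f)^\- x \is a fin_num).
  move=> fk; split; (rewrite ge0_fin_numE; last exact: integral_ge0);
    (apply: le_lt_trans kfin; apply: ge0_le_integral_nonmeas => // x);
    (apply: le_trans (fk x)); rewrite ?(funeposE, funenegE)/= -EFin_max lee_fin.
    by rewrite ge_max ler_norm normr_ge0.
  by rewrite ge_max normr_ge0 andbT -normrN ler_norm.
have [p1 n1] := parts _ f1k; have [p2 n2] := parts _ f2k.
have cmp (e1 e2 : T -> \bar R) : (forall x, 0 <= e1 x) -> (forall x, 0 <= e2 x) ->
    (forall x, e1 x <= e2 x + g x) ->
    \int[mu]_x e1 x \is a fin_num -> \int[mu]_x e2 x \is a fin_num ->
    (fine (\int[mu]_x e1 x) <= fine (\int[mu]_x e2 x) + fine (\int[mu]_x g x))%R.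
  move=> e10 e20 e12 fin1 fin2.
  rewrite -lee_fin EFinD !fineK//; first exact: le_integralD_nonmeas.
  by rewrite ge0_fin_numE// ltey.
have pt (a b : R) x : `|a - b|%:E <= g x -> maxe a%:E 0 <= maxe b%:E 0 + g x.
  move=> abg; apply: (@le_trans _ _ (maxe b%:E 0 + `|a - b|%:E)); last exact: leeD.
  rewrite -!EFin_max -EFinD lee_fin.
  have := ler_norm (a - b)%R; rewrite ge_max => h; apply/andP; split.
    have : (b <= Num.max b 0)%R by rewrite le_max lexx.
    by move: h; lra.
  have : (0 <= Num.max b 0)%R by rewrite le_max lexx orbT.
  by have := normr_ge0 (a - b)%R; lra.
have fg' x : `|f2 x - f1 x|%:E <= g x by rewrite distrC.
have fgN x : `|- f1 x - - f2 x|%:E <= g x by rewrite -opprD normrN.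
have fgN' x : `|- f2 x - - f1 x|%:E <= g x by rewrite -opprD normrN distrC.
have q1 : (fine (\int[mu]_x (EFin \o f1)^\+ x) <=
    fine (\int[mu]_x (EFin \o f2)^\+ x) + fine (\int[mu]_x g x))%R.
  by apply: cmp => // x; rewrite ?(funeposE, funenegE); exact: pt.
have q2 : (fine (\int[mu]_x (EFin \o f2)^\+ x) <=
    fine (\int[mu]_x (EFin \o f1)^\+ x) + fine (\int[mu]_x g x))%R.
  by apply: cmp => // x; rewrite ?(funeposE, funenegE); exact: pt.
have q3 : (fine (\int[mu]_x (EFin \o f1)^\- x) <=
    fine (\int[mu]_x (EFin \o f2)^\- x) + fine (\int[mu]_x g x))%R.
  by apply: cmp => // x; rewrite ?(funeposE, funenegE); exact: pt.
have q4 : (fine (\int[mu]_x (EFin \o f2)^\- x) <=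
    fine (\int[mu]_x (EFin \o f1)^\- x) + fine (\int[mu]_x g x))%R.
  by apply: cmp => // x; rewrite ?(funeposE, funenegE); exact: pt.
rewrite /Rintegral (integralE mu setT (EFin \o f1)) (integralE mu setT (EFin \o f2)).
rewrite (fineB p1 n1) (fineB p2 n2).
rewrite -[\int[mu]_x g x]fineK ?ge0_fin_numE ?ltey// -EFinM lee_fin.
by rewrite ler_norml; apply/andP; split; lra.
Qed.

End LowerIntegral.

Section InftyOn.
Context (d : measure_display) (T : measurableType d) (R : realType).
Variable mu : {measure set T -> \bar R}.
Local Open Scope ereal_scope.

(** A penalty that turns an inequality valid off a null set into one valid everywhere, at no cost in
    the integral of the larger side. This way null sets can be ignored even when the smaller side is
    not measurable. *)
Definition infty_on (N : set T) (x : T) : \bar R := if x \in N then +oo else 0.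

Lemma infty_on_ge0 N x : 0 <= infty_on N x.
Proof. by rewrite /infty_on; case: ifP. Qed.

Lemma measurable_infty_on N : measurable N -> measurable_fun setT (infty_on N).
Proof.
move=> mN; apply: measurable_fun_ifT => //.
apply: (measurable_fun_bool true); rewrite setTI.
by rewrite [X in measurable X](_ : _ = N)//; apply/seteqP; split => x; [exact: set_mem|exact: mem_set].
Qed.

Lemma integral_infty_on N : measurable N -> mu N = 0 -> \int[mu]_x infty_on N x = 0.
Proof.
move=> mN N0; rewrite -(integral0 mu setT).
apply: ae_eq_integral => //; first exact: measurable_infty_on.
exists N; split => // x /= xN; apply: contrapT => nNx; apply: xN => _.
by rewrite /infty_on memNset.
Qed.

Lemma integralD_infty_on (f : T -> \bar R) N : (forall x, 0 <= f x) ->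
  measurable_fun setT f -> measurable N -> mu N = 0 ->
  \int[mu]_x (f x + infty_on N x) = \int[mu]_x f x.
Proof.
move=> f0 mf mN N0; rewrite ge0_integralD//.
- by rewrite integral_infty_on// adde0.
- by move=> x _; exact: infty_on_ge0.
- exact: measurable_infty_on.
Qed.

End InftyOn.

Arguments infty_on {d T R} N x.

Section IteratedIntegral.
Context (d1 d2 : measure_display) (T1 : measurableType d1) (T2 : measurableType d2).
Context (R : realType).
Variables (m1 : {sigma_finite_measure set T1 -> \bar R}).
Variables (m2 : {sigma_finite_measure set T2 -> \bar R}).
Local Open Scope ereal_scope.

Lemma null_infty_section (k : T1 * T2 -> \bar R) : (forall p, 0 <= k p) ->
  measurable_fun setT k -> \int[m1 \x m2]_p k p < +oo ->
  measurable [set x | \int[m2]_y k (x, y) = +oo] /\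
  m1 [set x | \int[m2]_y k (x, y) = +oo] = 0.
Proof.
move=> k0 mk kfin; have mK := measurable_fun_fubini_tonelli_F (m2 := m2) k mk k0.
have mX : measurable [set x | \int[m2]_y k (x, y) = +oo].
  by rewrite -[X in measurable X]setTI; exact: (mK measurableT [set +oo] (emeasurable_set1 _)).
split => //; have iK : m1.-integrable setT (fubini_F m2 k).
  apply/integrableP; split => //; rewrite fubini_tonelli1// in kfin.
  by under eq_integral do rewrite gee0_abs ?integral_ge0//.
have [N [mN N0 sN]] := integrable_ae measurableT iK.
apply: subset_measure0 (mX) mN _ N0 => x /= Kx; apply: sN => /= /(_ I).
by rewrite /fubini_F Kx.
Qed.

(** The one-variable comparison is used for the inner and for the outer integral, which gives 2 * 2
    = 4. On the null set [X] of the [x] whose section of [k] has infinite integral the inner real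
    integrals are uncontrolled, and the penalty [infty_on X] absorbs them. *)
Lemma iterated_Rintegral_close_nonmeas (f1 f2 : T1 * T2 -> R) g k :
  (forall p, 0 <= g p) -> measurable_fun setT g ->
  (forall p, 0 <= k p) -> measurable_fun setT k ->
  (forall p, `|f1 p|%:E <= k p) -> (forall p, `|f2 p|%:E <= k p) ->
  \int[m1 \x m2]_p k p < +oo -> (forall p, `|f1 p - f2 p|%:E <= g p) ->
  `|(\int[m1]_x \int[m2]_y f1 (x, y))%R - (\int[m1]_x \int[m2]_y f2 (x, y))%R|%:E
    <= 4%:E * \int[m1 \x m2]_p g p.
Proof.
move=> g0 mg k0 mk f1k f2k kfin fg.
have [mX X0] := null_infty_section k0 mk kfin; set X := [set x | _] in mX X0.
have mK := measurable_fun_fubini_tonelli_F (m2 := m2) k mk k0.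
have mG := measurable_fun_fubini_tonelli_F (m2 := m2) g mg g0.
have K0 x : 0 <= fubini_F m2 k x by exact: integral_ge0.
have G0 x : 0 <= fubini_F m2 g x by exact: integral_ge0.
have secg x : measurable_fun setT (fun y => g (x, y)) by exact: measurableT_comp.
have seck x : measurable_fun setT (fun y => k (x, y)) by exact: measurableT_comp.
have kfin' : \int[m1]_x fubini_F m2 k x < +oo by rewrite -fubini_tonelli1.
have two0 : 0 <= 2%:E :> \bar R by rewrite lee_fin.
pose G x := 2%:E * fubini_F m2 g x + infty_on X x.
pose K x := 2%:E * fubini_F m2 k x + infty_on X x.
have mono (f : T1 * T2 -> R) x : (forall p, `|f p|%:E <= k p) -> ~ X x ->
    `|(\int[m2]_y f (x, y))%R|%:E <= 2%:E * fubini_F m2 k x.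
  move=> fk nXx; rewrite -[X in (`|X|%R)%:E]subr0.
  have <- : (\int[m2]_y (cst 0 : T2 -> R) y = 0)%R by rewrite /Rintegral integral0.
  apply: (@Rintegral_close_nonmeas _ _ _ _ _ _ _ (fun y => k (x, y))) => //=.
  - by move=> y; rewrite normr0.
  - by rewrite ltey; apply/eqP.
  - by move=> y; rewrite subr0.
have -> : 4%:E * \int[m1 \x m2]_p g p = 2%:E * \int[m1]_x G x.
  rewrite integralD_infty_on//.
  - rewrite ge0_integralZl// fubini_tonelli1// muleA -EFinM.
    by congr (_%:E * _); rewrite -natrM.
  - by move=> x; rewrite mule_ge0.
  - by exact: (measurable_funeM 2%:E mG).
apply: (@Rintegral_close_nonmeas _ _ _ _ _ _ _ K).
- by move=> x; rewrite adde_ge0 ?mule_ge0 ?infty_on_ge0.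
- apply: emeasurable_funD; first exact: (measurable_funeM 2%:E mG).
  exact: measurable_infty_on.
- move=> x; rewrite /K /infty_on; case: (boolP (x \in X)) => [_|].
    by rewrite addey ?leey// gt_eqF// (lt_le_trans (ltNyr 0))// mule_ge0.
  by rewrite notin_setE adde0 => nXx; exact: mono.
- move=> x; rewrite /K /infty_on; case: (boolP (x \in X)) => [_|].
    by rewrite addey ?leey// gt_eqF// (lt_le_trans (ltNyr 0))// mule_ge0.
  by rewrite notin_setE adde0 => nXx; exact: mono.
- rewrite integralD_infty_on//.
  + by rewrite ge0_integralZl// lte_mul_pinfty//.
  + by move=> x; rewrite mule_ge0.
  + by exact: (measurable_funeM 2%:E mK).
- move=> x; rewrite /G /infty_on; case: (boolP (x \in X)) => [_|].
    by rewrite addey ?leey// gt_eqF// (lt_le_trans (ltNyr 0))// mule_ge0.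
  rewrite notin_setE adde0 => nXx.
  apply: (@Rintegral_close_nonmeas _ _ _ _ _ _ _ (fun y => k (x, y))) => //=.
  by rewrite ltey; apply/eqP.
Qed.

End IteratedIntegral.

(** * Integration on the plane *)

(** The plane carries the product sigma-algebra, so an open set has to be exhibited as a countable
    union of rectangles; those with rational corners suffice. *)
Lemma continuous2_measurable_fun (R : realType) (f : R * R -> R) :
  continuous f -> measurable_fun setT f.
Proof.
move=> /continuousP cf; apply: (measurability _ (RGenOpens.measurableE R)).
move=> _ [_ [a [b ->] <-]]; rewrite setTI.
have := cf _ (@interval_open _ (BRight a) (BLeft b) isT isT).
set A := _ @^-1` _ => oA.
pose B (q : rat * rat * (rat * rat)) : set (R * R) :=
  `]ratr q.1.1, ratr q.1.2[ `*` `]ratr q.2.1, ratr q.2.2[.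
(* Rectangles that leave [A] are replaced by the empty set, so that the union runs over all rational
   quadruples. *)
pose C q := if `[< B q `<=` A >] then B q else set0.
have -> : A = \bigcup_q C q.
  apply/seteqP; split => [p Ap|p [q _]]; last first.
    by rewrite /C; case: asboolP => // BA /BA.
  have /nbhs_ballP[e /= e0 eA] : nbhs p A by exact: open_nbhs_nbhs.
  have rb (x : R) : exists ab : rat * rat, [/\ x - e < ratr ab.1, ratr ab.1 < x,
      x < ratr ab.2 & ratr ab.2 < x + e].
    have [a' /itvP xa] := rat_in_itvoo (x := x - e) (y := x) ltac:(lra).
    have [b' /itvP xb] := rat_in_itvoo (x := x) (y := x + e) ltac:(lra).
    by exists (a', b'); rewrite /= !xa !xb.
  have [ab [h1 h2 h3 h4]] := rb p.1; have [cd [h5 h6 h7 h8]] := rb p.2.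
  exists (ab, cd) => //; rewrite /C; case: asboolP => [_|].
    by split => /=; rewrite in_itv/= ?h2 ?h3 ?h6 ?h7.
  case=> -[x y] [/= ]; rewrite !in_itv/= => /andP[x1 x2] /andP[y1 y2].
  by apply: eA; split => /=; rewrite /ball/= ltr_distl; apply/andP; split; lra.
apply: countable_bigcupT_measurable => [|q]; first exact: countableP.
rewrite /C; case: ifP => // _.
exact: measurableX.
Qed.


Lemma integrable_patch (d : measure_display) (T : measurableType d) (R : realType)
    (mu : {measure set T -> \bar R}) (f : T -> R) (A : set T) :
  measurable A -> mu.-integrable setT (EFin \o f) ->
  mu.-integrable setT (EFin \o (f \_ A)).
Proof.
move=> mA intf; rewrite -restrict_EFin; apply/integrable_restrict => //.
by rewrite setTI; apply: integrableS intf.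
Qed.

Section Sections.
Context (R : realType).
Local Notation mu := (@lebesgue_measure R).
Local Notation mu2 := (mu \x mu)%E.
Implicit Types (f : R * R -> R) (A : set R).

(** Fubini makes almost all sections integrable. Setting the function to zero on the exceptional
    vertical and horizontal lines, which form a null set, makes all of them integrable; iterated
    real integrals of the result never meet a default value. *)
Lemma ae_integrable_sections f : mu2.-integrable setT (EFin \o f) ->
  exists f0 : R * R -> R, [/\ mu2.-integrable setT (EFin \o f0),
    forall x, mu.-integrable setT (fun y => (f0 (x, y))%:E),
    forall y, mu.-integrable setT (fun x => (f0 (x, y))%:E) &
    exists N : set (R * R), [/\ measurable N, mu2 N = 0%E &
      forall p, ~ N p -> f0 p = f p]].
Proof.
move=> intf.
have /ae_integrable1[X [mX X0 sX]] := intf.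
have /ae_integrable2[Y [mY Y0 sY]] := intf.
have mf : measurable_fun setT f by have /measurable_int/measurable_EFinP := intf.
pose N : set (R * R) := (X `*` setT) `|` (setT `*` Y).
have mXT : measurable (X `*` [set: R]) by exact: measurableX.
have mTY : measurable ([set: R] `*` Y) by exact: measurableX.
have mN : measurable N by exact: measurableU.
have N0 : mu2 N = 0%E.
  rewrite /= in X0 Y0.
  have e1 : mu2 (X `*` setT) = 0%E by rewrite /= product_measure1E//= X0 mul0e.
  have e2 : mu2 (setT `*` Y) = 0%E by rewrite /= product_measure1E//= Y0 mule0.
  by rewrite measureU0.
have bound p : `|(f \_ (~` N)) p| <= `|f p|.
  by rewrite patchE; case: ifP => // _; rewrite normr0.
have mf0 : measurable_fun setT (f \_ (~` N)).
  apply/measurable_restrict => //; rewrite ?setTI; first exact: measurableC.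
  exact: measurable_funTS.
exists (f \_ (~` N)); split.
- apply: le_integrable intf => //; first exact/measurable_EFinP.
  by move=> p _; rewrite /= lee_fin.
- move=> x; have [Xx|nXx] := pselect (X x).
    rewrite [X in _.-integrable _ X](_ : _ = cst 0%E); first exact: integrable0.
    apply/funext => y; rewrite patchE memNset// => NN; apply: NN.
    by left.
  have : mu.-integrable setT (fun y => (f (x, y))%:E).
    by apply: contrapT => /sX.
  apply: le_integrable => //.
    by apply/measurable_EFinP; exact: (measurableT_comp mf0).
  by move=> y _; rewrite /= lee_fin.
- move=> y; have [Yy|nYy] := pselect (Y y).
    rewrite [X in _.-integrable _ X](_ : _ = cst 0%E); first exact: integrable0.
    apply/funext => x; rewrite patchE memNset// => NN; apply: NN.
    by right.
  have : mu.-integrable setT (fun x => (f (x, y))%:E).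
    by apply: contrapT => /sY.
  apply: le_integrable => //.
    by apply/measurable_EFinP; exact: (measurableT_comp mf0).
  by move=> x _; rewrite /= lee_fin.
- by exists N; split => // p nNp; rewrite patchE mem_set.
Qed.

(* If all sections are integrable, the iterated real-valued integrals carry no junk values. *)
Lemma integrable_Rintegral_section f A : measurable A ->
  mu2.-integrable setT (EFin \o f) ->
  (forall x, mu.-integrable setT (fun y => (f (x, y))%:E)) ->
  mu.-integrable setT (fun x => (\int[mu]_(y in A) f (x, y))%:E).
Proof.
move=> mA intf sec.
pose fA (p : R * R) := (f \_ (setT `*` A)) p.
have mTA : measurable ([set: R] `*` A) by exact: measurableX.
have intfA : mu2.-integrable setT (EFin \o fA).
  exact: integrable_patch.
apply: eq_integrable (integrable_fubini_F intfA) => //= x _.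
rewrite /fubini_F /Rintegral fineK.
  rewrite [RHS]integral_mkcond; apply: eq_integral => y _.
  rewrite /fA/= !patchE; case: ifPn => [/set_mem[_ Ay]|].
    by rewrite mem_set.
  by rewrite notin_setE => nA; rewrite memNset// => Ay; apply: nA.
by apply: integrable_fin_num => //; apply: integrableS (sec x).
Qed.

Lemma Rintegral_section f A B : measurable A -> measurable B ->
  mu2.-integrable setT (EFin \o f) ->
  (forall x, mu.-integrable setT (fun y => (f (x, y))%:E)) ->
  \int[mu2]_(p in A `*` B) f p = \int[mu]_(x in A) \int[mu]_(y in B) f (x, y).
Proof.
move=> mA mB intf sec.
have mAB : measurable (A `*` B) by exact: measurableX.
rewrite [LHS]Rintegral_mkcond [RHS]Rintegral_mkcond {1}/Rintegral.
rewrite -integral12_prod_meas1; last exact: integrable_patch.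
congr fine; apply: eq_integral => x _; rewrite /fubini_F patchE; case: ifPn => [/set_mem Ax|].
  rewrite /Rintegral fineK; last first.
    by apply: integrable_fin_num => //; apply: integrableS (sec x).
  rewrite [RHS]integral_mkcond; apply: eq_integral => y _; rewrite /= !patchE.
  case: ifPn => [/set_mem[_ By]|]; first by rewrite mem_set.
  by rewrite notin_setE => nA; rewrite memNset// => By; apply: nA.
rewrite notin_setE => nAx; apply: integral0_eq => y _; rewrite patchE memNset//.
by case.
Qed.

Lemma integrable_swap f : mu2.-integrable setT (EFin \o f) ->
  mu2.-integrable setT (fun p => (f (p.2, p.1))%:E).
Proof.
move=> intf; have mf := measurable_int _ intf.
have mf' : measurable_fun setT (fun p : R * R => (f (p.2, p.1))%:E).
  apply: (measurableT_comp mf).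
  by apply/measurable_fun_pair; [exact: measurable_snd|exact: measurable_fst].
apply/integrable12ltyP => //=.
by have /integrable21ltyP := intf; apply.
Qed.

Lemma Rintegral_section_swap f A B : measurable A -> measurable B ->
  mu2.-integrable setT (EFin \o f) ->
  \int[mu2]_(p in A `*` B) f p = \int[mu2]_(p in B `*` A) f (p.2, p.1).
Proof.
move=> mA mB intf; have intf' := integrable_swap intf.
have mAB : measurable (A `*` B) by exact: measurableX.
have mBA : measurable (B `*` A) by exact: measurableX.
rewrite [LHS]Rintegral_mkcond [RHS]Rintegral_mkcond /Rintegral.
rewrite -integral21_prod_meas1; last exact: integrable_patch.
rewrite -integral12_prod_meas1; last exact: integrable_patch.
congr fine; apply: eq_integral => x _; apply: eq_integral => y _.
rewrite /= !patchE; congr (if _ then _ else _)%:E.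
by apply/idP/idP => /set_mem[/= ? ?]; apply/mem_set.
Qed.

Lemma product_measure_ysection (N : set (R * R)) : measurable N ->
  mu2 N = (\int[mu]_y mu (ysection N y))%E.
Proof.
move=> mN; rewrite -[RHS]/((mu \x^ mu)%E N).
by apply: product_measure_unique => // A B mA mB; exact: product_measure2E.
Qed.

Lemma null_ysections (N : set (R * R)) : measurable N ->
  (forall y, mu (ysection N y) = 0%E) -> mu2 N = 0%E.
Proof.
by move=> mN N0; rewrite product_measure_ysection//; exact: integral0_eq.
Qed.

Lemma null_swap (N : set (R * R)) : measurable N -> mu2 N = 0%E ->
  let N' := [set p | N (p.2, p.1)] in measurable N' /\ mu2 N' = 0%E.
Proof.
move=> mN N0 N'.
have mN' : measurable N'.
  have := measurable_fun_pair (@measurable_snd _ _ R R) (@measurable_fst _ _ R R).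
  by move=> /(_ measurableT N mN); rewrite setTI.
by split => //; rewrite -N0 product_measure_ysection.
Qed.

Lemma ae_sections (N : set (R * R)) : measurable N -> mu2 N = 0%E ->
  {ae mu, forall y, mu (ysection N y) = 0%E}.
Proof.
move=> mN; rewrite product_measure_ysection// => N0.
have mG : measurable_fun setT (fun y => mu (ysection N y)).
  exact: measurable_fun_ysection.
have : ae_eq mu setT (fun y => mu (ysection N y)) (cst 0%E).
  apply/ae_eq_integral_abs => //.
  by under eq_integral do rewrite gee0_abs//.
by apply: filterS => y /= /(_ I).
Qed.
End Sections.

(** * Continuity of wave maps *)

Lemma integral_itv_modulus (R : realType) (A : R -> R) (e : R) :
  (@lebesgue_measure R).-integrable setT (EFin \o A) -> 0 < e ->
  exists2 dl : R, 0 < dl & forall a b, a <= b -> b - a < dl ->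
    \int[lebesgue_measure]_(x in `]a, b]) `|A x| < e.
Proof.
move=> intA e0; have [dl [dl0 h]] := integral_normr_continuous intA e0.
exists dl => // a b ab bad; apply: h => //.
rewrite /= lebesgue_measure_itv/= lte_fin; case: ifPn => _; last by rewrite lte_fin.
by rewrite -EFinD lte_fin.
Qed.

(** * Dependence of the iterated integral on the corner of the rectangle *)

Section WaveIntegral.
Context (R : realType).
Local Notation mu := (@lebesgue_measure R).
Local Notation mu2 := (mu \x mu)%E.
Variables (S : R) (F F0 c : R * R -> R) (N : set (R * R)).
Let Q : set (R * R) := `]0, S[ `*` `]0, S[.
Hypothesis S0 : 0 < S.
Hypothesis intF0 : mu2.-integrable setT (EFin \o F0).
Hypothesis sec1 : forall x, mu.-integrable setT (fun y => (F0 (x, y))%:E).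
Hypothesis sec2 : forall y, mu.-integrable setT (fun x => (F0 (x, y))%:E).
Hypothesis mN : measurable N.
Hypothesis N0 : mu2 N = 0%E.
Hypothesis F0F : forall p, ~ N p -> F0 p = (F \_ Q) p.
Hypothesis c1 : forall u v, 0 <= u <= S -> 0 <= v <= S -> `|c (u, v)| <= 1.

(** The edges of the square are included because the wave map equation integrates over closed
    intervals, whereas [F0] represents [F] only on the open square. Off [B], every point of a closed
    rectangle is interior and [F0] agrees with [F] there. *)
Let B : set (R * R) := N `|` ((([set 0] `|` [set S]) `*` setT) `|`
  (setT `*` ([set 0] `|` [set S]))).

Let mB : measurable B.
Proof.
by apply: measurableU => //; apply: measurableU; apply: measurableX => //;
  exact: measurableU.
Qed.

Let B0 : mu2 B = 0%E.
Proof.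
have mP : measurable ([set 0] `|` [set S] : set R) by exact: measurableU.
have muP : mu ([set 0] `|` [set S] : set R) = 0%E.
  by rewrite measureU0//= lebesgue_measure_set1.
rewrite /= in muP.
have e1 : mu2 (([set 0] `|` [set S]) `*` setT) = 0%E.
  by rewrite /= product_measure1E//= muP mul0e.
have e2 : mu2 (setT `*` ([set 0] `|` [set S])) = 0%E.
  by rewrite /= product_measure1E//= muP mule0.
have m1 : measurable ((([set 0] `|` [set S]) : set R) `*` [set: R]) by exact: measurableX.
have m2 : measurable ([set: R] `*` (([set 0] `|` [set S]) : set R)) by exact: measurableX.
have e3 : mu2 ((([set 0] `|` [set S]) `*` setT) `|` (setT `*` ([set 0] `|` [set S]))) = 0%E.
  by rewrite measureU0.
by rewrite /B measureU0//; exact: measurableU.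
Qed.

Let f (u v : R) (p : R * R) : R := ((fun p => F p * c p) \_ (`[0, u] `*` `[0, v])) p.

Let fE u v : \int[mu]_(w in `[0, u]) \int[mu]_(z in `[0, v]) (F (w, z) * c (w, z)) =
  \int[mu]_w \int[mu]_z f u v (w, z).
Proof.
rewrite [LHS]Rintegral_mkcond; apply: eq_Rintegral => w _; rewrite patchE.
case: ifPn => [/set_mem wu|]; last rewrite notin_setE => wu.
  rewrite [LHS]Rintegral_mkcond; apply: eq_Rintegral => z _.
  rewrite /f !patchE; congr (if _ then _ else _).
  by apply/idP/idP => /set_mem h; apply/mem_set => //; case: h.
by rewrite /Rintegral integral0_eq// => z _; rewrite /f patchE memNset// => -[].
Qed.

(** A single integrable bound for all the integrands [f u v]; it is infinite on [B], where [F] is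
    arbitrary. *)
Let k (p : R * R) : \bar R := (`|F0 p|%:E + infty_on B p)%E.

Let mF0 : measurable_fun setT F0.
Proof. by have /measurable_int/measurable_EFinP := intF0. Qed.

Let k0 p : (0 <= k p)%E.
Proof. by rewrite adde_ge0 ?infty_on_ge0// lee_fin. Qed.

Let mk : measurable_fun setT k.
Proof.
apply: emeasurable_funD; last exact: measurable_infty_on.
by apply/measurable_EFinP; exact: measurableT_comp.
Qed.

Let kfin : (\int[mu2]_p k p < +oo)%E.
Proof.
rewrite integralD_infty_on//.
- by have /integrableP[] := intF0.
- by apply/measurable_EFinP; exact: measurableT_comp.
Qed.

Let interior u v p : 0 <= u <= S -> 0 <= v <= S -> ~ B p ->
  (`[0, u] `*` `[0, v]) p -> [/\ F0 p = F p, `|c p| <= 1 & (`]0, u] `*` `]0, v]) p].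
Proof.
case: p => w z uS vS nB [/=]; rewrite !in_itv/= => /andP[w0 wu] /andP[z0 zv].
have [nw0 nz0 nwS nzS nN] : [/\ w != 0, z != 0, w != S, z != S & ~ N (w, z)].
  split; [apply/eqP=> h|apply/eqP=> h|apply/eqP=> h|apply/eqP=> h|move=> h];
    apply: nB; rewrite /B/=.
  - by right; left; split => //; left.
  - by right; right; split => //; left.
  - by right; left; split => //; right.
  - by right; right; split => //; right.
  - by left.
have w0' : 0 < w by rewrite lt_neqAle eq_sym nw0.
have z0' : 0 < z by rewrite lt_neqAle eq_sym nz0.
have wS' : w < S by rewrite lt_neqAle nwS/=; lra.
have zS' : z < S by rewrite lt_neqAle nzS/=; lra.
split; last by split; rewrite /= ?in_itv/= ?w0' ?z0'.
  rewrite F0F// patchE mem_set//; split; rewrite /= ?in_itv/=; lra.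
by apply: c1; lra.
Qed.

Let f_le_k u v : 0 <= u <= S -> 0 <= v <= S -> forall p, (`|f u v p|%:E <= k p)%E.
Proof.
move=> uS vS p; rewrite /k /infty_on; case: ifPn => [_|].
  by rewrite addey ?leey.
rewrite notin_setE adde0 lee_fin /f patchE => nB; case: ifPn => [/set_mem pu|_].
  have [-> cp _] := interior uS vS nB pu.
  by rewrite normrM -[leRHS]mulr1; apply: ler_wpM2l.
by rewrite normr0.
Qed.

(** Off [B] the two integrands differ only at points that lie in exactly one of the two rectangles.
    Such a point lies in the vertical strip between [u] and [u'] or in the horizontal strip between
    [v] and [v'], and the difference is at most [|F0|]. The 4 is the constant of the nonmeasurable
    comparison. *)
Lemma wave_integral_close u v u' v' : 0 <= u <= S -> 0 <= v <= S ->
  0 <= u' <= S -> 0 <= v' <= S ->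
  `|\int[mu]_(w in `[0, u]) \int[mu]_(z in `[0, v]) (F (w, z) * c (w, z))
   - \int[mu]_(w in `[0, u']) \int[mu]_(z in `[0, v']) (F (w, z) * c (w, z))| <=
  4 * (\int[mu]_(w in `]Num.min u u', Num.max u u']) (\int[mu]_z `|F0 (w, z)|)
     + \int[mu]_(z in `]Num.min v v', Num.max v v']) (\int[mu]_w `|F0 (w, z)|)).
Proof.
move=> uS vS u'S v'S; rewrite !fE.
set W := `]_, _]%classic; set Z := `]Num.min v v', _]%classic.
pose aF p := `|F0 p|.
have intaF : mu2.-integrable setT (EFin \o aF).
  apply: le_integrable intF0 => //.
    by apply/measurable_EFinP; exact: measurableT_comp.
  by move=> p _; rewrite /= lee_fin normr_id.
have asec1 x : mu.-integrable setT (fun y => (aF (x, y))%:E).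
  apply: le_integrable (sec1 x) => //.
    by apply/measurable_EFinP; apply: measurableT_comp => //; exact: measurableT_comp.
  by move=> p _; rewrite /= lee_fin normr_id.
have asec2 y : mu.-integrable setT (fun x => (aF (x, y))%:E).
  apply: le_integrable (sec2 y) => //.
    by apply/measurable_EFinP; apply: measurableT_comp => //; exact: measurableT_comp.
  by move=> p _; rewrite /= lee_fin normr_id.
have mW : measurable W by exact: measurable_itv.
have mZ : measurable Z by exact: measurable_itv.
have mWT : measurable (W `*` [set: R]) by exact: measurableX.
have mTZ : measurable ([set: R] `*` Z) by exact: measurableX.
pose g1 p : \bar R := ((aF \_ (W `*` setT)) p)%:E.
pose g2 p : \bar R := ((aF \_ (setT `*` Z)) p)%:E.
have ig1 : mu2.-integrable setT g1 by exact: integrable_patch.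
have ig2 : mu2.-integrable setT g2 by exact: integrable_patch.
have g10 p : (0 <= g1 p)%E.
  by rewrite lee_fin patchE; case: ifP => // _; exact: normr_ge0.
have g20 p : (0 <= g2 p)%E.
  by rewrite lee_fin patchE; case: ifP => // _; exact: normr_ge0.
have mg1 := measurable_int _ ig1; have mg2 := measurable_int _ ig2.
pose g p : \bar R := ((g1 p + g2 p) + infty_on B p)%E.
have g0 p : (0 <= g p)%E.
  by apply: adde_ge0; [exact: adde_ge0|exact: infty_on_ge0].
have mg : measurable_fun setT g.
  by apply: emeasurable_funD; [exact: emeasurable_funD|exact: measurable_infty_on].
have fg p : (`|f u v p - f u' v' p|%:E <= g p)%E.
  rewrite /g /infty_on; case: ifPn => [_|].
    by rewrite addey ?leey.
  rewrite notin_setE adde0 /f !patchE => nB.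
  have bnd x y : 0 <= x <= S -> 0 <= y <= S -> p \in `[0, x]%classic `*` `[0, y]%classic ->
      `|F p * c p| <= aF p.
    move=> xS yS /set_mem pxy; have [FF cp _] := interior xS yS nB pxy.
    by rewrite normrM /aF FF -[leRHS]mulr1; apply: ler_wpM2l.
  case: ifPn => h; case: ifPn => h'.
  - by rewrite subrr normr0 adde_ge0.
  - rewrite subr0; apply: (@le_trans _ _ (aF p)%:E); first by rewrite lee_fin (bnd u v).
    have [WT|/negP WT] := boolP (p \in W `*` setT).
      by rewrite {1}/g1 patchE WT leeDl.
    have [TZ|/negP TZ] := boolP (p \in setT `*` Z).
      by rewrite {1}/g2 patchE TZ leeDr.
    exfalso; move/negP: h'; apply; move/set_mem: h => [] /=; rewrite !in_itv/= => h1 h2.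
    apply/mem_set; split => /=; rewrite ?in_itv/=.
      case/andP: h1 => -> h1/=; rewrite leNgt; apply/negP => h3; apply: WT.
      by apply/mem_set; split => //=; rewrite /W/= in_itv/= le_max h1 gt_min h3 orbT.
    case/andP: h2 => -> h2/=; rewrite leNgt; apply/negP => h3; apply: TZ.
    by apply/mem_set; split => //=; rewrite /Z/= in_itv/= le_max h2 gt_min h3 orbT.
  - rewrite sub0r normrN; apply: (@le_trans _ _ (aF p)%:E); first by rewrite lee_fin (bnd u' v').
    have [WT|/negP WT] := boolP (p \in W `*` setT).
      by rewrite {1}/g1 patchE WT leeDl.
    have [TZ|/negP TZ] := boolP (p \in setT `*` Z).
      by rewrite {1}/g2 patchE TZ leeDr.
    exfalso; move/negP: h; apply; move/set_mem: h' => [] /=; rewrite !in_itv/= => h1 h2.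
    apply/mem_set; split => /=; rewrite ?in_itv/=.
      case/andP: h1 => -> h1/=; rewrite leNgt; apply/negP => h3; apply: WT.
      by apply/mem_set; split => //=; rewrite /W/= in_itv/= le_max h1 gt_min h3 !orbT.
    case/andP: h2 => -> h2/=; rewrite leNgt; apply/negP => h3; apply: TZ.
    by apply/mem_set; split => //=; rewrite /Z/= in_itv/= le_max h2 gt_min h3 !orbT.
  - by rewrite subrr normr0 adde_ge0.
have := @iterated_Rintegral_close_nonmeas _ _ _ _ R mu mu _ _ _ _ g0 mg k0 mk (@f_le_k _ _ uS vS) (@f_le_k _ _ u'S v'S) kfin fg.
rewrite integralD_infty_on//; last 2 first.
- by move=> p; rewrite adde_ge0.
- exact: emeasurable_funD.
rewrite ge0_integralD//.
have e1 : (\int[mu2]_p g1 p)%E = (\int[mu]_(w in W) (\int[mu]_z `|F0 (w, z)|))%:E.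
  rewrite -(Rintegral_section (f := aF) _ _ intaF asec1)// Rintegral_mkcond /Rintegral fineK//.
  exact: integrable_fin_num.
have e2 : (\int[mu2]_p g2 p)%E = (\int[mu]_(w in Z) (\int[mu]_z `|F0 (z, w)|))%:E.
  have iaFs := integrable_swap intaF.
  rewrite -(Rintegral_section (f := fun p => aF (p.2, p.1)) _ _ iaFs asec2)//.
  rewrite -Rintegral_section_swap// Rintegral_mkcond /Rintegral fineK//.
  exact: integrable_fin_num.
by rewrite e1 e2 -EFinD -EFinM lee_fin.
Qed.

(** The two integrands coincide off the null set [B]. The comparison of iterated integrals therefore
    applies with [infty_on B] as the bound on their difference, and its integral is zero. *)
Lemma wave_integral_prod (psi : R * R -> R) u v : 0 <= u <= S -> 0 <= v <= S ->
  measurable_fun setT psi -> (forall p, `|psi p| <= 1) ->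
  (forall u v, 0 <= u <= S -> 0 <= v <= S -> c (u, v) = psi (u, v)) ->
  \int[mu]_(w in `[0, u]) \int[mu]_(z in `[0, v]) (F (w, z) * c (w, z)) =
  \int[mu2]_(p in `]0, u] `*` `]0, v]) (F0 p * psi p).
Proof.
move=> uS vS mpsi psi1 cpsi; pose H p := F0 p * psi p.
have bH p : `|H p| <= `|F0 p|.
  by rewrite normrM -[leRHS]mulr1; apply: ler_wpM2l.
have mH : measurable_fun setT H by exact: measurable_funM.
have intH : mu2.-integrable setT (EFin \o H).
  apply: le_integrable intF0 => //; first exact/measurable_EFinP.
  by move=> p _; rewrite /= lee_fin.
have secH x : mu.-integrable setT (fun y => (H (x, y))%:E).
  apply: le_integrable (sec1 x) => //.
    by apply/measurable_EFinP; exact: measurableT_comp.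
  by move=> p _; rewrite /= lee_fin.
pose f' p := (H \_ (`]0, u] `*` `]0, v])) p.
have <- : \int[mu]_w \int[mu]_z f' (w, z) = \int[mu2]_(p in `]0, u] `*` `]0, v]) (F0 p * psi p).
  have mP : measurable (`]0, u] `*` `]0, v] : set (R * R)) by exact: measurableX.
  have if' : mu2.-integrable setT (EFin \o f') by exact: integrable_patch.
  rewrite [RHS]Rintegral_mkcond -(Rintegral_section (f := f') measurableT measurableT if').
    by rewrite setXTT.
  move=> x; apply: le_integrable (secH x) => //.
    by apply/measurable_EFinP; apply: measurableT_comp => //; move/measurable_int/measurable_EFinP: if'.
  by move=> z _; rewrite /= /f' patchE lee_fin; case: ifP => // _; rewrite normr0.
rewrite fE; apply/eqP; rewrite -subr_eq0 -normr_le0 -lee_fin.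
have f'k p : (`|f' p|%:E <= k p)%E.
  apply: (@le_trans _ _ (`|F0 p|%:E)%E); last by rewrite leeDl// infty_on_ge0.
  by rewrite lee_fin /f' patchE; case: ifP => // _; rewrite normr0.
have := @iterated_Rintegral_close_nonmeas _ _ _ _ R mu mu _ _ _ _ (@infty_on_ge0 _ _ R B) (@measurable_infty_on _ _ R _ mB)
  k0 mk (@f_le_k _ _ uS vS) f'k kfin.
rewrite integral_infty_on// mule0; apply => p.
rewrite /infty_on; case: ifPn => [_|]; first exact: leey.
rewrite notin_setE => nB; rewrite lee_fin normr_le0 subr_eq0 /f /f' !patchE.
case: ifPn => h; case: ifPn => h' //.
- have [<- _ _] := interior uS vS nB (set_mem h); rewrite /H.
  case: p h {h' nB} => w z /set_mem[/=]; rewrite !in_itv/= => h1 h2.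
  by rewrite cpsi//; lra.
- have [_ _ h2] := interior uS vS nB (set_mem h).
  by exfalso; move/negP: h'; apply; exact: mem_set.
- exfalso; move/negP: h; apply; apply/mem_set; case/set_mem: h' => /=.
  by rewrite !in_itv/= => /andP[/ltW h1 h2] /andP[/ltW h3 h4]; split; rewrite /= ?in_itv/= ?h1 ?h3.
Qed.

End WaveIntegral.

(** * Projection onto an interval *)

Section Clamp.
Context (R : realType).
Implicit Types S x : R.

(** The nearest point of [0, S]. Composing with it extends a map from the square to the whole plane
    and preserves continuity. *)
Definition clamp S x := Num.max 0 (Num.min x S).

Lemma clamp_itv S x : 0 <= S -> 0 <= clamp S x <= S.
Proof.
by move=> S0; rewrite /clamp le_max lexx ge_max S0 ge_min lexx orbT.
Qed.

Lemma clamp_id S x : 0 <= x <= S -> clamp S x = x.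
Proof. by case/andP => x0 xS; rewrite /clamp min_l// max_r. Qed.

Lemma clamp_lip S x y : `|clamp S x - clamp S y| <= `|x - y|.
Proof.
have step a b : a <= b -> 0 <= clamp S b - clamp S a <= b - a.
  rewrite /clamp !maxElt !minElt => ab.
  by do ![case: ifP => //] => *; lra.
have [xy|/ltW xy] := leP x y.
  have /andP[h1 h2] := step _ _ xy.
  by rewrite distrC [leRHS]distrC !ger0_norm//; lra.
by have /andP[h1 h2] := step _ _ xy; rewrite !ger0_norm//; lra.
Qed.

End Clamp.

(** * Coordinates of points of the sphere and of absolutely continuous curves *)

Section Enorm.
Context (R : realType) (n : nat).
Implicit Types P Q : 'rV[R]_n.

Lemma dot_ge0 P : 0 <= dot P P.
Proof. by apply: sumr_ge0 => i _; rewrite -expr2 sqr_ge0. Qed.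

Lemma normr_coord_enorm P i : `|P 0 i| <= enorm P.
Proof.
rewrite -sqrtr_sqr; apply: ler_wsqrtr.
rewrite /dot (bigD1 i)//= expr2 lerDl; apply: sumr_ge0 => j _.
by rewrite -expr2 sqr_ge0.
Qed.

Lemma sphere_coord P i : unit_sphere n P -> `|P 0 i| <= 1.
Proof. by move=> <-; exact: normr_coord_enorm. Qed.

Lemma abs_continuous_on_coord_modulus (a b : R) (f : R -> 'rV[R]_n) (e : R) :
  abs_continuous_on a b f -> 0 < e ->
  exists2 dl : R, 0 < dl & forall s t, a <= s -> s <= b -> a <= t -> t <= b ->
    `|s - t| < dl -> forall i, `|f s 0 i - f t 0 i| < e.
Proof.
move=> acf e0; have [dl dl0 h] := acf e e0; exists dl => // s t.
have key s' t' : a <= s' -> s' <= t' -> t' <= b -> t' - s' < dl ->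
    forall i, `|f s' 0 i - f t' 0 i| < e.
  move=> as' s't' t'b st i.
  have := h 1 (fun=> s') (fun=> t'); rewrite !big_ord1; move/(_ _ _ st) => h'.
  rewrite distrC; apply: le_lt_trans (h' _ _) => //.
    by have := normr_coord_enorm (f t' - f s') i; rewrite !mxE.
  by move=> i1 i2 _ _ _; rewrite !ord1.
move=> as_ sb at_ tb stdl i; have [st|/ltW st] := leP s t.
  by apply: key => //; move: stdl; rewrite distrC ger0_norm; lra.
rewrite distrC; apply: key => //; move: stdl; rewrite ger0_norm; lra.
Qed.

End Enorm.

Section WaveData.
Context (R : realType) (n : nat).
Local Notation mu := (@lebesgue_measure R).
Local Notation mu2 := (mu \x mu)%E.
Variables (S : R) (phip phim : R -> 'rV[R]_n.+1) (phi : R * R -> 'rV[R]_n.+1).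
Hypothesis S0 : 0 < S.
Hypothesis acp : abs_continuous_on 0 S phip.
Hypothesis acm : abs_continuous_on 0 S phim.
Hypothesis wphi : is_wave_map S S phip phim phi.

(** The values of [phi] outside the square are arbitrary; this extension of a coordinate is the one
    for which continuity and measurability on the whole plane make sense. *)
Definition clamped (i : 'I_n.+1) (p : R * R) : R := phi (clamp S p.1, clamp S p.2) 0 i.

(** The wave map equation expresses [phi] by continuous boundary data and an iterated integral. A
    change of the corner costs integrals of the marginals of [|F0|] over short intervals, which are
    small by absolute continuity of the integral. So [phi] is continuous, hence measurable, and the
    iterated integral can be rewritten as one over the product. *)
Lemma wave_map_data : exists F0 : R * R -> R,
  [/\ mu2.-integrable setT (EFin \o F0),
    forall x, mu.-integrable setT (fun y => (F0 (x, y))%:E),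
    forall y, mu.-integrable setT (fun x => (F0 (x, y))%:E),
    {ae mu2, forall p, (`]0, S[ `*` `]0, S[) p -> F0 p = dot (du phi p) (dv phi p)} &
    forall i, continuous (clamped i) /\
      forall u v, 0 <= u <= S -> 0 <= v <= S ->
        phi (u, v) 0 i = phip u 0 i + phim v 0 i - phip 0 0 i
          - \int[mu2]_(p in `]0, u] `*` `]0, v]) (F0 p * clamped i p)].
Proof.
case: wphi => sph _ intF phiE.
set F := fun p : R * R => dot (du phi p) (dv phi p) in intF.
have mQ : measurable (`]0, S[ `*` `]0, S[ : set (R * R)) by exact: measurableX.
have intFQ : mu2.-integrable setT (EFin \o (F \_ (`]0, S[ `*` `]0, S[))).
  by rewrite -restrict_EFin; apply/integrable_restrict => //; rewrite setTI.
have [F0 [intF0 sec1 sec2 [N [mN N0 F0F]]]] := ae_integrable_sections intFQ.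
exists F0; split => //.
  exists N; split => // p /= hp; apply: contrapT => nNp; apply: hp => Qp.
  by rewrite F0F// patchE mem_set.
move=> i; have c1 u v : 0 <= u <= S -> 0 <= v <= S -> `|phi (u, v) 0 i| <= 1.
  by move=> uS vS; apply: sphere_coord; exact: sph.
have cl1 p : `|clamped i p| <= 1.
  by apply: c1; apply: clamp_itv; exact: ltW.
have phiEi u v : 0 <= u <= S -> 0 <= v <= S ->
    phi (u, v) 0 i = phip u 0 i + phim v 0 i - phip 0 0 i
      - \int[mu]_(w in `[0, u]) \int[mu]_(z in `[0, v]) (F (w, z) * phi (w, z) 0 i).
  by move=> uS vS; rewrite {1}phiE// !mxE.
pose c p := phi p 0 i.
have close := @wave_integral_close R S F F0 c N intF0 sec1 sec2 mN N0 F0F c1.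
have contc : continuous (clamped i).
  move=> p; apply/cvgrPdist_lt => e e0.
  (* Two boundary terms and four times the two strip integrals, each below e / 20, add up to at most
     e / 2. *)
  have e20 : 0 < e / 20 by lra.
  have [d1 d10 h1] := abs_continuous_on_coord_modulus acp e20.
  have [d2 d20 h2] := abs_continuous_on_coord_modulus acm e20.
  pose A1 x := \int[mu]_z `|F0 (x, z)|.
  pose A2 z := \int[mu]_x `|F0 (x, z)|.
  have absF0 : mu2.-integrable setT (EFin \o (fun p => `|F0 p|)).
    exact: integrable_norm.
  have iA1 : mu.-integrable setT (EFin \o A1).
    apply: (integrable_Rintegral_section measurableT absF0) => x.
    exact: (integrable_norm (sec1 x)).
  have iA2 : mu.-integrable setT (EFin \o A2).
    apply: (integrable_Rintegral_section (f := fun p => `|F0 (p.2, p.1)|) measurableT).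
      exact: (integrable_swap absF0).
    by move=> x; exact: (integrable_norm (sec2 x)).
  have [d3 d30 h3] := integral_itv_modulus iA1 e20.
  have [d4 d40 h4] := integral_itv_modulus iA2 e20.
  pose dl := Num.min (Num.min d1 d2) (Num.min d3 d4).
  have dl0 : 0 < dl by rewrite !lt_min d10 d20 d30 d40.
  have key u v u' v' : 0 <= u <= S -> 0 <= v <= S -> 0 <= u' <= S -> 0 <= v' <= S ->
      `|u - u'| < dl -> `|v - v'| < dl -> `|phi (u, v) 0 i - phi (u', v') 0 i| < e.
    move=> uS vS u'S v'S; rewrite !lt_min => /andP[/andP[u1 u2] /andP[u3 u4]].
    move=> /andP[/andP[v1 v2] /andP[v3 v4]].
    have := h1 u u' _ _ _ _ u1 i; have := h2 v v' _ _ _ _ v2 i.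
    have minmax (x y : R) : Num.min x y <= Num.max x y /\
        Num.max x y - Num.min x y = `|x - y|.
      have [xy|xy] := leP x y; split => //.
      - by rewrite distrC ger0_norm// subr_ge0.
      - exact: ltW.
      - by rewrite gtr0_norm// subr_gt0.
    have [mM1 mM2] := minmax u u'; have [mM3 mM4] := minmax v v'.
    have E (A : R -> R) D : (forall x, 0 <= A x) ->
        \int[mu]_(x in D) `|A x| = \int[mu]_(x in D) A x.
      by move=> A0; apply: eq_Rintegral => x _; rewrite ger0_norm.
    have A10 x : 0 <= A1 x by exact: Rintegral_ge0.
    have A20 x : 0 <= A2 x by exact: Rintegral_ge0.
    set W := `]Num.min u u', Num.max u u']%classic.
    set Z := `]Num.min v v', Num.max v v']%classic.
    have I1 : \int[mu]_(x in W) A1 x < e / 20 by rewrite -E//; apply: h3; rewrite ?mM2.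
    have I2 : \int[mu]_(x in Z) A2 x < e / 20 by rewrite -E//; apply: h4; rewrite ?mM4.
    rewrite (phiEi _ _ uS vS) (phiEi _ _ u'S v'S).
    have := close u v u' v' uS vS u'S v'S; rewrite -/W -/Z.
    rewrite -[X in 4 * (X + _)]/(\int[mu]_(x in W) A1 x).
    rewrite -[X in 4 * (_ + X)]/(\int[mu]_(x in Z) A2 x).
    move: (uS) (vS) (u'S) (v'S) => /andP[-> ->] /andP[-> ->] /andP[-> ->] /andP[-> ->].
    rewrite /c; set J := Rintegral _ _ _; set J' := Rintegral _ _ _.
    move=> i3 /(_ isT isT isT isT) i4 /(_ isT isT isT isT) i5.
    clear - i3 i4 i5 I1 I2; move: i3 i4 i5; rewrite !ltr_norml ler_norml.
    by move=> /andP[? ?] /andP[? ?] /andP[? ?]; apply/andP; split; lra.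
  have : \forall q \near p, `|q.1 - p.1| < dl /\ `|q.2 - p.2| < dl.
    exists (ball p.1 dl, ball p.2 dl) => /=; first by split; exact: nbhsx_ballx.
    by move=> q [/= ]; rewrite /ball/= => q1 q2; rewrite distrC; split => //; rewrite distrC.
  apply: filterS => q [q1 q2]; apply: key; try by apply: clamp_itv; exact: ltW.
    by apply: le_lt_trans (clamp_lip _ _ _) _; rewrite distrC.
  by apply: le_lt_trans (clamp_lip _ _ _) _; rewrite distrC.
split => // u v uS vS; rewrite phiEi//; congr (_ - _).
(* Continuity, just established, provides the measurable representative [clamped i] of the
   coordinate. *)
apply: (@wave_integral_prod R S F F0 c N intF0 sec1 mN N0 F0F c1) => //.
  exact: continuous2_measurable_fun.
by move=> u' v' u'S v'S; rewrite /clamped !clamp_id.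
Qed.

End WaveData.

(** * Absolutely continuous functions *)

Section Truncation.
Context (R : realType).
Implicit Types c r : R.

(** The nearest point of [-c, c], written as a shifted [clamp] so that its Lipschitz bound carries
    over. *)
Definition truncation c r := clamp (2 * c) (r + c) - c.

Lemma truncation_id c r : `|r| <= c -> truncation c r = r.
Proof. by rewrite ler_norml /truncation => /andP[? ?]; rewrite clamp_id; lra. Qed.

Lemma truncation_le c r : 0 <= c -> `|truncation c r| <= c.
Proof.
move=> c0; have /andP[] := @clamp_itv R (2 * c) (r + c) ltac:(lra).
by rewrite ler_norml /truncation => ? ?; apply/andP; split; lra.
Qed.

Lemma truncation_lip c r s : `|truncation c r - truncation c s| <= `|r - s|.
Proof.
rewrite /truncation opprB addrA subrK; apply: le_trans (clamp_lip _ _ _) _.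
by rewrite opprD addrACA subrr addr0.
Qed.

Lemma truncation_dist c r : 0 <= c -> `|r - truncation c r| <= `|r|.
Proof.
move=> c0; have [/truncation_id->|rc] := leP `|r| c.
  by rewrite subrr normr0.
rewrite /truncation /clamp; move: rc; rewrite ltr_normr => /orP[h|h].
  rewrite min_r; last by lra.
  by rewrite max_r ?ger0_norm; lra.
by rewrite min_l ?max_l ?ler0_norm; lra.
Qed.

Lemma continuous_lip1 (h : R -> R) : (forall x y, `|h x - h y| <= `|x - y|) ->
  continuous h.
Proof.
move=> hlip x; apply/cvgrPdist_lt => e e0; near=> y.
by apply: le_lt_trans (hlip _ _) _; near: y; exact: cvgr_dist_lt.
Unshelve. all: by end_near. Qed.

End Truncation.

(** * Limits of uniformly integrable sequences *)

Section UniformIntegrability.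
Context (d : measure_display) (T : measurableType d) (R : realType).
Variables (mu : {measure set T -> \bar R}) (D : set T).
Hypothesis mD : measurable D.
Hypothesis Dfin : (mu D < +oo)%E.
Variables (G : nat -> T -> R) (g : T -> R).
Hypothesis mG : forall n, measurable_fun D (G n).
Hypothesis Gg : forall x, D x -> (fun n => G n x) @ \oo --> g x.
Hypothesis UI : forall e, 0 < e -> exists c n0, 0 <= c /\
  forall n, (n0 <= n)%N -> (\int[mu]_(x in D) `|G n x - truncation c (G n x)|%:E <= e%:E)%E.

Let mg : measurable_fun D g.
Proof. exact: measurable_fun_cvg mG Gg. Qed.

Let mtr c (h : T -> R) : measurable_fun D h -> measurable_fun D (truncation c \o h).
Proof.
move=> mh; apply: measurableT_comp mh; apply: continuous_measurable_fun.
exact: continuous_lip1 (@truncation_lip _ _).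
Qed.

Let mdist c (h : T -> R) : measurable_fun D h ->
  measurable_fun D (fun x => `|h x - truncation c (h x)|).
Proof.
move=> mh; apply: measurableT_comp => //; apply: measurable_funB => //.
exact: mtr.
Qed.

(** Fatou's lemma for the parts cut off by the truncation. The sequence is shifted by [n0] because
    the bound holds only from that index on. *)
Lemma fatou_truncation e c n0 : 0 <= c -> (forall n, (n0 <= n)%N ->
    (\int[mu]_(x in D) `|G n x - truncation c (G n x)|%:E <= e%:E)%E) ->
  (\int[mu]_(x in D) `|g x - truncation c (g x)|%:E <= e%:E)%E.
Proof.
move=> c0 He.
pose h n x : \bar R := `|G (n + n0) x - truncation c (G (n + n0) x)|%:E.
have mh n : measurable_fun D (h n) by apply/measurable_EFinP; exact: mdist.
have h0 n x : D x -> (0 <= h n x)%E by rewrite lee_fin.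
have cvh x : D x -> (fun n => h n x) @ \oo --> `|g x - truncation c (g x)|%:E.
  move=> Dx; apply: cvg_EFin; first by apply: nearW.
  have cvG : (fun n => G (n + n0) x) @ \oo --> g x.
    by rewrite (cvg_shiftn n0 (fun n => G n x)); exact: Gg.
  apply: cvg_norm; apply: cvgB => //.
  by apply: (continuous_cvg _ _ cvG); exact: (continuous_lip1 (@truncation_lip _ c)).
have := fatou mu mD mh h0.
rewrite (eq_integral (fun x => `|g x - truncation c (g x)|%:E)); last first.
  by move=> x /set_mem Dx; have /cvg_limn_einf_sup[-> _] := cvh _ Dx.
move/le_trans; apply; rewrite limn_einf_lim; apply: lime_le.
  by apply: is_cvg_einfs.
apply: nearW => n; apply: le_trans (He (n + n0) (leq_addl _ _)).
by apply: ereal_inf_lbound; exists n => //=.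
Qed.

(** Vitali's convergence theorem for integrals with a constant value. At a fixed level [c] the
    truncations converge by dominated convergence, with the constant [c] as bound since [D] has
    finite measure. What is cut off is small uniformly in [n], and by Fatou also in the limit. *)
Lemma uniformly_integrable_limit : mu.-integrable D (EFin \o g) /\
  forall I, (forall n, mu.-integrable D (EFin \o G n)) ->
    (forall n, \int[mu]_(x in D) G n x = I) -> \int[mu]_(x in D) g x = I.
Proof.
have cstint (r : R) : mu.-integrable D (EFin \o cst r).
  apply: measurable_bounded_integrable => //.
  by exists `|r|; split => // M rM x _; exact: ltW.
have trint c (h : T -> R) : 0 <= c -> measurable_fun D h ->
    mu.-integrable D (EFin \o (truncation c \o h)).
  move=> c0 mh; apply: le_integrable (cstint c) => //.
    by apply/measurable_EFinP; exact: mtr.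
  by move=> x _; rewrite /= lee_fin (ger0_norm c0); exact: truncation_le.
have distint c (h : T -> R) e : measurable_fun D h ->
    (\int[mu]_(x in D) `|h x - truncation c (h x)|%:E <= e%:E)%E ->
    mu.-integrable D (fun x => `|h x - truncation c (h x)|%:E).
  move=> mh he; apply/integrableP; split.
    by apply/measurable_EFinP; exact: mdist.
  under eq_integral do rewrite gee0_abs// ?lee_fin//.
  exact: le_lt_trans he (ltry _).
have gint : mu.-integrable D (EFin \o g).
  have [c [n0 [c0 He]]] := UI ltr01.
  have h1 := distint _ _ _ mg (fatou_truncation c0 He).
  have := integrableD mD h1 (cstint c); apply: le_integrable => //.
    exact/measurable_EFinP.
  move=> x _; rewrite /= lee_fin; apply: le_trans (ler_norm _).
  rewrite -{1}(subrK (truncation c (g x)) (g x)); apply: le_trans (ler_normD _ _) _.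
  by apply: lerD => //; exact: truncation_le.
split => // I Gint GI; apply/eqP; rewrite -subr_eq0 -normr_le0; apply/ler_addgt0Pr => e e0.
rewrite add0r; have e3 : 0 < e / 3 by lra.
have [c [n0 [c0 He]]] := UI e3.
have mtG n : measurable_fun D (EFin \o (truncation c \o G n)).
  by apply/measurable_EFinP; exact: mtr.
have mtg : measurable_fun D (EFin \o (truncation c \o g)).
  by apply/measurable_EFinP; exact: mtr.
have [_ _ dct] : [/\ mu.-integrable D (EFin \o (truncation c \o g)),
    [sequence \int[mu]_(x in D) `|(EFin \o (truncation c \o G n)) x -
                                  (EFin \o (truncation c \o g)) x|]_n @ \oo --> 0%E &
    [sequence \int[mu]_(x in D) (EFin \o (truncation c \o G n)) x]_n @ \oo -->
      (\int[mu]_(x in D) (EFin \o (truncation c \o g)) x)]%E.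
  apply: (dominated_convergence mD mtG mtg _ (cstint c)).
    apply: aeW => x Dx; apply: cvg_EFin; first by apply: nearW.
    by apply: (continuous_cvg _ _ (Gg Dx)); exact: (continuous_lip1 (@truncation_lip _ c)).
  by apply: aeW => x n Dx; rewrite /= lee_fin; exact: truncation_le.
have dctR : (fun n => \int[mu]_(x in D) truncation c (G n x)) @ \oo -->
    \int[mu]_(x in D) truncation c (g x).
  apply: fine_cvg; rewrite fineK//.
  exact: integrable_fin_num (trint c g c0 mg).
have Rdist (h : T -> R) : measurable_fun D h -> mu.-integrable D (EFin \o h) ->
    (\int[mu]_(x in D) `|h x - truncation c (h x)|%:E <= (e / 3)%:E)%E ->
    `|\int[mu]_(x in D) h x - \int[mu]_(x in D) truncation c (h x)| <= e / 3.
  move=> mh ih hh; rewrite -RintegralB//; last exact: trint.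
  apply: le_trans (le_normr_Rintegral mD _) _.
    exact: (integrableB mD ih (trint c h c0 mh)).
  by rewrite -lee_fin /Rintegral fineK//; exact: integrable_fin_num (distint _ _ _ mh hh).
(* One index [n] beyond both thresholds; the truncation of the limit, the dominated convergence and
   the truncation of [G n] contribute e / 3 each. *)
move/cvgrPdist_lt: dctR => /(_ _ e3)[n1 _ Hn1].
have := Hn1 (maxn n0 n1) (leq_maxr _ _); set n := maxn n0 n1 => d1.
have d2 := Rdist g mg gint (fatou_truncation c0 He).
have d3 := Rdist (G n) (mG n) (Gint n) (He n (leq_maxl _ _)).
rewrite GI in d3; move: d1 d2 d3; rewrite !ler_norml ltr_norml.
by move=> /andP[? ?] /andP[? ?] /andP[? ?]; apply/andP; split; lra.
Qed.

End UniformIntegrability.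

(** * Step functions on a uniform grid *)

Section StepFunctions.
Context (R : realType).
Local Notation mu := (@lebesgue_measure R).
Variables (h : R) (h0 : 0 < h) (phi : nat -> R).

Definition stepf (y : R) : R := phi (Num.truncn (y / h)).

Lemma stepfE k y : k%:R * h <= y -> y < k.+1%:R * h -> stepf y = phi k.
Proof.
move=> y1 y2; rewrite /stepf; congr phi; apply: truncn_def.
by rewrite ler_pdivlMr// ltr_pdivrMr// y1.
Qed.

Let splitS n : `[0, n.+1%:R * h[%classic =
  `[0, n%:R * h[%classic `|` `[n%:R * h, n.+1%:R * h[%classic.
Proof.
have nh : 0 <= n%:R * h by rewrite mulr_ge0// ltW.
by rewrite -itv_bndbnd_setU// bnd_simp// ler_wpM2r ?ltW// ltr_nat.
Qed.

Let empty0 : `[0, 0%:R * h[%classic = set0 :> set R.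
Proof. by rewrite mul0r set_itvco0. Qed.

Lemma measurable_stepf n : measurable_fun `[0, n%:R * h[ stepf.
Proof.
elim: n => [|n IH]; first by rewrite empty0; exact: measurable_fun_set0.
rewrite splitS; apply/measurable_funU => //; split => //.
apply: (eq_measurable_fun (cst (phi n))) => // y /set_mem.
by rewrite /= in_itv/= => /andP[y1 y2]; rewrite (stepfE y1).
Qed.

Lemma integrable_stepf n : mu.-integrable `[0, n%:R * h[ (EFin \o stepf).
Proof.
apply: measurable_bounded_integrable => //.
- by rewrite /= lebesgue_measure_itv/=; case: ifP => _; rewrite ?ltry// -EFinD ltry.
- exact: measurable_stepf.
- exists (\sum_(k < n) `|phi k|); split; first exact: num_real.
  move=> M MM y /=; rewrite in_itv/= => /andP[y0 yn]; apply: le_trans (ltW MM).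
  have yh : 0 <= y / h by rewrite divr_ge0// ltW.
  have kn : (Num.truncn (y / h) < n)%N.
    rewrite -(ltr_nat R); apply: le_lt_trans (_ : y / h < n%:R).
      by have /andP[] := truncn_itv yh.
    by rewrite ltr_pdivrMr.
  rewrite (bigD1 (Ordinal kn))//= /stepf lerDl; exact: sumr_ge0.
Qed.

Lemma Rintegral_stepf n : \int[mu]_(y in `[0, n%:R * h[) stepf y = \sum_(k < n) phi k * h.
Proof.
elim: n => [|n IH]; first by rewrite empty0 Rintegral_set0 big_ord0.
have := integrable_stepf n.+1.
rewrite splitS big_ord_recr/= -IH => intS; rewrite Rintegral_setU//; last first.
  apply/disj_setPS => y [/=]; rewrite !in_itv/= => /andP[_ y1] /andP[y2 _]; lra.
congr (_ + _); rewrite (@eq_Rintegral _ _ _ mu _ (cst (phi n))); last first.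
  by move=> y /set_mem; rewrite /= in_itv/= => /andP[y1 y2]; rewrite (stepfE y1).
rewrite Rintegral_cst//= lebesgue_measure_itv/= lte_fin ltr_pM2r// ltr_nat ltnSn.
by rewrite -EFinD/= -mulrBl -natrB// subSnn mul1r.
Qed.

End StepFunctions.

Definition ac_real (R : realType) (S : R) (f : R -> R) : Prop :=
  forall e : R, 0 < e -> exists2 dl : R, 0 < dl &
    forall (k : nat) (s t : 'I_k -> R),
      (forall i, [/\ 0 <= s i, s i <= t i & t i <= S]) ->
      trivIset [set: 'I_k] (fun i => `]s i, t i[%classic) ->
      \sum_(i < k) (t i - s i) < dl -> \sum_(i < k) `|f (t i) - f (s i)| < e.

Lemma abs_continuous_on_coord (R : realType) n (S : R) (f : R -> 'rV[R]_n) i :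
  abs_continuous_on 0 S f -> ac_real S (fun x => f x 0 i).
Proof.
move=> acf e e0; have [dl dl0 H] := acf e e0; exists dl => // k s t st tr sd.
apply: le_lt_trans (H k s t st tr sd); apply: ler_sum => j _.
by have := normr_coord_enorm (f (t j) - f (s j)) i; rewrite !mxE.
Qed.

(** * Steep cells of an absolutely continuous function *)

Section AbsolutelyContinuous.
Context (R : realType).
Local Notation mu := (@lebesgue_measure R).
Variables (S : R) (f : R -> R).
Hypothesis acf : ac_real S f.

(** This is the uniform integrability of the difference quotients over uniform grids: the sum is the
    integral of the absolute value of the quotient over the cells where it exceeds [c]. *)
Lemma ac_real_steep_increments (e : R) : 0 < e -> exists c dl : R, [/\ 0 <= c, 0 < dl &
  forall h n, 0 < h -> h < dl -> n%:R * h <= S ->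
    \sum_(k < n | c * h < `|f (k.+1%:R * h) - f (k%:R * h)|)
      `|f (k.+1%:R * h) - f (k%:R * h)| < e].
Proof.
(* With slopes above 2 * e / dl, steep cells whose increments sum to less than [e] have total length
   less than dl / 2. A mesh below dl / 2 leaves room for one more cell within [dl]. *)
move=> e0; have [dl dl0 H] := acf e0; exists (2 * e / dl), (dl / 2); split.
- by rewrite divr_ge0 ?mulr_ge0// ltW.
- by lra.
move=> h n h0 hd nS; set c := 2 * e / dl.
pose u (k : nat) := `|f (k.+1%:R * h) - f (k%:R * h)|.
pose sel (k : nat) := c * h < u k.
(* Only few cells are steep: the total length of the steep ones jumps by less
   than dl / 2 from one cell to the next, and cannot enter [dl / 2, dl). *)
suff key j : (j <= n)%N -> \sum_(k < j) (if sel k then h else 0) < dl / 2 /\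
    \sum_(k < j) (if sel k then u k else 0) < e.
  by have [_] := key n (leqnn n); rewrite [X in _ -> X < _]big_mkcond.
elim: j => [_|j IH jn]; first by rewrite !big_ord0; split; lra.
have [IH1 _] := IH (ltnW jn).
have len : \sum_(k < j.+1) (if sel k then h else 0) < dl.
  by rewrite big_ord_recr/=; case: ifP => _; lra.
have small : \sum_(k < j.+1) (if sel k then u k else 0) < e.
  pose s (i : 'I_j.+1) := i%:R * h.
  (* Cells that are not steep become empty intervals, so that the family keeps the index set of all
     cells. *)
  pose t (i : 'I_j.+1) := if sel i then i.+1%:R * h else i%:R * h.
  have := H j.+1 s t.
  rewrite (eq_bigr (fun k : 'I_j.+1 => if sel k then h else 0)); last first.
    by move=> i _; rewrite /t /s; case: ifP => _; rewrite ?subrr// -mulrBl -natrB// subSnn mul1r.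
  rewrite [X in _ -> _ -> _ -> X < _](eq_bigr (fun k : 'I_j.+1 => if sel k then u k else 0)); last first.
    by move=> i _; rewrite /t /s /u; case: ifP => _ //; rewrite subrr normr0.
  apply => //.
    move=> i; rewrite /s /t; have iS : i.+1%:R * h <= S.
      apply: le_trans nS; rewrite ler_wpM2r ?(ltW h0) ?ler_nat//.
      exact: leq_trans (ltn_ord i) jn.
    have ih : i%:R * h <= i.+1%:R * h by rewrite ler_wpM2r ?(ltW h0) ?ler_nat//.
    by split; rewrite ?mulr_ge0 ?(ltW h0)//; case: ifP => _ //; apply: le_trans iS.
  have lt_disj (i i' : 'I_j.+1) y : (i < i')%N -> `]s i, t i[%classic y -> `]s i', t i'[%classic y -> False.
    move=> ii'; rewrite /= !in_itv/= => /andP[_ y1] /andP[y2 _].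
    have : y < i.+1%:R * h.
      apply: lt_le_trans y1 _; rewrite /t; case: ifP => _ //.
      by rewrite ler_wpM2r ?(ltW h0) ?ler_nat//.
    have : i.+1%:R * h <= i'%:R * h by rewrite ler_wpM2r ?(ltW h0)// ler_nat.
    by move: y2; rewrite /s; lra.
  move=> i i' _ _ [y [yi yi']]; apply/val_inj.
  case: (ltngtP i i') => // ii'; exfalso; first exact: lt_disj ii' yi yi'.
  exact: lt_disj ii' yi' yi.
split => //.
have : c * (\sum_(k < j.+1) (if sel k then h else 0)) <= \sum_(k < j.+1) (if sel k then u k else 0).
  rewrite mulr_sumr; apply: ler_sum => k _; case: ifP => [sk|_]; last by rewrite mulr0.
  exact: ltW.
move=> /le_lt_trans/(_ small); rewrite /c mulrC mulrA ltr_pdivrMr//.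
by move: small => _; nra.
Qed.

End AbsolutelyContinuous.

(** A point lies somewhere inside its grid cell, so the quotient over the cell is not one based at
    the point. Splitting the increment at [y] gives errors [e * (b - y)] and [e * (y - a)], which
    add up to [e * (b - a)]. *)
Lemma derivable_straddle (R : realType) (f : R -> R) (y e : R) :
  derivable f y 1 -> 0 < e -> exists2 dl : R, 0 < dl & forall a b,
    a <= y -> y <= b -> a < b -> b - a < dl ->
    `|(f b - f a) / (b - a) - (derive1 f y)| <= e.
Proof.
move=> df e0; have : (fun h : R => h^-1 *: (f (h *: 1 + y) - f y)) @ 0^' --> (derive1 f y).
  by rewrite derive1E; exact: df.
move=> /cvgrPdist_le/(_ _ e0)[dl /= dl0 H]; exists dl => // a b ay yb ab bad.
have incr z : a <= z -> z <= b -> `|f z - f y - (derive1 f y) * (z - y)| <= e * `|z - y|.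
  move=> az zb; have [->|zy] := eqVneq z y.
    by rewrite !subrr mulr0 subr0 normr0 mulr0.
  have zy0 : z - y != 0 by rewrite subr_eq0.
  have := H (z - y); rewrite /ball_/= sub0r normrN.
  have zyd : `|z - y| < dl by rewrite ltr_norml; apply/andP; split; lra.
  move=> /(_ zyd zy0); rewrite [X in f X](_ : _ = z); last by rewrite -[X in X + _]/((z - y) * 1) mulr1 subrK.
  rewrite distrC => h; rewrite -ler_pdivrMr ?normr_gt0// -normfV -normrM.
  by rewrite mulrBl mulfK// [X in X - _]mulrC.
have ha := incr a (lexx _) (ltW ab); have hb := incr b (ltW ab) (lexx _).
have ba0 : 0 < b - a by lra.
rewrite -[X in _ - X](mulfK (lt0r_neq0 ba0)) -mulrBl normrM normfV (gtr0_norm ba0).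
rewrite ler_pdivrMr//; move: ha hb; rewrite (ler0_norm (_ : a - y <= 0)); last by lra.
rewrite (ger0_norm (_ : 0 <= b - y)); last by lra.
rewrite !ler_norml => /andP[? ?] /andP[? ?]; apply/andP; split; nra.
Qed.

(** * The fundamental theorem of calculus for absolutely continuous functions *)

Section AbsolutelyContinuousFTC.
Context (R : realType).
Local Notation mu := (@lebesgue_measure R).
Variables (S : R) (f : R -> R).
Hypothesis S0 : 0 < S.
Hypothesis acf : ac_real S f.
Variable N : set R.
Hypothesis mN : measurable N.
Hypothesis N0 : mu N = 0%E.
Hypothesis df : forall y, 0 < y -> y < S -> ~ N y -> derivable f y 1.

Section FixedEndpoint.
Variable x : R.
Hypothesis x0 : 0 < x.
Hypothesis xS : x <= S.
(** The mesh divides [x], so that whole cells fill [[0, x[] exactly and the increments telescope to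
    [f x - f 0]. *)
Let h n : R := x / n.+1%:R.
Let phi n k : R := (f (k.+1%:R * h n) - f (k%:R * h n)) / h n.
Let G n := stepf (h n) (phi n).
(** At 0 nothing is known about the two-sided derivative. *)
Let N' : set R := N `|` [set 0].
Let E : set R := `[0, x[%classic `\` N'.

Let h0 n : 0 < h n.
Proof. by rewrite divr_gt0. Qed.

Let nh n : n.+1%:R * h n = x.
Proof. by rewrite /h mulrC divfK// pnatr_eq0. Qed.

Let mN' : measurable N'. Proof. exact: measurableU. Qed.

Let N'0 : mu N' = 0%E.
Proof. by rewrite measureU0//; exact: lebesgue_measure_set1. Qed.

Let mE : measurable E. Proof. exact: measurableD. Qed.

Let Efin : (mu E < +oo)%E.
Proof.
apply: (@le_lt_trans _ _ (mu `[0, x[%classic)).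
  by apply: le_measure; rewrite ?inE//; exact: subDsetl.
by rewrite /= lebesgue_measure_itv/=; case: ifP => _; rewrite ?ltry// -EFinD ltry.
Qed.

Let intG n : mu.-integrable `[0, x[ (EFin \o G n).
Proof. by rewrite -(nh n); exact: integrable_stepf. Qed.

Let cvgG y : E y -> (fun n => G n y) @ \oo --> (derive1 f y).
Proof.
move=> [/=]; rewrite in_itv/= => /andP[y0 yx] nN'.
have yn0 : y != 0 by apply/eqP => yE; apply: nN'; right.
have y1 : 0 < y by rewrite lt_neqAle eq_sym yn0.
have dy : derivable f y 1.
  by apply: df => //; [exact: lt_le_trans yx xS|move=> Ny; apply: nN'; left].
apply/cvgrPdist_le => e e0; have [dl dl0 H] := derivable_straddle dy e0.
have : (fun n => x / n.+1%:R) @ \oo --> (0 : R).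
  by rewrite -(mulr0 x); apply: cvgMr; exact: cvg_harmonic.
move=> /cvgrPdist_lt/(_ _ dl0); apply: filterS => n; rewrite sub0r normrN.
rewrite -/(h n) gtr0_norm// => hdl; have yh : 0 <= y / h n by rewrite divr_ge0// ltW.
have /andP[k1 k2] := truncn_itv yh; set k := Num.truncn _ in k1 k2.
rewrite ler_pdivlMr// in k1; rewrite ltr_pdivrMr// in k2.
rewrite distrC /G (stepfE (h0 n) _ k1 k2) /phi.
have kh : k.+1%:R * h n - k%:R * h n = h n by rewrite -mulrBl -natrB// subSnn mul1r.
have := H (k%:R * h n) (k.+1%:R * h n) k1 (ltW k2); rewrite kh; apply => //.
by rewrite -subr_gt0 kh.
Qed.

(** Truncation at [c] changes the quotient only on steep cells, and there by at most its absolute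
    value; so the integral is bounded by the sum of the steep increments. *)
Let UI e : 0 < e -> exists c n0, 0 <= c /\ forall n, (n0 <= n)%N ->
  (\int[mu]_(y in E) `|G n y - truncation c (G n y)|%:E <= e%:E)%E.
Proof.
move=> e0; have [c [dl [c0 dl0 H]]] := ac_real_steep_increments acf e0.
have : (fun n => x / n.+1%:R) @ \oo --> (0 : R).
  by rewrite -(mulr0 x); apply: cvgMr; exact: cvg_harmonic.
move=> /cvgrPdist_lt/(_ _ dl0)[n0 _ Hn0]; exists c, n0; split => // n n0n.
have := Hn0 n n0n; rewrite /= sub0r normrN -/(h n) gtr0_norm// => hdl.
have := H (h n) n.+1 (h0 n) hdl; rewrite nh => /(_ xS) small.
pose psi k := `|phi n k - truncation c (phi n k)|.
have intpsi : mu.-integrable `[0, x[ (EFin \o stepf (h n) psi).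
  by rewrite -(nh n); exact: integrable_stepf.
apply: (@le_trans _ _ (\int[mu]_(y in `[0%R, x[) (stepf (h n) psi y)%:E)%E).
  apply: ge0_subset_integral => //; first exact: measurable_int intpsi.
  exact: subDsetl.
rewrite -(@fineK _ (\int[mu]_(y in _) _)%E); last exact: integrable_fin_num intpsi.
have stepE : \int[mu]_(y in `[0, x[) stepf (h n) psi y = \sum_(k < n.+1) psi k * h n.
  by rewrite -(Rintegral_stepf (h0 n)) nh.
rewrite lee_fin [leLHS]stepE.
apply: le_trans (ltW small); rewrite [leRHS]big_mkcond/=; apply: ler_sum => k _.
have phiE : f (k.+1%:R * h n) - f (k%:R * h n) = phi n k * h n by rewrite divfK ?gt_eqF.
rewrite phiE normrM (gtr0_norm (h0 n)) ltr_pM2r//; case: ltP => ck.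
  by rewrite ler_wpM2r ?(ltW (h0 n))//; exact: truncation_dist.
by rewrite /psi truncation_id// subrr normr0 mul0r.
Qed.

(** Every step function of difference quotients has integral [f x - f 0], by telescoping. These
    functions converge to the derivative off [N'] and are uniformly integrable, so the value of the
    integral passes to the limit. *)
Lemma ac_FTC_endpoint : mu.-integrable (`[0, x[ `\` (N `|` [set 0])) (EFin \o (derive1 f)) /\
  \int[mu]_(y in `[0, x[ `\` (N `|` [set 0])) (derive1 f y) = f x - f 0.
Proof.
have mG n : measurable_fun E (G n).
  have mG0 : measurable_fun `[0, x[ (G n).
    by have := @measurable_stepf _ (h n) (h0 n) (phi n) n.+1; rewrite nh.
  by apply: measurable_funS mG0 => //; exact: subDsetl.
have [intf H] := @uniformly_integrable_limit _ _ R mu E mE Efin _ _ mG cvgG UI.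
split => //; apply: H => n.
  by apply: integrableS (intG n) => //; exact: subDsetl.
rewrite /Rintegral -negligible_integral//; last exact: intG.
have stepE : \int[mu]_(y in `[0, x[) stepf (h n) (phi n) y = \sum_(k < n.+1) phi n k * h n.
  by rewrite -(Rintegral_stepf (h0 n)) nh.
rewrite [LHS]stepE (eq_bigr (fun k : 'I_n.+1 => f (k.+1%:R * h n) - f (k%:R * h n))); last first.
  by move=> k _; rewrite divfK ?gt_eqF.
rewrite -(big_mkord xpredT (fun k => f (k.+1%:R * h n) - f (k%:R * h n))).
by rewrite telescope_sumr// nh mul0r.
Qed.

End FixedEndpoint.

Lemma ac_FTC : exists g : R -> R, [/\ mu.-integrable setT (EFin \o g) &
  forall x, 0 <= x <= S -> f x = f 0 + \int[mu]_(y in `]0, x]) g y].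
Proof.
pose g := (derive1 f) \_ (`[0, S[ `\` (N `|` [set 0])).
have mE x : measurable (`[0, x[ `\` (N `|` [set 0]) : set R).
  by apply: measurableD => //; exact: measurableU.
have [intg _] := ac_FTC_endpoint S0 (lexx _).
have intg' : mu.-integrable setT (EFin \o g).
  by rewrite /g -restrict_EFin; have H := @integrable_mkcond _ _ _ mu _ (EFin \o (derive1 f)) (mE S); apply/H.
exists g; split => // x /andP[]; rewrite le_eqVlt => /predU1P[<-|x0] xS.
  by rewrite set_itvoc0 Rintegral_set0 addr0.
have [_ E] := ac_FTC_endpoint x0 xS.
have -> : \int[mu]_(y in `]0, x]) g y = \int[mu]_(y in `[0, x[) g y.
  rewrite -Rintegral_itv_bndo_bndc; last by apply: integrableS intg'.
  by rewrite Rintegral_itv_obnd_cbnd//; apply: integrableS intg'.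
have -> : \int[mu]_(y in `[0, x[) g y = \int[mu]_(y in `[0, x[ `\` (N `|` [set 0])) (derive1 f y).
  rewrite /Rintegral (@negligible_integral _ _ _ mu _ (N `|` [set 0]))//.
  - congr fine; apply: eq_integral => y /set_mem[yx nN]; rewrite /g patchE mem_set//.
    split => //; move: yx; rewrite /= !in_itv/=; lra.
  - exact: measurableU.
  - by apply: integrableS intg'.
  - by rewrite measureU0//; exact: lebesgue_measure_set1.
by rewrite E; ring.
Qed.

End AbsolutelyContinuousFTC.

(** * Partial derivatives as densities *)

Section IntervalIntegral.
Context (R : realType).
Local Notation mu := (@lebesgue_measure R).
Implicit Types h : R -> R.

Lemma integrable_itv h (A : set R) : measurable A -> mu.-integrable setT (EFin \o h) ->
  mu.-integrable A (EFin \o h).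
Proof. by move=> mA; apply: integrableS. Qed.

Lemma Rintegral_itv_cat h (a b c : R) : mu.-integrable setT (EFin \o h) ->
  a <= b -> b <= c ->
  \int[mu]_(x in `]a, c]) h x - \int[mu]_(x in `]a, b]) h x = \int[mu]_(x in `]b, c]) h x.
Proof.
move=> ih ab bc; apply: Rintegral_itvB; rewrite ?bnd_simp//.
exact: integrable_itv.
Qed.

Lemma ae_derive_integral h : mu.-integrable setT (EFin \o h) ->
  exists N : set R, [/\ measurable N, mu N = 0%E & forall x, ~ N x -> 0 < x ->
    derivable (fun u : R => \int[mu]_(t in `]0, u]) h t) x 1 /\
    derive1 (fun u : R => \int[mu]_(t in `]0, u]) h t) x = h x].
Proof.
move=> ih; have loc : locally_integrable setT h.
  by apply: open_integrable_locally => //; exact: openT.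
have [N [mN N0 sN]] := @FTC1 R h (BRight 0) (fun y => integrable_itv (measurable_itv _) ih) loc.
exists N; split => // x nNx x0; apply: contrapT => H; apply: nNx.
by apply: sN => /= H'; apply: H; exact: H'.
Qed.

Lemma derivable_near_eq (f g : R -> R) (x : R) :
  {near x, f =1 g} -> derivable f x 1 -> derivable g x 1 /\ derive1 g x = derive1 f x.
Proof.
move=> fg df; split; first exact: near_eq_derivable fg df.
by rewrite !derive1E; exact/esym/near_eq_derive.
Qed.

Lemma near_itv_oo (a b x : R) : a < x -> x < b -> \forall y \near x, a < y /\ y < b.
Proof.
move=> ax xb; near=> y; split; near: y; [exact: lt_nbhsr|exact: lt_nbhsl].
Unshelve. all: by end_near. Qed.

(** A limit along a sequence, so that derivatives can be compared with measurable functions. *)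
Lemma derivable_quotient (f : R -> R) (x : R) : derivable f x 1 ->
  (fun n : nat => n.+1%:R * (f (x + n.+1%:R^-1) - f x)) @ \oo --> derive1 f x.
Proof.
move=> df; apply/cvgrPdist_le => e e0.
have [dl dl0 H] := derivable_straddle df e0.
have := @cvg_harmonic R; move=> /cvgrPdist_lt/(_ _ dl0); apply: filterS => n.
have n0 : 0 < n.+1%:R^-1 :> R by rewrite invr_gt0 ltr0n.
rewrite sub0r normrN /harmonic gtr0_norm// => hd.
have := H x (x + n.+1%:R^-1) (lexx _); rewrite addrAC subrr add0r => /(_ _ _ hd).
rewrite invrK distrC mulrC; apply; [by rewrite lerDl ltW|by rewrite ltrDl].
Qed.

End IntervalIntegral.

(** * Densities of a coordinate of the wave map along one direction *)

Section Direction.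
Context (R : realType).
Local Notation mu := (@lebesgue_measure R).
Local Notation mu2 := (mu \x mu)%E.
Variables (S : R) (psi H F0 : R * R -> R) (f k : R -> R).
Hypothesis S0 : 0 < S.
Hypothesis cpsi : continuous psi.
Hypothesis intH : mu2.-integrable setT (EFin \o H).
Hypothesis secH : forall x, mu.-integrable setT (fun y => (H (x, y))%:E).
Hypothesis intF0 : mu2.-integrable setT (EFin \o F0).
Hypothesis secF0 : forall x, mu.-integrable setT (fun y => (F0 (x, y))%:E).
Hypothesis HF0 : forall p, `|H p| <= `|F0 p|.
Hypothesis acf : ac_real S f.
Hypothesis psiE : forall u v, 0 <= u <= S -> 0 <= v <= S ->
  psi (u, v) = f u + k v - f 0 - \int[mu2]_(p in `]0, u] `*` `]0, v]) H p.
Hypothesis dpsi : {ae mu2, forall p, (`]0, S[ `*` `]0, S[) p ->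
  derivable (fun w => psi (w, p.2)) p.1 1}.

Let K v w := \int[mu]_(z in `]0, v]) H (w, z).

Let intK v : mu.-integrable setT (EFin \o K v).
Proof. exact: integrable_Rintegral_section. Qed.

Let psiEK u v : 0 <= u <= S -> 0 <= v <= S ->
  psi (u, v) = f u + k v - f 0 - \int[mu]_(w in `]0, u]) K v w.
Proof. by move=> uS vS; rewrite psiE// Rintegral_section. Qed.

(** Derivability of the boundary datum comes from the wave map itself: on a suitable line at height
    [z] the map is derivable almost everywhere, and so is the integral term as a primitive of an
    integrable function. The datum is their sum up to a constant. *)
Let ae_derivable_f : exists N : set R, [/\ measurable N, mu N = 0%E &
  forall y, 0 < y -> y < S -> ~ N y -> derivable f y 1].
Proof.
have [M [mM M0 sM]] := dpsi.
have [z [z0 zS Mz]] : exists z, [/\ 0 < z, z < S & mu (ysection M z) = 0%E].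
  have [Y [mY Y0 sY]] := ae_sections mM M0.
  apply: contrapT => noz.
  (* If no height worked, the whole interval would lie in the null set of heights with a non-null
     section. *)
  have : (mu `]0%R, S[%classic <= mu Y)%E.
    apply: le_measure; rewrite ?inE// => z; rewrite /= in_itv/= => /andP[z0 zS].
    by apply: sY => /= Mz; apply: noz; exists z.
  rewrite /= in Y0; rewrite /= Y0 lebesgue_measure_itv/= lte_fin S0 -EFinD lee_fin subr0.
  by rewrite leNgt S0.
have [N [mN N0 HN]] := ae_derive_integral (intK z).
have mMz : measurable (ysection M z) by exact: measurable_ysection.
exists (N `|` ysection M z); split; first exact: measurableU.
  by rewrite measureU0.
move=> y y0 yS nN.
have dy : derivable (fun w => psi (w, z)) y 1.
  apply: contrapT => ndy; apply: nN; right.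
  rewrite ysectionE; apply: (sM (y, z)) => /= Hd; apply: ndy; apply: Hd.
  by split => /=; rewrite ?in_itv/= ?y0 ?z0.
have [dK _] := HN y (fun Ny => nN (or_introl Ny)) y0.
have : derivable (fun w => psi (w, z) + (f 0 - k z) + \int[mu]_(t in `]0, w]) K z t) y 1.
  exact: (derivableD (derivableD dy (derivable_cst _ _ _)) dK).
move=> /(@derivable_near_eq R _ f)[] //.
have := near_itv_oo y0 yS; apply: filterS => w [w0 wS].
by rewrite psiEK ?(ltW w0) ?(ltW wS) ?(ltW z0) ?(ltW zS)//; ring.
Qed.

(** What the partial derivative of [psi] in the first variable at [(w, v)] must be if [g] is the
    derivative of the boundary datum: the wave equation integrated in the second variable. *)
Definition slope (g : R -> R) v w := g w - \int[mu]_(z in `]0, v]) H (w, z).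

(** The slope is a density on every line. On the line at height [z] the derivative equals the slope
    at height [z] almost everywhere, and this differs from the slope at height [v] by an integral of
    [H] over []v, z]]. The exceptional set depends on [z]; to combine uncountably many of them, the
    points violating the estimate are collected in a measurable set of the plane whose horizontal
    sections are null. *)
Lemma direction_density : exists g : R -> R, [/\ mu.-integrable setT (EFin \o g),
  forall v, mu.-integrable setT (EFin \o slope g v),
  forall u u' v, 0 <= u -> u <= u' -> u' <= S -> 0 <= v <= S ->
    psi (u', v) - psi (u, v) = \int[mu]_(w in `]u, u']) slope g v w &
  forall v v', 0 <= v -> v <= v' -> v' <= S ->
    {ae mu2, forall p, (`]0, S[ `*` `]v, v'[) p ->
      derivable (fun w => psi (w, p.2)) p.1 1 ->
      `|derive1 (fun w => psi (w, p.2)) p.1 - slope g v p.1| <=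
        \int[mu]_(z in `]v, v']) `|F0 (p.1, z)|}].
Proof.
have [N [mN N0 df]] := ae_derivable_f.
have [g [intg gE]] := ac_FTC S0 acf mN N0 df.
have intsl v : mu.-integrable setT (EFin \o slope g v).
  exact: (integrableB measurableT intg (intK v)).
have psisl u v : 0 <= u <= S -> 0 <= v <= S ->
    psi (u, v) = k v + \int[mu]_(w in `]0, u]) slope g v w.
  move=> uS vS; rewrite psiEK// (gE u uS) RintegralB//; last 2 first.
  - exact: integrable_itv.
  - exact: (integrable_itv _ (intK v)).
  by rewrite /K; ring.
exists g; split => //.
  move=> u u' v u0 uu' u'S vS; rewrite (psisl u') ?(psisl u)//; last 2 first.
  + by rewrite u0 (le_trans uu').
  + by rewrite (le_trans u0).
  by rewrite -(Rintegral_itv_cat (intsl v) u0 uu'); ring.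
move=> v v' v0 vv' v'S.
have absF0 : mu2.-integrable setT (EFin \o (fun p => `|F0 p|)) by exact: integrable_norm.
pose e1 w := \int[mu]_(z in `]v, v']) `|F0 (w, z)|.
have inte1 : mu.-integrable setT (EFin \o e1).
  apply: (integrable_Rintegral_section (f := fun p => `|F0 p|)) => // x.
  exact: (integrable_norm (secF0 x)).
pose D n (p : R * R) := n.+1%:R * (psi (p.1 + n.+1%:R^-1, p.2) - psi p).
have mpsi : measurable_fun setT psi by exact: continuous2_measurable_fun.
have mD n : measurable_fun setT (D n).
  apply: measurable_funM => //; apply: measurable_funB => //.
  apply: (measurableT_comp mpsi); apply/measurable_fun_pair; last exact: measurable_snd.
  by apply: measurable_funD => //; exact: measurable_fst.
have msl : measurable_fun setT (fun p : R * R => slope g v p.1).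
  have /measurable_int/measurable_EFinP h := intsl v.
  by apply: (measurableT_comp h); exact: measurable_fst.
have me1 : measurable_fun setT (fun p : R * R => (e1 p.1)%:E).
  have /measurable_int h := inte1.
  by apply: (measurableT_comp h); exact: measurable_fst.
(* The upper limit exists at every point and is measurable; where [psi] is derivable it is the
   distance of the derivative to the slope. *)
pose L (p : R * R) := limn_esup (fun n => `|D n p - slope g v p.1|%:E).
have mL : measurable_fun setT L.
  apply: measurable_fun_limn_esup => n; apply/measurable_EFinP.
  by apply: measurableT_comp => //; apply: measurable_funB.
pose Bad : set (R * R) := (`]0, S[ `*` `]v, v'[) `&` [set p | ((e1 p.1)%:E < L p)%E].
have mBad : measurable Bad.
  apply: measurableI; first exact: measurableX.
  by rewrite -[X in measurable X]setTI; exact: emeasurable_fun_lt.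
have Llim p l : derivable (fun w => psi (w, p.2)) p.1 1 ->
    derive1 (fun w => psi (w, p.2)) p.1 = l -> L p = `|l - slope g v p.1|%:E.
  move=> dp lE; rewrite /L; have h := derivable_quotient dp; rewrite lE in h.
  have : (fun n => `|D n p - slope g v p.1|%:E) @ \oo --> `|l - slope g v p.1|%:E.
    apply: cvg_EFin; first by apply: nearW.
    apply: cvg_norm; apply: cvgB; last exact: cvg_cst.
    by case: p h {dp lE} => w z /= h; exact: h.
  by move=> /cvg_limn_einf_sup[].
exists Bad; split => //.
  apply: null_ysections => // z.
  have [zv|zv] := pselect (v < z /\ z < v'); last first.
    rewrite (_ : ysection Bad z = set0) ?measure0//; apply/seteqP; split => // w.
    by rewrite ysectionE /Bad/= => -[[_]]; rewrite /= in_itv/= => /andP[? ?]; case: zv.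
  case: zv => vz zv'; have zS : 0 <= z <= S by lra.
  have [M [mM M0 HM]] := ae_derive_integral (intsl z).
  apply: (@subset_measure0 _ _ _ mu _ M) => //; first exact: measurable_ysection.
  move=> w; rewrite ysectionE /Bad/= => -[[/=]]; rewrite in_itv/= => /andP[w0 wS] _.
  rewrite ltNge => /negP; rewrite -[M w]notK => nL nM; apply: nL.
  have [dM dME] := HM w nM w0.
  have dM' : derivable (fun u : R => \int[mu]_(t in `]0, u]) slope g z t + k z) w 1.
    exact: (derivableD dM (derivable_cst _ _ _)).
  have [] := @derivable_near_eq R _ (fun w => psi (w, z)) w _ dM'.
    have := near_itv_oo w0 wS; apply: filterS => y [y0 yS].
    by rewrite psisl ?(ltW y0) ?(ltW yS)// addrC.
  move=> d1 d2.
  have d3 : derive1 (fun w => psi (w, z)) w = slope g z w.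
    by rewrite d2 derive1E (deriveD dM (derivable_cst _ _ _)) derive_cst addr0 -derive1E dME.
  rewrite (Llim (w, z) _ d1 d3) lee_fin /slope.
  have -> : g w - \int[mu]_(z0 in `]0, z]) H (w, z0) - (g w - \int[mu]_(z0 in `]0, v]) H (w, z0))
      = - (\int[mu]_(z0 in `]v, z]) H (w, z0)).
    by rewrite -(Rintegral_itv_cat (secH w) v0 (ltW vz)); ring.
  rewrite normrN; apply: le_trans (le_normr_Rintegral _ _) _ => //.
    exact: (integrable_itv _ (secH w)).
  have iF : mu.-integrable setT (EFin \o (fun y => `|F0 (w, y)|)).
    exact: (integrable_norm (secF0 w)).
  have iH : mu.-integrable setT (EFin \o (fun y => `|H (w, y)|)).
    exact: (integrable_norm (secH w)).
  apply: (@le_trans _ _ (\int[mu]_(z0 in `]v, z]) `|F0 (w, z0)|)).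
    apply: le_Rintegral.
    - exact: measurable_itv.
    - exact: (integrable_itv (measurable_itv _) iH).
    - exact: (integrable_itv (measurable_itv _) iF).
    - by move=> y _; exact: HF0.
  rewrite /e1 -subr_ge0 (Rintegral_itv_cat iF (ltW vz) (ltW zv')).
  exact: Rintegral_ge0.
move=> p /= hp; split; first by apply: contrapT => np; apply: hp => /np.
rewrite /= ltNge; apply/negP => nL; apply: hp => pin dp.
by move: nL; rewrite (Llim p _ dp erefl) lee_fin.
Qed.

End Direction.

(** * Integrals of products of functions of one variable *)

Section ProductIntegral.
Context (R : realType).
Local Notation mu := (@lebesgue_measure R).
Local Notation mu2 := (mu \x mu)%E.

Lemma integrable_prod_fun (P Q : R -> R) : mu.-integrable setT (EFin \o P) ->
  mu.-integrable setT (EFin \o Q) ->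
  mu2.-integrable setT (EFin \o (fun p => P p.1 * Q p.2)).
Proof.
move=> iP iQ; have /measurable_int/measurable_EFinP mP := iP.
have /measurable_int/measurable_EFinP mQ := iQ.
have mPQ : measurable_fun setT (fun p : R * R => P p.1 * Q p.2).
  apply: measurable_funM; [apply: (measurableT_comp mP)|apply: (measurableT_comp mQ)].
    exact: measurable_fst.
  exact: measurable_snd.
apply/integrable12ltyP; first exact/measurable_EFinP.
have /integrableP[_ fP] := iP; have /integrableP[_ fQ] := iQ.
have mnQ : measurable_fun setT (fun y => `|Q y|%:E).
  by apply/measurable_EFinP; exact: measurableT_comp.
have mnP : measurable_fun setT (fun y => `|P y|%:E).
  by apply/measurable_EFinP; exact: measurableT_comp.
have Q0 : (0 <= \int[mu]_y `|Q y|%:E)%E by exact: integral_ge0.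
have inner x : (\int[mu]_y `|(EFin \o (fun p : R * R => (P p.1 * Q p.2)%R)) (x, y)| =
    `|P x|%:E * \int[mu]_y `|Q y|%:E)%E.
  rewrite -ge0_integralZl//.
  by apply: eq_integral => y _; rewrite /= normrM EFinM.
under eq_integral do rewrite inner.
rewrite ge0_integralZr// muleC lte_mul_pinfty//.
by rewrite ge0_fin_numE.
Qed.

Lemma Rintegral_prod_fun (P Q : R -> R) (A B : set R) : measurable A -> measurable B ->
  mu.-integrable setT (EFin \o P) -> mu.-integrable setT (EFin \o Q) ->
  \int[mu2]_(p in A `*` B) (P p.1 * Q p.2) =
  (\int[mu]_(x in A) P x) * (\int[mu]_(y in B) Q y).
Proof.
move=> mA mB iP iQ.
have sec x : mu.-integrable setT (fun y => (P x * Q y)%:E).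
  by under eq_fun do rewrite EFinM; exact: integrableZl.
rewrite (Rintegral_section mA mB (integrable_prod_fun iP iQ) sec) /=.
rewrite -RintegralZr//; last exact: (integrable_itv mA iP).
apply: eq_Rintegral => x _; rewrite RintegralZl//.
exact: (integrable_itv mB iQ).
Qed.

Lemma le_normr_Rintegral_ae (d : measure_display) (T : measurableType d)
    (m : {measure set T -> \bar R}) (D : set T) (X E : T -> R) : measurable D ->
  m.-integrable D (EFin \o X) -> m.-integrable D (EFin \o E) ->
  {ae m, forall p, D p -> `|X p| <= E p} ->
  `|\int[m]_(p in D) X p| <= \int[m]_(p in D) E p.
Proof.
move=> mD iX iE [N [mN N0 sN]]; rewrite /Rintegral !(negligible_integral mN mD)//.
have mDN : measurable (D `\` N) by exact: measurableD.
have iX' : m.-integrable (D `\` N) (EFin \o X) by apply: integrableS iX => //; exact: subDsetl.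
have iE' : m.-integrable (D `\` N) (EFin \o E) by apply: integrableS iE => //; exact: subDsetl.
apply: le_trans (le_normr_Rintegral mDN iX') _.
apply: le_Rintegral => //; first exact: integrable_norm.
move=> p [Dp nNp]; apply: contrapT => h; apply: nNp; apply: sN => /= H; apply: h; exact: H.
Qed.

End ProductIntegral.

Section MatrixDerivative.
Context (R : realType) (n : nat).

Lemma derivable_coord (f : R -> 'rV[R]_n.+1) (x : R) (i : 'I_n.+1) : derivable f x 1 ->
  derivable (fun w => f w 0 i) x 1 /\ derive1 (fun w => f w 0 i) x = derive1 f x 0 i.
Proof.
move=> df; split; first exact: (derivable_mxP _ _ _).1.
by rewrite !derive1E derive_mx// mxE.
Qed.

End MatrixDerivative.

(** * Densities of the wave map in both directions *)

Section WaveCells.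
Context (R : realType) (n : nat).
Local Notation mu := (@lebesgue_measure R).
Local Notation mu2 := (mu \x mu)%E.
Variables (S : R) (phip phim : R -> 'rV[R]_n.+1) (phi : R * R -> 'rV[R]_n.+1).
Hypothesis S0 : 0 < S.
Hypothesis acp : abs_continuous_on 0 S phip.
Hypothesis acm : abs_continuous_on 0 S phim.
Hypothesis corner : phip 0 = phim 0.
Hypothesis wphi : is_wave_map S S phip phim phi.

Local Notation psi := (clamped S phi).

Lemma clamped_id i u v : 0 <= u <= S -> 0 <= v <= S -> psi i (u, v) = phi (u, v) 0 i.
Proof. by move=> uS vS; rewrite /clamped !clamp_id. Qed.

Lemma derive_clamped_u i p : (`]0, S[ `*` `]0, S[) p ->
  derivable (fun w => phi (w, p.2)) p.1 1 ->
  derivable (fun w => psi i (w, p.2)) p.1 1 /\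
  derive1 (fun w => psi i (w, p.2)) p.1 = du phi p 0 i.
Proof.
case: p => w z [/=]; rewrite !in_itv/= => /andP[w0 wS] /andP[z0 zS] dw.
have [d1 d2] := derivable_coord i dw; rewrite /du/= -d2.
apply: derivable_near_eq => //.
have := near_itv_oo w0 wS; apply: filterS => y [y0 yS].
by rewrite clamped_id// !(ltW, y0, yS, z0, zS).
Qed.

Lemma derive_clamped_v i p : (`]0, S[ `*` `]0, S[) p ->
  derivable (fun z => phi (p.1, z)) p.2 1 ->
  derivable (fun z => psi i (p.1, z)) p.2 1 /\
  derive1 (fun z => psi i (p.1, z)) p.2 = dv phi p 0 i.
Proof.
case: p => w z [/=]; rewrite !in_itv/= => /andP[w0 wS] /andP[z0 zS] dw.
have [d1 d2] := derivable_coord i dw; rewrite /dv/= -d2.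
apply: derivable_near_eq => //.
have := near_itv_oo z0 zS; apply: filterS => y [y0 yS].
by rewrite clamped_id// !(ltW, y0, yS, w0, wS).
Qed.

Variable F0 : R * R -> R.
Hypothesis intF0 : mu2.-integrable setT (EFin \o F0).
Hypothesis sec1 : forall x, mu.-integrable setT (fun y => (F0 (x, y))%:E).
Hypothesis sec2 : forall y, mu.-integrable setT (fun x => (F0 (x, y))%:E).
Hypothesis cpsi : forall i, continuous (psi i).
Hypothesis psiE : forall i u v, 0 <= u <= S -> 0 <= v <= S ->
  phi (u, v) 0 i = phip u 0 i + phim v 0 i - phip 0 0 i
    - \int[mu2]_(p in `]0, u] `*` `]0, v]) (F0 p * psi i p).

Let psi1 i p : `|psi i p| <= 1.
Proof.
have [sph _ _ _] := wphi; apply: sphere_coord.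
by apply: sph; apply: clamp_itv; exact: ltW.
Qed.

Let mpsi i : measurable_fun setT (psi i).
Proof. exact: continuous2_measurable_fun. Qed.

Let H i p := F0 p * psi i p.

Let HF0 i p : `|H i p| <= `|F0 p|.
Proof. by rewrite normrM -[leRHS]mulr1; apply: ler_wpM2l. Qed.

Let mH i : measurable_fun setT (H i).
Proof.
apply: measurable_funM; last exact: mpsi.
by have /measurable_int/measurable_EFinP := intF0.
Qed.

Let intH i : mu2.-integrable setT (EFin \o H i).
Proof.
apply: le_integrable intF0 => //; first by apply/measurable_EFinP; exact: mH.
by move=> p _; rewrite /= lee_fin; exact: HF0.
Qed.

Let secH1 i x : mu.-integrable setT (fun y => (H i (x, y))%:E).
Proof.
apply: le_integrable (sec1 x) => //.
  by apply/measurable_EFinP; exact: (measurableT_comp (mH i)).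
by move=> p _; rewrite /= lee_fin; exact: HF0.
Qed.

Let secH2 i y : mu.-integrable setT (fun x => (H i (x, y))%:E).
Proof.
apply: le_integrable (sec2 y) => //.
  by apply/measurable_EFinP; exact: (measurableT_comp (mH i)).
by move=> p _; rewrite /= lee_fin; exact: HF0.
Qed.

Let dphi : {ae mu2, forall p, (`]0, S[ `*` `]0, S[) p ->
  derivable (fun w => phi (w, p.2)) p.1 1 /\ derivable (fun z => phi (p.1, z)) p.2 1}.
Proof.
have [_ [N [mN N0 sN]] _ _] := wphi; exists N; split => // p /= hp; apply: sN => /= h.
apply: hp => -[]; rewrite /= !in_itv/= => /andP[p1 p1'] /andP[p2 p2'].
by apply: h; split; rewrite /= ?in_itv/= !ltW.
Qed.

(* The v-direction is the u-direction for the transposed wave map. *)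
Lemma wave_densities : exists g k : 'I_n.+1 -> R -> R,
  [/\ forall i, mu.-integrable setT (EFin \o g i),
      forall i, mu.-integrable setT (EFin \o k i) &
  forall i, let p v w := g i w - \int[mu]_(z in `]0, v]) H i (w, z) in
    let q u z := k i z - \int[mu]_(w in `]0, u]) H i (w, z) in
  [/\ forall v, mu.-integrable setT (EFin \o p v),
      forall u, mu.-integrable setT (EFin \o q u),
      forall u u' v, 0 <= u -> u <= u' -> u' <= S -> 0 <= v <= S ->
        psi i (u', v) - psi i (u, v) = \int[mu]_(w in `]u, u']) p v w,
      forall u v v', 0 <= u <= S -> 0 <= v -> v <= v' -> v' <= S ->
        psi i (u, v') - psi i (u, v) = \int[mu]_(z in `]v, v']) q u z &
      forall u u' v v', 0 <= u -> u <= u' -> u' <= S -> 0 <= v -> v <= v' -> v' <= S ->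
        {ae mu2, forall x, (`]u, u'[ `*` `]v, v'[) x ->
          `|du phi x 0 i - p v x.1| <= \int[mu]_(z in `]v, v']) `|F0 (x.1, z)| /\
          `|dv phi x 0 i - q u x.2| <= \int[mu]_(w in `]u, u']) `|F0 (w, x.2)|}]].
Proof.
have FF : Filter (nbhs (almost_everywhere mu2)) by exact: ae_filter_ringOfSetsType.
have dirU i : exists g, [/\ mu.-integrable setT (EFin \o g),
    forall v, mu.-integrable setT (EFin \o slope (H i) g v),
    forall u u' v, 0 <= u -> u <= u' -> u' <= S -> 0 <= v <= S ->
      psi i (u', v) - psi i (u, v) = \int[mu]_(w in `]u, u']) slope (H i) g v w &
    forall v v', 0 <= v -> v <= v' -> v' <= S ->
      {ae mu2, forall p, (`]0, S[ `*` `]v, v'[) p ->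
        derivable (fun w => psi i (w, p.2)) p.1 1 ->
        `|derive1 (fun w => psi i (w, p.2)) p.1 - slope (H i) g v p.1| <=
          \int[mu]_(z in `]v, v']) `|F0 (p.1, z)|}].
  have [] := @direction_density R S (psi i) (H i) F0 (fun u => phip u 0 i)
    (fun v => phim v 0 i) S0 (@cpsi i) (intH i) (@secH1 i) intF0 sec1 (@HF0 i).
  - exact: abs_continuous_on_coord.
  - by move=> u v uS vS; rewrite clamped_id// psiE.
  - apply: filterS dphi => p dp pQ; have [dp1 _] := dp pQ.
    by have [] := derive_clamped_u i pQ dp1.
  - by move=> g [h1 h2 h3 h4]; exists g.
pose sw (p : R * R) := (p.2, p.1).
have dirV i : exists k, [/\ mu.-integrable setT (EFin \o k),
    forall u, mu.-integrable setT (EFin \o slope (H i \o sw) k u),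
    forall v v' u, 0 <= v -> v <= v' -> v' <= S -> 0 <= u <= S ->
      psi i (u, v') - psi i (u, v) = \int[mu]_(w in `]v, v']) slope (H i \o sw) k u w &
    forall u u', 0 <= u -> u <= u' -> u' <= S ->
      {ae mu2, forall p, (`]0, S[ `*` `]u, u'[) p ->
        derivable (fun w => psi i (p.2, w)) p.1 1 ->
        `|derive1 (fun w => psi i (p.2, w)) p.1 - slope (H i \o sw) k u p.1| <=
          \int[mu]_(z in `]u, u']) `|F0 (z, p.1)|}].
  have cps : continuous (psi i \o sw).
    move=> p; apply: (@continuous_comp _ _ _ sw (psi i)); last exact: cpsi.
    exact: swap_continuous.
  have [] := @direction_density R S (psi i \o sw) (H i \o sw) (F0 \o sw) (fun u => phim u 0 i)
    (fun v => phip v 0 i) S0 cps (integrable_swap (intH i)) (@secH2 i)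
    (integrable_swap intF0) sec2 (fun p => HF0 i (sw p)).
  - exact: abs_continuous_on_coord.
  - move=> u v uS vS; rewrite /sw/= clamped_id// psiE// corner.
    rewrite (Rintegral_section_swap _ _ (intH i))//.
    by ring.
  - have [N [mN N0 sN]] := dphi; have [mN' N'0] := null_swap mN N0.
    exists [set p | N (p.2, p.1)]; split => // p /= hp; apply: sN => /= h.
    apply: hp => -[p1 p2]; have [//|_ dp2] := h.
    by have [] := @derive_clamped_v i (p.2, p.1) (conj p2 p1) dp2.
  - by move=> k [h1 h2 h3 h4]; exists k.
have [g gP] := choice dirU; have [k kP] := choice dirV.
exists g, k; split => [i|i|i p q]; [by have [] := gP i|by have [] := kP i|].
have [_ g2 g3 g4] := gP i; have [_ k2 k3 k4] := kP i.
split; [exact: g2|exact: k2|exact: g3| |].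
  by move=> u v v' uS v0 vv' v'S; exact: k3.
move=> u u' v v' u0 uu' u'S v0 vv' v'S.
have aeU := g4 _ _ v0 vv' v'S.
have aeV : {ae mu2, forall x, (`]u, u'[ `*` `]0, S[) x ->
    derivable (fun w => psi i (x.1, w)) x.2 1 ->
    `|derive1 (fun w => psi i (x.1, w)) x.2 - q u x.2| <=
      \int[mu]_(z in `]u, u']) `|F0 (z, x.2)|}.
  have [N [mN N0 sN]] := k4 _ _ u0 uu' u'S; have [mN' N'0] := null_swap mN N0.
  exists [set p | N (p.2, p.1)]; split => // x /= hx; apply: sN => /= h.
  by apply: hx => -[x1 x2]; exact: h.
apply: filterS3 dphi aeU aeV => x h1 h2 h3 [x1 x2].
have xU : `]0, S[%classic x.1.
  move: x1; rewrite /= !in_itv/= => /andP[x1 x1'].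
  by rewrite (le_lt_trans u0 x1) (lt_le_trans x1' u'S).
have xV : `]0, S[%classic x.2.
  move: x2; rewrite /= !in_itv/= => /andP[x2 x2'].
  by rewrite (le_lt_trans v0 x2) (lt_le_trans x2' v'S).
have [du1 dv1] := h1 (conj xU xV).
have [du2 <-] := derive_clamped_u i (conj xU xV) du1.
have [dv2 <-] := derive_clamped_v i (conj xU xV) dv1.
by split; [exact: h2|exact: h3].
Qed.

End WaveCells.

(** * The wave map on a cell *)

Lemma ge0_Rintegral_subset (d : measure_display) (T : measurableType d) (R : realType)
    (m : {measure set T -> \bar R}) (D : set T) (h : T -> R) : measurable D ->
  m.-integrable setT (EFin \o h) -> (forall x, 0 <= h x) ->
  \int[m]_(x in D) h x <= \int[m]_x h x.
Proof.
move=> mD ih h0; rewrite Rintegral_mkcond; apply: le_Rintegral => //.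
  exact: integrable_patch.
by move=> x _; rewrite patchE; case: ifP.
Qed.

Section FiniteSums.
Context (d : measure_display) (T : measurableType d) (R : realType) (n : nat).
Variables (m : {measure set T -> \bar R}) (h : 'I_n -> T -> R).
Hypothesis ih : forall i, m.-integrable setT (EFin \o h i).

Lemma integrable_sumR : m.-integrable setT (EFin \o (fun x => \sum_i h i x)).
Proof.
apply: (eq_integrable measurableT (fun x => \sum_i (EFin \o h i) x)%E).
  by move=> x _; rewrite /= sumEFin.
by apply: integrable_sum.
Qed.

Lemma Rintegral_sum (D : set T) : measurable D ->
  \int[m]_(x in D) (\sum_i h i x) = \sum_i \int[m]_(x in D) h i x.
Proof.
move=> mD; have ihD i : m.-integrable D (EFin \o h i) by apply: integrableS (ih i).
rewrite /Rintegral; under eq_integral do rewrite -sumEFin.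
rewrite (integral_sum mD ihD) sum_fine// => i _.
exact: (integrable_fin_num mD (ihD i)).
Qed.

End FiniteSums.

Lemma ae_forall_fin (d : measure_display) (T : measurableType d) (R : realType)
    (m : {measure set T -> \bar R}) (n : nat) (P : 'I_n -> T -> Prop) :
  (forall i, {ae m, forall x, P i x}) -> {ae m, forall x, forall i, P i x}.
Proof.
move=> aeP; have FF : Filter (nbhs (almost_everywhere m)) by exact: ae_filter_ringOfSetsType.
have : {ae m, forall x, forall k (kn : (k < n)%N), P (Ordinal kn) x}.
  apply: ae_foralln => k; case: (pselect (k < n)%N) => kn.
    by have := aeP (Ordinal kn); apply: filterS => x Px kn'; rewrite (bool_irrelevance kn' kn).
  by apply: aeW => x kn'; case: kn.
by apply: filterS => x Px i; have := Px i (ltn_ord i); congr P; exact/val_inj.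
Qed.

Section WaveCellEstimate.
Context (R : realType) (n : nat).
Local Notation mu := (@lebesgue_measure R).
Local Notation mu2 := (mu \x mu)%E.
Variables (S : R) (phip phim : R -> 'rV[R]_n.+1) (phi : R * R -> 'rV[R]_n.+1).
Hypothesis S0 : 0 < S.
Hypothesis acp : abs_continuous_on 0 S phip.
Hypothesis acm : abs_continuous_on 0 S phim.
Hypothesis corner : phip 0 = phim 0.
Hypothesis wphi : is_wave_map S S phip phim phi.

(** The part [2 * n.+1] comes from replacing the product of derivatives by the product of densities
    in [n.+1] coordinates, the 1 from freezing the wave map at the corner of the cell. *)
Let C : R := (2 * n.+1 + 1)%:R.

(** The mixed difference is minus the integral over the cell of [F0] times the coordinate. Freezing
    the coordinate at the corner costs its oscillation on the cell. The inner product of the two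
    increments is the integral of a sum of products of densities, and those densities are close to
    the partial derivatives, whose inner product is [F0]. *)
Lemma wave_cells : exists (A B : R -> R) (F0 : R * R -> R),
  [/\ mu.-integrable setT (EFin \o A), mu.-integrable setT (EFin \o B),
      (forall x, 0 <= A x) /\ (forall x, 0 <= B x), mu2.-integrable setT (EFin \o F0) &
  [/\
    forall i u u' v, 0 <= u -> u <= u' -> u' <= S -> 0 <= v <= S ->
      `|phi (u', v) 0 i - phi (u, v) 0 i| <= \int[mu]_(w in `]u, u']) A w,
    forall i u v v', 0 <= u <= S -> 0 <= v -> v <= v' -> v' <= S ->
      `|phi (u, v') 0 i - phi (u, v) 0 i| <= \int[mu]_(z in `]v, v']) B z &
    forall i u u' v v', 0 <= u -> u <= u' -> u' <= S -> 0 <= v -> v <= v' -> v' <= S ->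
      `|phi (u', v') 0 i - phi (u', v) 0 i - phi (u, v') 0 i + phi (u, v) 0 i
        + dot (phi (u', v) - phi (u, v)) (phi (u, v') - phi (u, v)) * phi (u, v) 0 i| <=
      C * (\int[mu2]_(x in `]u, u'] `*` `]v, v']) `|F0 x|) *
        (\int[mu]_(w in `]u, u']) A w + \int[mu]_(z in `]v, v']) B z)]].
Proof.
have FF : Filter (nbhs (almost_everywhere mu2)) by exact: ae_filter_ringOfSetsType.
have [F0 [intF0 sec1 sec2 F0E cpsi']] := wave_map_data S0 acp acm wphi.
have cpsi i : continuous (clamped S phi i) by have [] := cpsi' i.
have psiE i u v : 0 <= u <= S -> 0 <= v <= S ->
  phi (u, v) 0 i = phip u 0 i + phim v 0 i - phip 0 0 i
    - \int[mu2]_(p in `]0, u] `*` `]0, v]) (F0 p * clamped S phi i p).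
  by have [_] := cpsi' i; apply.
have [g [k [intg intk dens]]] := wave_densities S0 acp acm corner wphi intF0 sec1 sec2 cpsi psiE.
pose H i x := F0 x * clamped S phi i x.
pose p i v w := g i w - \int[mu]_(z in `]0, v]) H i (w, z).
pose q i u z := k i z - \int[mu]_(w in `]0, u]) H i (w, z).
have absF0 : mu2.-integrable setT (EFin \o (fun x => `|F0 x|)) by exact: integrable_norm.
have asec1 x : mu.-integrable setT (EFin \o (fun y => `|F0 (x, y)|)).
  exact: (integrable_norm (sec1 x)).
have asec2 y : mu.-integrable setT (EFin \o (fun x => `|F0 (x, y)|)).
  exact: (integrable_norm (sec2 y)).
pose a1 w := \int[mu]_z `|F0 (w, z)|.
pose b1 z := \int[mu]_w `|F0 (w, z)|.
have inta1 : mu.-integrable setT (EFin \o a1).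
  exact: (integrable_Rintegral_section (f := fun x => `|F0 x|)).
have intb1 : mu.-integrable setT (EFin \o b1).
  apply: (integrable_Rintegral_section (f := fun x => `|F0 (x.2, x.1)|)) => //.
  exact: (integrable_swap absF0).
(* [A] bounds the slopes of all coordinates on all lines at once, since the slope moves away from
   [g i] by at most [a1]; [B] does the same in the other direction. *)
pose A w := \sum_i `|g i w| + a1 w.
pose B z := \sum_i `|k i z| + b1 z.
have intsum (h : 'I_n.+1 -> R -> R) : (forall i, mu.-integrable setT (EFin \o h i)) ->
    mu.-integrable setT (EFin \o (fun x => \sum_i `|h i x|)).
  move=> ih; have := @integrable_sumR _ _ R _ mu (fun i x => `|h i x|); apply => i.
  exact: (integrable_norm (ih i)).
have intA : mu.-integrable setT (EFin \o A).
  exact: (integrableD measurableT (intsum _ intg) inta1).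
have intB : mu.-integrable setT (EFin \o B).
  exact: (integrableD measurableT (intsum _ intk) intb1).
have a10 x : 0 <= a1 x by exact: Rintegral_ge0.
have b10 x : 0 <= b1 x by exact: Rintegral_ge0.
have A0 x : 0 <= A x by rewrite addr_ge0// sumr_ge0.
have B0 x : 0 <= B x by rewrite addr_ge0// sumr_ge0.
have [sph _ _ _] := wphi.
have psi1 i x : `|clamped S phi i x| <= 1.
  by apply: sphere_coord; apply: sph; apply: clamp_itv; exact: ltW.
have mF0 : measurable_fun setT F0 by have /measurable_int/measurable_EFinP := intF0.
have mH i : measurable_fun setT (H i).
  by apply: measurable_funM => //; exact: continuous2_measurable_fun.
have HF0 i x : `|H i x| <= `|F0 x|.
  by rewrite normrM -[leRHS]mulr1; apply: ler_wpM2l.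
have intH i : mu2.-integrable setT (EFin \o H i).
  apply: le_integrable intF0 => //; first by apply/measurable_EFinP; exact: mH.
  by move=> x _; rewrite /= lee_fin; exact: HF0.
have secH1 i x : mu.-integrable setT (EFin \o (fun y => H i (x, y))).
  apply: le_integrable (sec1 x) => //.
    by apply/measurable_EFinP; exact: (measurableT_comp (mH i)).
  by move=> y _; rewrite /= lee_fin; exact: HF0.
have secH2 i y : mu.-integrable setT (EFin \o (fun x => H i (x, y))).
  apply: le_integrable (sec2 y) => //.
    by apply/measurable_EFinP; exact: (measurableT_comp (mH i)).
  by move=> x _; rewrite /= lee_fin; exact: HF0.
have bndint (h h' : R -> R) D : measurable D -> mu.-integrable setT (EFin \o h) ->
    mu.-integrable setT (EFin \o h') -> (forall x, `|h x| <= h' x) ->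
    `|\int[mu]_(x in D) h x| <= \int[mu]_(x in D) h' x.
  move=> mD ih ih' hh'; apply: le_trans (le_normr_Rintegral mD (integrable_itv mD ih)) _.
  apply: le_Rintegral => //; first exact: (integrable_itv mD (integrable_norm ih)).
  exact: (integrable_itv mD ih').
have bndT (h h' : R -> R) D : measurable D -> mu.-integrable setT (EFin \o h) ->
    mu.-integrable setT (EFin \o h') -> (forall x, `|h x| <= h' x) ->
    `|\int[mu]_(x in D) h x| <= \int[mu]_x h' x.
  move=> mD ih ih' hh'; apply: le_trans (bndint _ _ _ mD ih ih' hh') _.
  by apply: ge0_Rintegral_subset => // x; exact: le_trans (hh' x).
have pA i v w : `|p i v w| <= A w.
  apply: le_trans (ler_normB _ _) _; apply: lerD.
    by rewrite (bigD1 i)//= lerDl sumr_ge0.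
  by apply: bndT => // x; exact: HF0.
have qB i u z : `|q i u z| <= B z.
  apply: le_trans (ler_normB _ _) _; apply: lerD.
    by rewrite (bigD1 i)//= lerDl sumr_ge0.
  by apply: bndT => // x; exact: HF0.
have intp i v : mu.-integrable setT (EFin \o p i v).
  by have [h _ _ _ _] := dens i; exact: h.
have intq i u : mu.-integrable setT (EFin \o q i u).
  by have [_ h _ _ _] := dens i; exact: h.
have pE i u u' v : 0 <= u -> u <= u' -> u' <= S -> 0 <= v <= S ->
    clamped S phi i (u', v) - clamped S phi i (u, v) = \int[mu]_(w in `]u, u']) p i v w.
  by have [_ _ h _ _] := dens i; exact: h.
have qE i u v v' : 0 <= u <= S -> 0 <= v -> v <= v' -> v' <= S ->
    clamped S phi i (u, v') - clamped S phi i (u, v) = \int[mu]_(z in `]v, v']) q i u z.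
  by have [_ _ _ h _] := dens i; exact: h.
have dU i u u' v : 0 <= u -> u <= u' -> u' <= S -> 0 <= v <= S ->
      `|clamped S phi i (u', v) - clamped S phi i (u, v)| <= \int[mu]_(w in `]u, u']) A w.
  by move=> *; rewrite pE//; apply: bndint.
have dV i u v v' : 0 <= u <= S -> 0 <= v -> v <= v' -> v' <= S ->
      `|clamped S phi i (u, v') - clamped S phi i (u, v)| <= \int[mu]_(z in `]v, v']) B z.
  by move=> *; rewrite qE//; apply: bndint.
exists A, B, F0; split => //; split.
- move=> i u u' v u0 uu' u'S vS; rewrite -!(@clamped_id R n S phi) ?u0 ?u'S ?andbT//; first exact: dU.
  + exact: le_trans uu' _.
  + exact: le_trans u0 _.
- move=> i u v v' uS v0 vv' v'S; rewrite -!(@clamped_id R n S phi) ?v0 ?v'S ?andbT//; first exact: dV.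
  + exact: le_trans vv' _.
  + exact: le_trans v0 _.
move=> i u u' v v' u0 uu' u'S v0 vv' v'S.
have uS : 0 <= u <= S by rewrite u0 (le_trans uu').
have vS : 0 <= v <= S by rewrite v0 (le_trans vv').
have uS' : 0 <= u' <= S by rewrite u'S (le_trans u0).
have vS' : 0 <= v' <= S by rewrite v'S (le_trans v0).
set I := `]u, u']%classic; set J := `]v, v']%classic.
have mI : measurable I by exact: measurable_itv.
have mJ : measurable J by exact: measurable_itv.
have mIJ : measurable (I `*` J) by exact: measurableX.
set nu := \int[mu2]_(x in I `*` J) `|F0 x|.
set DA := \int[mu]_(w in I) A w; set DB := \int[mu]_(w in J) B w.
have nu0 : 0 <= nu by exact: Rintegral_ge0.
have DA0 : 0 <= DA by exact: Rintegral_ge0.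
have DB0 : 0 <= DB by exact: Rintegral_ge0.
have mixed : clamped S phi i (u', v') - clamped S phi i (u', v) - clamped S phi i (u, v')
    + clamped S phi i (u, v) = - \int[mu2]_(x in I `*` J) H i x.
  transitivity (\int[mu]_(w in I) p i v' w - \int[mu]_(w in I) p i v w).
    by rewrite -!pE//; ring.
  rewrite -RintegralB//; try exact: (integrable_itv mI (intp _ _)).
  rewrite (Rintegral_section mI mJ (intH i) (secH1 i)).
  transitivity (\int[mu]_(w in I) (- 1 * \int[mu]_(z in J) H i (w, z))).
    apply: eq_Rintegral => w _; rewrite /p mulN1r.
    by rewrite -(Rintegral_itv_cat (secH1 i w) v0 vv'); ring.
  rewrite RintegralZl//; first by rewrite mulN1r.
  exact: (integrable_itv mI (integrable_Rintegral_section mJ (intH i) (secH1 i))).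
(* The densities are taken on the lower and the left edge of the cell. Each factor depends on one
   variable only, so the integral of the product is the product of the two increments. *)
pose dd x := \sum_j p j v x.1 * q j u x.2.
have ipq j : mu2.-integrable setT (EFin \o (fun x => p j v x.1 * q j u x.2)).
  exact: integrable_prod_fun.
have dotE : dot (phi (u', v) - phi (u, v)) (phi (u, v') - phi (u, v)) =
    \int[mu2]_(x in I `*` J) dd x.
  rewrite /dot (@Rintegral_sum _ _ R _ mu2 (fun j x => p j v x.1 * q j u x.2) ipq _ mIJ).
  apply: eq_bigr => j _; rewrite !mxE Rintegral_prod_fun// -pE// -qE//.
  by rewrite !(@clamped_id R n S phi).
have intdd : mu2.-integrable setT (EFin \o dd).
  exact: (@integrable_sumR _ _ R _ mu2 (fun j x => p j v x.1 * q j u x.2)).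
pose e1 w := \int[mu]_(z in J) `|F0 (w, z)|.
pose e2 z := \int[mu]_(w in I) `|F0 (w, z)|.
have inte1 : mu.-integrable setT (EFin \o e1).
  exact: (integrable_Rintegral_section (f := fun x => `|F0 x|)).
have inte2 : mu.-integrable setT (EFin \o e2).
  apply: (integrable_Rintegral_section (f := fun x => `|F0 (x.2, x.1)|)) => //.
  exact: (integrable_swap absF0).
have e1nu : \int[mu]_(w in I) e1 w = nu by rewrite /nu Rintegral_section.
have e2nu : \int[mu]_(z in J) e2 z = nu.
  rewrite /nu (Rintegral_section_swap mI mJ absF0) Rintegral_section//.
  exact: (integrable_swap absF0).
have e10 w : 0 <= e1 w by exact: Rintegral_ge0.
have e20 w : 0 <= e2 w by exact: Rintegral_ge0.
have e2B z : e2 z <= B z.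
  apply: (@le_trans _ _ (b1 z)); first exact: ge0_Rintegral_subset.
  by rewrite lerDr sumr_ge0.
(* [E1] bounds the error in the [u] density times a derivative in [v], and [E2] a density in [u]
   times the error in the [v] density. The former is counted twice, because the derivative in [v] is
   at most [|q| + e2], hence at most [2 * B]. *)
pose E1 (x : R * R) := e1 x.1 * B x.2; pose E2 (x : R * R) := A x.1 * e2 x.2.
have iE1 : mu2.-integrable setT (EFin \o E1) by exact: integrable_prod_fun.
have iE2 : mu2.-integrable setT (EFin \o E2) by exact: integrable_prod_fun.
pose E x := n.+1%:R * (2 * E1 x + E2 x).
have iE' : mu2.-integrable setT (EFin \o (fun x => 2 * E1 x + E2 x)).
  exact: (integrableD measurableT (integrableZl measurableT 2 iE1) iE2).
have iE : mu2.-integrable setT (EFin \o E).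
  exact: (integrableZl measurableT n.+1%:R iE').
have restr (h : R * R -> R) : mu2.-integrable setT (EFin \o h) ->
    mu2.-integrable (I `*` J) (EFin \o h) by apply: integrableS.
have intE : \int[mu2]_(x in I `*` J) E x = n.+1%:R * (nu * (2 * DB + DA)).
  rewrite RintegralZl//; last exact: restr.
  rewrite RintegralD//; last 2 first.
  - exact: (restr _ (integrableZl measurableT 2 iE1)).
  - exact: restr.
  rewrite RintegralZl//; last exact: restr.
  rewrite (Rintegral_prod_fun mI mJ inte1 intB) (Rintegral_prod_fun mI mJ intA inte2).
  by rewrite e1nu e2nu -/DA -/DB; ring.
(* The cells contain their upper and right edges, while the density estimates hold on open cells;
   these two edges are null. *)
have lines : {ae mu2, forall x : R * R, x.1 != u' /\ x.2 != v'}.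
  have m1 : measurable ([set u'] `*` [set: R]) by exact: measurableX.
  have m2 : measurable ([set: R] `*` [set v']) by exact: measurableX.
  exists (([set u'] `*` [set: R]) `|` ([set: R] `*` [set v'])); split.
  - exact: measurableU.
  - rewrite measureU0//= product_measure1E//=.
      by rewrite lebesgue_measure_set1 mul0e.
    by rewrite lebesgue_measure_set1 mule0.
  - move=> x /= hx; apply: contrapT => nx; apply: hx; split; apply/eqP => xe; apply: nx.
      by left.
    by right.
have aebd : {ae mu2, forall x, (I `*` J) x -> `|F0 x - dd x| <= E x}.
  have all_dens : {ae mu2, forall x, forall j : 'I_n.+1, (`]u, u'[ `*` `]v, v'[) x ->
      `|du phi x 0 j - p j v x.1| <= e1 x.1 /\ `|dv phi x 0 j - q j u x.2| <= e2 x.2}.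
    apply: ae_forall_fin => j; have [_ _ _ _ h] := dens j.
    exact: (h u u' v v' u0 uu' u'S v0 vv' v'S).
  apply: filterS3 lines F0E all_dens => x [x1 x2] F0x hd [xI xJ].
  move: xI xJ; rewrite /I /J /= !in_itv/= => /andP[ux xu] /andP[vx xv].
  have xu' : x.1 < u' by rewrite lt_neqAle x1.
  have xv' : x.2 < v' by rewrite lt_neqAle x2.
  rewrite F0x; last first.
    by split; rewrite /= in_itv/= ?(le_lt_trans u0 ux) ?(le_lt_trans v0 vx) ?(lt_le_trans xu' u'S)
      ?(lt_le_trans xv' v'S).
  rewrite /dot /dd -sumrB; apply: le_trans (ler_norm_sum _ _ _) _.
  have -> : E x = \sum_(j < n.+1) (2 * E1 x + E2 x) by rewrite sumr_const card_ord /E mulr_natl.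
  apply: ler_sum => j _; have [] := hd j.
    by split; rewrite /= in_itv/= ?ux ?vx.
  move=> h1 h2; rewrite (_ : _ - _ = (du phi x 0 j - p j v x.1) * dv phi x 0 j
     + p j v x.1 * (dv phi x 0 j - q j u x.2)); last by ring.
  apply: le_trans (ler_normD _ _) _; rewrite !normrM; apply: lerD; last first.
    by apply: ler_pM.
  rewrite /E1 mulrCA; apply: ler_pM => //.
  rewrite -(subrK (q j u x.2) (dv phi x 0 j)); apply: le_trans (ler_normD _ _) _.
  by rewrite mulr_natl mulr2n; apply: lerD => //; exact: le_trans h2 _.
have main1 : `|\int[mu2]_(x in I `*` J) F0 x - dot (phi (u', v) - phi (u, v)) (phi (u, v') - phi (u, v))|
    <= n.+1%:R * (nu * (2 * DB + DA)).
  rewrite dotE -RintegralB//; [|exact: restr|exact: restr].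
  rewrite -intE; apply: le_normr_Rintegral_ae => //; last exact: restr.
  exact: (restr _ (integrableB measurableT intF0 intdd)).
pose c := clamped S phi i (u, v).
have main2 : `|\int[mu2]_(x in I `*` J) H i x - c * \int[mu2]_(x in I `*` J) F0 x| <= (DA + DB) * nu.
  rewrite -RintegralZl//; last exact: restr.
  have icF : mu2.-integrable setT (EFin \o (fun x => c * F0 x)).
    exact: (integrableZl measurableT c intF0).
  rewrite -RintegralB//; [|exact: restr|exact: restr].
  rewrite -RintegralZl//; last exact: restr.
  apply: le_normr_Rintegral_ae => //.
  - exact: (restr _ (integrableB measurableT (intH i) icF)).
  - exact: (restr _ (integrableZl measurableT (DA + DB) absF0)).
  apply: aeW => x [xI xJ]; move: xI xJ; rewrite /I /J /= !in_itv/= => /andP[ux xu] /andP[vx xv].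
  rewrite /H mulrC -mulrBl normrM; apply: ler_wpM2r => //.
  have x1S : 0 <= x.1 <= S by rewrite (le_trans u0 (ltW ux)) (le_trans xu u'S).
  (* The oscillation is estimated along the path from the corner that follows the lower edge and
     then goes up. *)
  have -> : clamped S phi i x - c = (clamped S phi i (x.1, x.2) - clamped S phi i (x.1, v))
     + (clamped S phi i (x.1, v) - c) by case: (x) => ? ? /=; ring.
  apply: le_trans (ler_normD _ _) _; rewrite addrC; apply: lerD.
    apply: le_trans (dU i u x.1 v u0 (ltW ux) (le_trans xu u'S) vS) _.
    rewrite -subr_ge0 (Rintegral_itv_cat intA (ltW ux) xu); exact: Rintegral_ge0.
  apply: le_trans (dV i x.1 v x.2 x1S v0 (ltW vx) (le_trans xv v'S)) _.
  rewrite -subr_ge0 (Rintegral_itv_cat intB (ltW vx) xv); exact: Rintegral_ge0.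
rewrite -!(@clamped_id R n S phi)// mixed -/c.
set FI := \int[mu2]_(x in I `*` J) F0 x in main1 main2 *.
set HI := \int[mu2]_(x in I `*` J) H i x in main2 *.
set D := dot _ _ in main1 *.
have -> : - HI + D * c = - (HI - c * FI) - c * (FI - D) by ring.
apply: le_trans (ler_normB _ _) _; rewrite normrN normrM.
have c1 : `|c| <= 1 by exact: psi1.
have : `|c| * `|FI - D| <= n.+1%:R * (nu * (2 * DB + DA)).
  by rewrite -[leRHS]mul1r; apply: ler_pM.
have nuDA : 0 <= n.+1%:R * (nu * DA) :> R by rewrite !mulr_ge0.
move=> bnd; clear - main2 nuDA bnd; move: main2 nuDA bnd; rewrite /C natrD natrM.
move: `|HI - _| (`|c| * _) => X Y; nra.
Qed.

End WaveCellEstimate.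

(** * The discrete wave map *)

Section DotAlgebra.
Context (R : realType) (n : nat).
Implicit Types P Q A B : 'rV[R]_n.+1.

Lemma dotC P Q : dot P Q = dot Q P.
Proof. by apply: eq_bigr => i _; rewrite mulrC. Qed.

Lemma dotDl P Q A : dot (P + Q) A = dot P A + dot Q A.
Proof. by rewrite -big_split; apply: eq_bigr => i _; rewrite !mxE mulrDl. Qed.

Lemma dotZl c P A : dot (c *: P) A = c * dot P A.
Proof. by rewrite mulr_sumr; apply: eq_bigr => i _; rewrite !mxE mulrA. Qed.

Lemma dotNl P A : dot (- P) A = - dot P A.
Proof. by rewrite -scaleN1r dotZl mulN1r. Qed.

Lemma dotDr P Q A : dot A (P + Q) = dot A P + dot A Q.
Proof. by rewrite !(dotC A) dotDl. Qed.

Lemma dotZr c P A : dot A (c *: P) = c * dot A P.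
Proof. by rewrite !(dotC A) dotZl. Qed.

Lemma dotNr P A : dot A (- P) = - dot A P.
Proof. by rewrite !(dotC A) dotNl. Qed.

Definition dotE := (dotDl, dotDr, dotNl, dotNr, dotZl, dotZr).

Lemma dot_eq0 P : (dot P P == 0) = (P == 0).
Proof.
apply/idP/idP => [|/eqP ->]; last by rewrite /dot big1// => i _; rewrite mxE mul0r.
rewrite psumr_eq0; last by move=> i _; rewrite -expr2 sqr_ge0.
move=> /allP h; apply/eqP/rowP => i; rewrite mxE.
by have := h i (mem_index_enum _); rewrite /= mulf_eq0 orbb => /eqP.
Qed.

Lemma enorm_sqr P : enorm P ^+ 2 = dot P P.
Proof. by rewrite sqr_sqrtr// dot_ge0. Qed.

Lemma sphere_dot P : unit_sphere n.+1 P <-> dot P P = 1.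
Proof.
split=> [PS|PS]; first by rewrite -enorm_sqr PS expr1n.
by rewrite /unit_sphere/= /enorm PS sqrtr1.
Qed.

Lemma normr_row_le P (c : R) : 0 <= c -> (forall i, `|P 0 i| <= c) -> `|P| <= c.
Proof.
move=> c0 h; rewrite [leLHS]/Num.norm/= mx_normrE; apply: bigmax_le => // -[i j] _.
by rewrite ord1; exact: h.
Qed.

Lemma coord_le_normr P i : `|P 0 i| <= `|P|.
Proof.
by rewrite [leRHS]/Num.norm/= mx_normrE; apply: (le_bigmax _ (fun ij => `|P ij.1 ij.2|) (0, i)).
Qed.

Lemma normr_le_enorm P : `|P| <= enorm P.
Proof. by apply: normr_row_le => [|i]; [exact: sqrtr_ge0|exact: normr_coord_enorm]. Qed.

Lemma sphere_normr P : unit_sphere n.+1 P -> `|P| <= 1.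
Proof. by move=> <-; exact: normr_le_enorm. Qed.

Lemma normr_dot P Q : `|dot P Q| <= n.+1%:R * `|P| * `|Q|.
Proof.
apply: le_trans (ler_norm_sum _ _ _) _.
have -> : n.+1%:R * `|P| * `|Q| = \sum_(i < n.+1) `|P| * `|Q|.
  by rewrite sumr_const card_ord -mulrA mulr_natl.
by apply: ler_sum => i _; rewrite normrM; apply: ler_pM => //; exact: coord_le_normr.
Qed.

Lemma enorm_le_normr P : enorm P <= n.+1%:R * `|P|.
Proof.
rewrite -(@ler_pXn2r _ 2)// ?nnegrE ?mulr_ge0 ?sqrtr_ge0// enorm_sqr.
apply: le_trans (ler_norm _) _; apply: le_trans (normr_dot _ _) _.
have -> : (n.+1%:R * `|P|) ^+ 2 = n.+1%:R * `|P| * `|P| * n.+1%:R by ring.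
by rewrite ler_peMr ?ler1n// !mulr_ge0.
Qed.

End DotAlgebra.

(** * The reflection that defines the discrete wave map *)

Section Reflection.
Context (R : realType) (n : nat).
Variables (A B P : 'rV[R]_n.+1).
Hypothesis A1 : unit_sphere n.+1 A.
Hypothesis B1 : unit_sphere n.+1 B.
Hypothesis P1 : unit_sphere n.+1 P.

Let D := reflection (A + B) P.
Let AA : dot A A = 1. Proof. exact/sphere_dot. Qed.
Let BB : dot B B = 1. Proof. exact/sphere_dot. Qed.
Let PP : dot P P = 1. Proof. exact/sphere_dot. Qed.
(** For unit vectors [q] is the squared length of [A + B], and [c] is the inner product of [A + B]
    with [P]. *)
Let q : R := 2 + 2 * dot A B.
Let c : R := dot A P + dot B P.

Let DE : A + B != 0 -> q != 0 /\ D = (2 * c / q) *: (A + B) - P.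
Proof.
move=> AB; have qE : q = dot (A + B) (A + B) by rewrite !dotE AA BB (dotC B A) /q; ring.
split; first by rewrite qE dot_eq0.
rewrite /D /reflection (negbTE AB) enorm_sqr -qE dotDl -/c.
by congr (_ *: _ - _); rewrite mulrAC.
Qed.

(** The reflection is an isometry that exchanges the unit vectors [A] and [B]. This remains true
    when [A + B] vanishes, where it is the antipodal map. *)
Let swapped : dot D A = dot P B /\ dot D B = dot P A.
Proof.
have [AB0|AB0] := eqVneq (A + B) 0.
  have BA : B = - A by apply/eqP; rewrite -addr_eq0 addrC AB0.
  rewrite /D /reflection AB0 eqxx BA !dotE. by rewrite opprK (dotC P A).
have [q0 ->] := DE AB0; rewrite !dotE AA BB (dotC B A) (dotC P A) (dotC P B).
have e : 2 * c / q * (1 + dot A B) = c by rewrite /q; field; exact: q0.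
by split; rewrite ?[dot A B + 1]addrC e /c; ring.
Qed.

Lemma reflection_sphere : unit_sphere n.+1 D.
Proof.
apply/sphere_dot; have [AB0|AB0] := eqVneq (A + B) 0.
  by rewrite /D /reflection AB0 eqxx !dotE opprK.
have [q0 ->] := DE AB0; rewrite !dotE AA BB PP (dotC B A) (dotC P A) (dotC P B).
have -> : dot A B = (q - 2) / 2 by rewrite /q; field.
have -> : dot A P = c - dot B P by rewrite /c addrK.
by field.
Qed.

Lemma reflection_enorm : enorm (D - A) = enorm (B - P) /\ enorm (D - B) = enorm (A - P).
Proof.
have DD : dot D D = 1 by apply/sphere_dot; exact: reflection_sphere.
have [DA DB] := swapped; split; congr Num.sqrt;
  rewrite !dotE ?DD ?AA ?BB ?PP ?(dotC A D) ?(dotC B D) ?DA ?DB ?(dotC P A) ?(dotC P B); ring.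
Qed.

(** The left side is exactly [dot a b] times [(1 - 4 / q) P - (2 / q) (a + b)], because
    [dot a b = q / 2 - c]. Moreover [4 - q] is the squared length of [a - b], so the second factor
    is of the order of the increments. Smallness gives [q >= 3], which excludes antipodal
    neighbours. *)
Lemma reflection_mixed_difference : n.+1%:R * (`|A - P| + `|B - P|) <= 1 ->
  `|D - A - B + P + dot (A - P) (B - P) *: P| <=
    3 * n.+1%:R * `|A - P| * `|B - P| * (`|A - P| + `|B - P|).
Proof.
set a := A - P; set b := B - P; set s := `|a| + `|b|; move=> small.
have s0 : 0 <= s by rewrite addr_ge0.
have n1 : 1 <= n.+1%:R :> R by rewrite ler1n.
have s1 : s <= 1 by nra.
have abE : dot a b = q / 2 - c.
  by rewrite /a /b !dotE PP (dotC P B) /q /c; field.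
have q4 : 4 - q = dot (a - b) (a - b).
  have -> : a - b = A - B by rewrite /a /b opprB addrA subrK.
  by rewrite !dotE AA BB (dotC B A) /q; ring.
have q4s : 0 <= 4 - q <= s.
  rewrite q4 dot_ge0/=; apply: le_trans (ler_norm _) _; apply: le_trans (normr_dot _ _) _.
  have abs : `|a - b| <= s by exact: ler_normB.
  rewrite -[leRHS]mul1r; apply: ler_pM => //.
  by apply: le_trans small; exact: ler_wpM2l.
have q3 : 3 <= q by lra.
have AB0 : A + B != 0.
  apply/eqP => AB0; have : dot (A + B) (A + B) = 0 by rewrite AB0 /dot big1// => i _; rewrite mxE mul0r.
  by rewrite !dotE AA BB (dotC B A); move: q3; rewrite /q; lra.
have [q0 DE'] := DE AB0.
have -> : D - A - B + P + dot a b *: P =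
    dot a b *: ((1 - 4 / q) *: P - (2 / q) *: (a + b)).
  rewrite DE'; apply/rowP => i; rewrite !mxE abE.
  by field.
rewrite normrZ; apply: le_trans (_ : n.+1%:R * `|a| * `|b| * (3 * s) <= _); last first.
  by rewrite le_eqVlt; apply/orP; left; apply/eqP; ring.
apply: ler_pM => //; first exact: normr_dot.
apply: le_trans (ler_normB _ _) _; rewrite (normrZ (1 - 4 / q)) (normrZ (2 / q)).
have Pn : `|P| <= 1 by exact: sphere_normr.
have abn : `|a + b| <= s by exact: ler_normD.
have i1 : `|1 - 4 / q| <= s.
  have -> : 1 - 4 / q = - ((4 - q) / q) by field.
  case/andP: q4s => q4s1 q4s2.
  rewrite normrN ger0_norm; last by rewrite divr_ge0//; lra.
  by rewrite ler_pdivrMr; nra.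
have i2 : `|2 / q| <= 1.
  by rewrite ger0_norm; [rewrite ler_pdivrMr; lra|rewrite divr_ge0//; lra].
have j1 : `|1 - 4 / q| * `|P| <= s * 1 by exact: ler_pM.
have j2 : `|2 / q| * `|a + b| <= 1 * s by exact: ler_pM.
by apply: le_trans (lerD j1 j2) _; move: s0; lra.
Qed.

End Reflection.

Lemma mixed_difference_split (V : zmodType) (a b c d : V) :
  d - c = (b - a) + (d - b - c + a).
Proof. by rewrite [RHS]addrC [d - b - c]addrAC -[RHS]addrA [a + _]addrC subrK subrK. Qed.

(** * A discrete Gronwall inequality in two variables *)

Section DiscreteGronwall.
Context (R : realType) (V : normedZmodType R).
Variables (E : nat -> nat -> V) (al be : nat -> R) (err : nat -> nat -> R) (M : nat).
Hypothesis E0k : forall k, (k <= M)%N -> E 0%N k = 0.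
Hypothesis Em0 : forall m, (m <= M)%N -> E m 0%N = 0.
Hypothesis al0 : forall m, 0 <= al m.
Hypothesis be0 : forall m, 0 <= be m.
Hypothesis err0 : forall m k, 0 <= err m k.

Let box m k : V := E m.+1 k.+1 - E m.+1 k - E m k.+1 + E m k.

Hypothesis boxE : forall m k, (m < M)%N -> (k < M)%N ->
  `|box m k| <= be k * `|E m.+1 k - E m k| + al m * `|E m k.+1 - E m k|
    + al m * be k * `|E m k| + err m k.

(** The total mixed variation over a rectangle. It dominates [E], and its rows and columns dominate
    the increments of [E], since [E] vanishes on both axes. *)
Let X m k : R := \sum_(i < m) \sum_(j < k) `|box i j|.
Let T : R := \sum_(i < M) \sum_(j < M) err i j.
(** A discrete exponential: [al i * W i] is a quarter of the increment of [W], so that such sums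
    telescope. *)
Let W m : R := \prod_(i < m) (1 + 4 * al i).
Let Z k : R := \prod_(i < k) (1 + 4 * be i).

Let incr_u m k : (m < M)%N -> (k <= M)%N -> `|E m.+1 k - E m k| <= \sum_(j < k) `|box m j|.
Proof.
move=> mM; elim: k => [|k IH] kM; first by rewrite !Em0// ?(ltnW mM)// subrr normr0 big_ord0.
rewrite big_ord_recr/= (mixed_difference_split (E m k) (E m.+1 k)).
by apply: le_trans (ler_normD _ _) _; apply: lerD => //; exact: IH (ltnW kM).
Qed.

Let incr_v m k : (m <= M)%N -> (k < M)%N -> `|E m k.+1 - E m k| <= \sum_(i < m) `|box i k|.
Proof.
move=> + kM; elim: m => [|m IH] mM; first by rewrite !E0k// ?(ltnW kM)// subrr normr0 big_ord0.
rewrite big_ord_recr/= (mixed_difference_split (E m k) (E m k.+1)).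
apply: le_trans (ler_normD _ _) _; apply: lerD; first exact: IH (ltnW mM).
by rewrite /box [X in `|X + _| <= _]addrAC.
Qed.

Let norm_le m k : (m <= M)%N -> (k <= M)%N -> `|E m k| <= X m k.
Proof.
move=> + kM; elim: m => [|m IH] mM; first by rewrite E0k// normr0 /X big_ord0.
rewrite /X big_ord_recr/= -(subrK (E m k) (E m.+1 k)) [leRHS]addrC.
by apply: le_trans (ler_normD _ _) _; apply: lerD; [exact: incr_u|exact: IH (ltnW mM)].
Qed.

Let W1 m : 1 <= W m.
Proof.
elim: m => [|m IH]; first by rewrite /W big_ord0.
have -> : W m.+1 = W m * (1 + 4 * al m) by rewrite /W big_ord_recr.
by have := al0 m; nra.
Qed.

Let Z1 k : 1 <= Z k.
Proof.
elim: k => [|k IH]; first by rewrite /Z big_ord0.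
have -> : Z k.+1 = Z k * (1 + 4 * be k) by rewrite /Z big_ord_recr.
by have := be0 k; nra.
Qed.

Let W0 m : 0 <= W m. Proof. exact: le_trans ler01 (W1 m). Qed.

Let Z0 k : 0 <= Z k. Proof. exact: le_trans ler01 (Z1 k). Qed.

Let Wsum m : \sum_(i < m) al i * W i = (W m - 1) / 4.
Proof.
elim: m => [|m IH]; first by rewrite /W !big_ord0; field.
by rewrite big_ord_recr/= IH /W big_ord_recr/=; field.
Qed.

Let Zsum k : \sum_(j < k) be j * Z j = (Z k - 1) / 4.
Proof.
elim: k => [|k IH]; first by rewrite /Z !big_ord0; field.
by rewrite big_ord_recr/= IH /Z big_ord_recr/=; field.
Qed.

Let T0 : 0 <= T.
Proof. by apply: sumr_ge0 => i _; apply: sumr_ge0 => j _. Qed.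

Let partial_err m k : (m <= M)%N -> (k <= M)%N -> \sum_(i < m) \sum_(j < k) err i j <= T.
Proof.
move=> mM kM; apply: (@le_trans _ _ (\sum_(i < m) \sum_(j < M) err i j)).
  apply: ler_sum => i _; rewrite -!(big_mkord xpredT (fun j => err i j)).
  by rewrite [leRHS](big_cat_nat (leq0n k) kM)//= lerDl sumr_ge0.
rewrite /T -!(big_mkord xpredT (fun i => \sum_(j < M) err i j)).
by rewrite [leRHS](big_cat_nat (leq0n m) mM)//= lerDl sumr_ge0// => i _; exact: sumr_ge0.
Qed.

(** Summing the hypothesis over a rectangle bounds [X m k] by weighted sums of [X] over rectangles
    with a smaller [m + k], plus [T]. Under the inductive bound [4 T W Z] the three sums are at most
    [T W Z], [T W Z] and [T W Z / 4]; with [T] itself, the total stays below [4 T W Z]. *)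
Let X_bound s : forall m k, (m + k <= s)%N -> (m <= M)%N -> (k <= M)%N ->
  X m k <= 4 * T * (W m * Z k).
Proof.
elim: s => [|s IH] m k mks mM kM.
  move: mks; rewrite leqn0 addn_eq0 => /andP[/eqP -> _]; rewrite /X big_ord0.
  by rewrite !mulr_ge0.
have IHk (j : 'I_k) : X m j <= 4 * T * (W m * Z j).
  apply: IH => //; last exact: (leq_trans (ltnW (ltn_ord j))).
  by rewrite -ltnS (leq_trans _ mks)// ltn_add2l.
have IHm (i : 'I_m) : X i k <= 4 * T * (W i * Z k).
  apply: IH => //; last exact: (leq_trans (ltnW (ltn_ord i))).
  by rewrite -ltnS (leq_trans _ mks)// ltn_add2r.
have IHmk (i : 'I_m) (j : 'I_k) : X i j <= 4 * T * (W i * Z j).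
  apply: IH.
  - rewrite -ltnS (leq_trans _ mks)// -addSn leq_add//; exact: ltnW.
  - exact: (leq_trans (ltnW (ltn_ord i))).
  - exact: (leq_trans (ltnW (ltn_ord j))).
have step : X m k <= \sum_(j < k) be j * X m j + \sum_(i < m) al i * X i k
    + \sum_(i < m) \sum_(j < k) al i * be j * X i j + T.
  apply: (@le_trans _ _ (\sum_(i < m) \sum_(j < k) (be j * \sum_(j' < j) `|box i j'|
      + al i * \sum_(i' < i) `|box i' j| + al i * be j * X i j + err i j))).
    apply: ler_sum => i _; apply: ler_sum => j _.
    have iM : (i < M)%N by exact: leq_trans mM.
    have jM : (j < M)%N by exact: leq_trans kM.
    apply: le_trans (boxE iM jM) _; rewrite lerD2r; apply: lerD; last first.
      by apply: ler_wpM2l; [exact: mulr_ge0|apply: norm_le; exact: ltnW].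
    by apply: lerD; apply: ler_wpM2l => //; [apply: incr_u|apply: incr_v] => //; exact: ltnW.
  under eq_bigr do rewrite !big_split/=.
  rewrite !big_split/= -!addrA; apply: lerD.
    (* Summed over [i], the partial row sums up to [j] form [X m j]; the columns similarly form
       [X i k]. *)
    rewrite exchange_big/= le_eqVlt; apply/orP; left; apply/eqP.
    by apply: eq_bigr => j _; rewrite /X -mulr_sumr.
  apply: lerD; last by apply: lerD => //; exact: partial_err.
  rewrite le_eqVlt; apply/orP; left; apply/eqP; apply: eq_bigr => i _.
  by rewrite -mulr_sumr; congr (_ * _); rewrite /X exchange_big.
apply: le_trans step _.
have s1 : \sum_(j < k) be j * X m j <= T * W m * (Z k - 1).
  apply: (@le_trans _ _ (\sum_(j < k) be j * (4 * T * (W m * Z j)))).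
    by apply: ler_sum => j _; exact: ler_wpM2l.
  rewrite (eq_bigr (fun j : 'I_k => 4 * T * W m * (be j * Z j))); last by move=> j _; ring.
  by rewrite -mulr_sumr Zsum le_eqVlt; apply/orP; left; apply/eqP; field.
have s2 : \sum_(i < m) al i * X i k <= T * (W m - 1) * Z k.
  apply: (@le_trans _ _ (\sum_(i < m) al i * (4 * T * (W i * Z k)))).
    by apply: ler_sum => i _; exact: ler_wpM2l.
  rewrite (eq_bigr (fun i : 'I_m => 4 * T * Z k * (al i * W i))); last by move=> i _; ring.
  by rewrite -mulr_sumr Wsum le_eqVlt; apply/orP; left; apply/eqP; field.
have s3 : \sum_(i < m) \sum_(j < k) al i * be j * X i j <= T / 4 * (W m - 1) * (Z k - 1).
  apply: (@le_trans _ _ (\sum_(i < m) \sum_(j < k) al i * be j * (4 * T * (W i * Z j)))).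
    by apply: ler_sum => i _; apply: ler_sum => j _; apply: ler_wpM2l => //; exact: mulr_ge0.
  rewrite (eq_bigr (fun i : 'I_m => T * (Z k - 1) * (al i * W i))); last first.
    move=> i _; rewrite (eq_bigr (fun j : 'I_k => 4 * T * (al i * W i) * (be j * Z j))).
      by rewrite -mulr_sumr Zsum; field.
    by move=> j _; ring.
  by rewrite -mulr_sumr Wsum le_eqVlt; apply/orP; left; apply/eqP; field.
apply: le_trans (lerD (lerD (lerD s1 s2) s3) (lexx T)) _.
rewrite -subr_ge0; have -> : 4 * T * (W m * Z k)
    - (T * W m * (Z k - 1) + T * (W m - 1) * Z k + T / 4 * (W m - 1) * (Z k - 1) + T) =
  T * (7 / 4 * (W m * Z k) + 5 / 4 * (W m + Z k) - 5 / 4) by field.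
rewrite mulr_ge0//; have w := W1 m; have z := Z1 k.
have : 0 <= W m * Z k by rewrite mulr_ge0.
lra.
Qed.

Lemma discrete_gronwall m k : (m <= M)%N -> (k <= M)%N ->
  `|E m k| <= 4 * (\sum_(i < M) \sum_(j < M) err i j) *
    (expR (4 * \sum_(i < M) al i) * expR (4 * \sum_(j < M) be j)).
Proof.
move=> mM kM; apply: le_trans (norm_le mM kM) _.
apply: le_trans (X_bound (leqnn (m + k)) mM kM) _.
have prod_exp (a : nat -> R) l : (forall i, 0 <= a i) -> (l <= M)%N ->
    \prod_(i < l) (1 + 4 * a i) <= expR (4 * \sum_(i < M) a i).
  move=> a0 lM; apply: (@le_trans _ _ (expR (4 * \sum_(i < l) a i))).
    rewrite mulr_sumr expR_sum; apply: ler_prod => i _.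
    by rewrite expR_ge1Dx// andbT; have := a0 i; lra.
  rewrite ler_expR ler_wpM2l// -!(big_mkord xpredT a).
  by rewrite [leRHS](big_cat_nat (leq0n l) lM)//= lerDl sumr_ge0.
rewrite ler_wpM2l ?mulr_ge0//; apply: ler_pM => //; exact: prod_exp.
Qed.

End DiscreteGronwall.

(** At each point at most one of the restricted functions is nonzero. This bounds sums over grid
    cells by quantities independent of the mesh. *)
Lemma sum_Rintegral_disjoint (d : measure_display) (T : measurableType d) (R : realType)
    (m : {measure set T -> \bar R}) (M : nat) (D : nat -> set T) (D0 : set T) (h : T -> R) :
  (forall i, measurable (D i)) -> measurable D0 -> (forall i, D i `<=` D0) ->
  trivIset setT D -> m.-integrable setT (EFin \o h) -> (forall x, 0 <= h x) ->
  \sum_(i < M) \int[m]_(x in D i) h x <= \int[m]_(x in D0) h x.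
Proof.
move=> mD mD0 DD0 trD ih h0.
rewrite (eq_bigr (fun i : 'I_M => \int[m]_x (h \_ (D i)) x)); last first.
  by move=> i _; rewrite Rintegral_mkcond.
have ihD (i : 'I_M) : m.-integrable setT (EFin \o (h \_ (D i))) by exact: integrable_patch.
rewrite -(@Rintegral_sum _ _ R _ m (fun (i : 'I_M) x => (h \_ (D i)) x) ihD _ measurableT).
rewrite [leRHS]Rintegral_mkcond; apply: le_Rintegral => //.
- exact: (@integrable_sumR _ _ R _ m (fun (i : 'I_M) x => (h \_ (D i)) x)).
- exact: integrable_patch.
- move=> x _; have rhs0 : 0 <= (h \_ D0) x by rewrite patchE; case: ifP.
  have [[i Di]|nD] := pselect (exists i : 'I_M, D i x); last first.
    rewrite big1// => i _; rewrite patchE memNset// => Di; apply: nD; by exists i.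
  rewrite (bigD1 i)//= big1 ?addr0.
    by rewrite !patchE !mem_set//; exact: DD0 Di.
  move=> j ji; rewrite patchE memNset// => Dj.
  move/negP: ji; apply; apply/eqP/val_inj.
  by apply: (trD _ _ I I); exists x.
Qed.

Lemma global_wave_map_axes (R : realType) (n : nat) (S : R) (phip phim : R -> 'rV[R]_n.+1)
    (phi : R * R -> 'rV[R]_n.+1) : 0 < S -> phip 0 = phim 0 -> is_wave_map S S phip phim phi ->
  (forall u, 0 <= u <= S -> phi (u, 0) = phip u) /\
  (forall v, 0 <= v <= S -> phi (0, v) = phim v).
Proof.
move=> S0 corner [_ _ _ phiE]; have S00 : 0 <= (0 : R) <= S by rewrite lexx ltW.
split=> [u uS|v vS]; rewrite phiE//.
  rewrite -corner; have -> : \row_(i < n.+1) \int[lebesgue_measure]_(w in `[0, u])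
      \int[lebesgue_measure]_(z in `[0, 0])
        (dot (du phi (w, z)) (dv phi (w, z)) * phi (w, z) 0 i) = 0.
    apply/rowP => i; rewrite !mxE /Rintegral integral0_eq// => w _.
    by rewrite set_itv1 integral_set1.
  by rewrite subr0 addrK.
have -> : \row_(i < n.+1) \int[lebesgue_measure]_(w in `[0, 0])
    \int[lebesgue_measure]_(z in `[0, v])
      (dot (du phi (w, z)) (dv phi (w, z)) * phi (w, z) 0 i) = 0.
  by apply/rowP => i; rewrite !mxE set_itv1 Rintegral_set1.
by rewrite subr0 addrAC subrr add0r.
Qed.

(** * Conserved increments of the discrete wave map *)

Section DiscreteWaveMapEnergy.
Context (R : realType) (n : nat).
Variables (Yp Ym : nat -> 'rV[R]_n.+1) (Y : nat -> nat -> 'rV[R]_n.+1).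
Hypothesis dY : is_discrete_wave_map Yp Ym Y.
Hypothesis Yp1 : forall m, unit_sphere n.+1 (Yp m).
Hypothesis Ym1 : forall k, unit_sphere n.+1 (Ym k).

Lemma discrete_wave_map_sphere m k : unit_sphere n.+1 (Y m k).
Proof.
have [Yl Yr Yrec] := dY; elim: m k => [|m IHm] k; first by rewrite Yr.
elim: k => [|k IHk]; first by rewrite Yl.
by rewrite Yrec; exact: reflection_sphere.
Qed.

(** By the isometry property of the reflection, opposite edges of a grid cell have equal Euclidean
    length. So every increment of the discrete map is as long as the corresponding increment of the
    boundary datum. *)
Lemma discrete_wave_map_energy_u m k :
  enorm (Y m.+1 k - Y m k) = enorm (Yp m.+1 - Yp m).
Proof.
have [Yl Yr Yrec] := dY; elim: k => [|k IHk]; first by rewrite !Yl.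
rewrite -IHk Yrec.
by have [] := reflection_enorm (discrete_wave_map_sphere m.+1 k)
  (discrete_wave_map_sphere m k.+1) (discrete_wave_map_sphere m k).
Qed.

Lemma discrete_wave_map_energy_v m k :
  enorm (Y m k.+1 - Y m k) = enorm (Ym k.+1 - Ym k).
Proof.
have [Yl Yr Yrec] := dY; elim: m => [|m IHm]; first by rewrite !Yr.
rewrite -IHm Yrec.
by have [] := reflection_enorm (discrete_wave_map_sphere m.+1 k)
  (discrete_wave_map_sphere m k.+1) (discrete_wave_map_sphere m k).
Qed.

End DiscreteWaveMapEnergy.

(** * Difference of the two maps on a grid cell *)

Section ErrorRecursion.
Context (R : realType) (n : nat).
Local Notation c := (n.+1%:R : R).
Implicit Types P A B D : 'rV[R]_n.+1.

(** Unprimed points are the corners of a cell under the wave map, primed ones under the discrete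
    map. Both obey the same recursion up to small terms; subtracting leaves a bilinear expression in
    the differences. The factors [c] in the primed bounds arise because conservation holds for the
    Euclidean norm, while errors are measured in the maximum norm. *)
Lemma box_error P A B D P' A' B' D' (al be C nu w : R) :
  unit_sphere n.+1 A' -> unit_sphere n.+1 B' -> unit_sphere n.+1 P' ->
  D' = reflection (A' + B') P' ->
  `|A - P| <= al -> `|B - P| <= be -> `|A' - P'| <= c * al -> `|B' - P'| <= c * be ->
  al <= w -> be <= w -> 2 * c * c * w <= 1 -> 0 <= C -> 0 <= nu ->
  `|D - A - B + P + dot (A - P) (B - P) *: P| <= C * nu * (al + be) ->
  `|(D' - D) - (A' - A) - (B' - B) + (P' - P)| <=
    c ^+ 2 * be * `|(A' - A) - (P' - P)| + c ^+ 2 * al * `|(B' - B) - (P' - P)|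
    + (c ^+ 2 * al) * (c ^+ 2 * be) * `|P' - P|
    + 2 * c * w * (3 * c ^+ 3 * (al * be) + C * nu).
Proof.
move=> A1 B1 P1 D'E aA bB a'A b'B alw bew small C0 nu0 rX.
have c1 : 1 <= c by rewrite ler1n.
have al0 : 0 <= al by exact: le_trans aA.
have be0 : 0 <= be by exact: le_trans bB.
have w0 : 0 <= w by exact: le_trans alw.
have a'b' : c * (`|A' - P'| + `|B' - P'|) <= 1.
  apply: le_trans small; have -> : 2 * c * c * w = c * (c * w + c * w) by ring.
  apply: ler_wpM2l => //; apply: lerD; [apply: le_trans a'A _|apply: le_trans b'B _];
  exact: ler_wpM2l.
have rY := reflection_mixed_difference A1 B1 P1 a'b'; rewrite -D'E in rY.
set a := A - P in aA rX *; set b := B - P in bB rX *.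
set a' := A' - P' in a'A a'b' rY *; set b' := B' - P' in b'B a'b' rY *.
(* The two recursion errors, minus the difference of the products [dot a b] times the corner, in
   which one factor is exchanged at a time. *)
have -> : (D' - D) - (A' - A) - (B' - B) + (P' - P) =
   (D' - A' - B' + P' + dot a' b' *: P') - (D - A - B + P + dot a b *: P)
   - (dot (a' - a) b' *: P' + dot a (b' - b) *: P' + dot a b *: (P' - P)).
  by apply/rowP => i; rewrite !dotE !mxE; ring.
have -> : (A' - A) - (P' - P) = a' - a.
  by apply/rowP => i; rewrite !mxE; ring.
have -> : (B' - B) - (P' - P) = b' - b.
  by apply/rowP => i; rewrite !mxE; ring.
have P'1 : `|P'| <= 1 by exact: sphere_normr.
have t1 : `|dot (a' - a) b' *: P'| <= c ^+ 2 * be * `|a' - a|.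
  rewrite normrZ -[leRHS]mulr1; apply: ler_pM => //; apply: le_trans (normr_dot _ _) _.
  have -> : c ^+ 2 * be * `|a' - a| = c * `|a' - a| * (c * be) by ring.
  by apply: ler_wpM2l => //; exact: mulr_ge0.
have t2 : `|dot a (b' - b) *: P'| <= c ^+ 2 * al * `|b' - b|.
  rewrite normrZ -[leRHS]mulr1; apply: ler_pM => //; apply: le_trans (normr_dot _ _) _.
  apply: ler_wpM2r => //; rewrite expr2 -mulrA; apply: ler_wpM2l => //.
  by apply: le_trans aA _; rewrite ler_peMl.
have t3 : `|dot a b *: (P' - P)| <= (c ^+ 2 * al) * (c ^+ 2 * be) * `|P' - P|.
  rewrite normrZ; apply: ler_wpM2r => //; apply: le_trans (normr_dot _ _) _.
  apply: (@le_trans _ _ (c * al * be)).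
    by apply: ler_pM => //; exact: ler_wpM2l.
  (* The surplus [c ^+ 3 >= 1] makes this coefficient the product of the two preceding ones, as the
     Gronwall inequality requires. *)
  have -> : (c ^+ 2 * al) * (c ^+ 2 * be) = c * al * be * (c ^+ 3) by ring.
  by rewrite ler_peMr ?mulr_ge0// exprn_ege1.
have r1 : 3 * c * `|a'| * `|b'| * (`|a'| + `|b'|) <= 2 * c * w * (3 * c ^+ 3 * (al * be)).
  have -> : 2 * c * w * (3 * c ^+ 3 * (al * be)) =
    3 * c * (c * al) * (c * be) * (c * w + c * w) by ring.
  have cal : `|a'| <= c * w by apply: le_trans a'A _; exact: ler_wpM2l.
  have cbe : `|b'| <= c * w by apply: le_trans b'B _; exact: ler_wpM2l.
  apply: ler_pM; rewrite ?mulr_ge0 ?addr_ge0//; last exact: lerD.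
  by apply: ler_pM => //; apply: ler_wpM2l => //; exact: mulr_ge0.
have r2 : C * nu * (al + be) <= 2 * c * w * (C * nu).
  rewrite [leRHS]mulrC; apply: ler_wpM2l; first exact: mulr_ge0.
  have -> : 2 * c * w = c * (w + w) by ring.
  apply: (@le_trans _ _ (w + w)); first exact: lerD.
  by rewrite ler_peMl// addr_ge0.
apply: le_trans (ler_normB _ _) _.
have n1 := le_trans (ler_normB _ _) (lerD rY rX).
have n2 := le_trans (ler_normD (dot (a' - a) b' *: P' + dot a (b' - b) *: P')
  (dot a b *: (P' - P))) (lerD (le_trans (ler_normD _ _) (lerD t1 t2)) t3).
apply: le_trans (lerD n1 n2) _.
rewrite addrC lerD2l [leRHS]mulrDr; exact: lerD.
Qed.

End ErrorRecursion.

(** * Convergence *)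

Section Convergence.
Context (R : realType) (n : nat).
Local Notation mu := (@lebesgue_measure R).
Local Notation mu2 := (mu \x mu)%E.
Local Notation c := (n.+1%:R : R).
Variables (phip phim : R -> 'rV[R]_n.+1) (phi : R * R -> 'rV[R]_n.+1).
Hypothesis phip_sphere : forall u : R, 0 <= u -> unit_sphere n.+1 (phip u).
Hypothesis phim_sphere : forall v : R, 0 <= v -> unit_sphere n.+1 (phim v).
Hypothesis phip_ac : loc_abs_continuous phip.
Hypothesis phim_ac : loc_abs_continuous phim.
Hypothesis phi_corner : phip 0 = phim 0.
Hypothesis phi_wave : is_global_wave_map phip phim phi.

Lemma grid_cells_disjoint (h : R) : 0 < h ->
  trivIset setT (fun k : nat => `]h * k%:R, h * k.+1%:R]%classic).
Proof.
move=> h0; have lt_disj (i j : nat) y : (i < j)%N -> `]h * i%:R, h * i.+1%:R]%classic y ->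
    `]h * j%:R, h * j.+1%:R]%classic y -> False.
  move=> ij; rewrite /= !in_itv/= => /andP[_ y1] /andP[y2 _].
  have : h * i.+1%:R <= h * j%:R by rewrite ler_wpM2l ?(ltW h0)// ler_nat.
  lra.
move=> i j _ _ [y [yi yj]]; case: (ltngtP i j) => // ij; exfalso.
  exact: lt_disj ij yi yj.
exact: lt_disj ij yj yi.
Qed.

(** Here [w'] bounds the integrals of [A] and [B] over every interval of length at most the mesh,
    and [Kc] does not depend on it. The square has side [S.+1], one unit more than will be needed,
    so that it contains the right and upper neighbours used by the interpolation. *)
Lemma grid_error (S : nat) (w : R) : 0 < w -> 2 * c * c * w <= 1 -> exists Kc : R, 0 <= Kc /\
  forall w', 0 < w' -> w' <= w -> exists N0 : nat, forall N, (N0 <= N)%N ->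
  let x (k : nat) : R := 2 ^- N * k%:R in
  let Y := discrete_wave_map (fun k => phip (x k)) (fun k => phim (x k)) in
  (forall m k, (m <= S.+1 * 2 ^ N)%N -> (k <= S.+1 * 2 ^ N)%N ->
    `|Y m k - phi (x m, x k)| <= w' * Kc) /\
  (forall u u' v v', 0 <= u <= S.+1%:R -> 0 <= u' <= S.+1%:R -> 0 <= v <= S.+1%:R ->
    0 <= v' <= S.+1%:R -> `|u - u'| <= 2 ^- N -> `|v - v'| <= 2 ^- N ->
    `|phi (u, v) - phi (u', v')| <= 2 * w').
Proof.
move=> w0 small; set S1 : R := S.+1%:R.
have S10 : 0 < S1 by rewrite ltr0n.
have wm := phi_wave S10 S10.
have [ax_p ax_m] := global_wave_map_axes S10 phi_corner wm.
have [A [B [F0 [intA intB [A0 B0] intF0 [incU incV cell]]]]] :=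
  wave_cells S10 (phip_ac S10) (phim_ac S10) phi_corner wm.
have absF0 : mu2.-integrable setT (EFin \o (fun x => `|F0 x|)) by exact: integrable_norm.
set C := (2 * n.+1 + 1)%:R in cell.
have C0 : 0 <= C by rewrite ler0n.
pose IA := \int[mu]_x A x; pose IB := \int[mu]_x B x; pose IF := \int[mu2]_x `|F0 x|.
have IA0 : 0 <= IA by exact: Rintegral_ge0.
have IB0 : 0 <= IB by exact: Rintegral_ge0.
have IF0 : 0 <= IF by exact: Rintegral_ge0.
(* The Gronwall bound with every sum over cells replaced by the corresponding integral over the
   whole line or plane, and with the factor [w'] taken out of the cell errors. *)
pose Kc := 4 * (2 * c * (3 * c ^+ 3 * (IA * IB) + C * IF)) *
  (expR (4 * (c ^+ 2 * IA)) * expR (4 * (c ^+ 2 * IB))).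
have Kc0 : 0 <= Kc by rewrite !(mulr_ge0, addr_ge0, expR_ge0, exprn_ge0).
exists Kc; split => // w' w'0 w'w.
have [dA dA0 mA] := integral_itv_modulus intA w'0.
have [dB dB0 mB] := integral_itv_modulus intB w'0.
have [N0 _ HN0] : \forall N \near \oo, (2 ^- N : R) < Num.min dA dB.
  have d0 : 0 < Num.min dA dB by rewrite lt_min dA0.
  have := @cvg_expr R (2^-1) _; rewrite ger0_norm ?invr_ge0//.
  have half : (2^-1 : R) < 1 by rewrite invf_lt1// ltr1n.
  move=> /(_ half)/cvgrPdist_lt/(_ _ d0); apply: filterS => N.
  by rewrite sub0r normrN ger0_norm ?exprn_ge0 ?invr_ge0// exprVn.
exists N0 => N N0N x Y; have := HN0 N N0N; rewrite /= lt_min => /andP[hA hB].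
set h : R := 2 ^- N in x hA hB Y *.
have h0 : 0 < h by rewrite invr_gt0 exprn_gt0.
set M := (S.+1 * 2 ^ N)%N.
have hM : h * M%:R = S1.
  by rewrite /M natrM natrX mulrC mulfK// expf_neq0// pnatr_eq0.
have absE (Z : R -> R) D : (forall y, 0 <= Z y) ->
    \int[mu]_(y in D) `|Z y| = \int[mu]_(y in D) Z y.
  by move=> Z0; apply: eq_Rintegral => y _; rewrite ger0_norm.
have mA' a b : a <= b -> b - a <= h -> \int[mu]_(y in `]a, b]) A y <= w'.
  by move=> ab abh; rewrite -absE// ltW// mA// (le_lt_trans abh).
have mB' a b : a <= b -> b - a <= h -> \int[mu]_(y in `]a, b]) B y <= w'.
  by move=> ab abh; rewrite -absE// ltW// mB// (le_lt_trans abh).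
have x0 m : 0 <= x m by rewrite mulr_ge0// ltW.
have xM m : (m <= M)%N -> x m <= S1 by move=> mM; rewrite -hM ler_wpM2l ?(ltW h0)// ler_nat.
have xin m : (m <= M)%N -> 0 <= x m <= S1 by move=> mM; rewrite x0 xM.
have xS m : x m.+1 = x m + h by rewrite /x -natr1 mulrDr mulr1.
have xle m : x m <= x m.+1 by rewrite xS lerDl ltW.
have nearU u u' v : 0 <= u <= S1 -> 0 <= u' <= S1 -> 0 <= v <= S1 -> `|u - u'| <= h ->
    `|phi (u, v) - phi (u', v)| <= w'.
  move=> /andP[u1 u2] /andP[u3 u4] vS uu'; apply: normr_row_le => [|i]; first exact: ltW.
  rewrite !mxE; have [le_uu|/ltW le_uu] := leP u u'.
    rewrite distrC; apply: le_trans (incU i _ _ _ _ le_uu u4 vS) _ => //.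
    by apply: mA' => //; move: uu'; rewrite distrC ger0_norm ?subr_ge0.
  apply: le_trans (incU i _ _ _ _ le_uu u2 vS) _ => //.
  by apply: mA' => //; move: uu'; rewrite ger0_norm ?subr_ge0.
have nearV u v v' : 0 <= u <= S1 -> 0 <= v <= S1 -> 0 <= v' <= S1 -> `|v - v'| <= h ->
    `|phi (u, v) - phi (u, v')| <= w'.
  move=> uS /andP[v1 v2] /andP[v3 v4] vv'; apply: normr_row_le => [|i]; first exact: ltW.
  rewrite !mxE; have [le_vv|/ltW le_vv] := leP v v'.
    rewrite distrC; apply: le_trans (incV i _ _ _ uS _ le_vv v4) _ => //.
    by apply: mB' => //; move: vv'; rewrite distrC ger0_norm ?subr_ge0.
  apply: le_trans (incV i _ _ _ uS _ le_vv v2) _ => //.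
  by apply: mB' => //; move: vv'; rewrite ger0_norm ?subr_ge0.
split; last first.
  move=> u u' v v' uS u'S vS v'S uu' vv'.
  rewrite -(subrK (phi (u', v)) (phi (u, v))) -addrA mulr_natl mulr2n.
  by apply: le_trans (ler_normD _ _) _; apply: lerD; [exact: nearU|exact: nearV].
have Y00 : phip (x 0%N) = phim (x 0%N) by rewrite /x mulr0.
have dY := discrete_wave_mapP (Yp := fun k => phip (x k)) (Ym := fun k => phim (x k)) Y00.
rewrite -/Y in dY; have [Yl Yr Yrec] := dY.
have sphY := discrete_wave_map_sphere dY (fun m => phip_sphere (x0 m)) (fun k => phim_sphere (x0 k)).
have enU := discrete_wave_map_energy_u dY (fun m => phip_sphere (x0 m)) (fun k => phim_sphere (x0 k)).
have enV := discrete_wave_map_energy_v dY (fun m => phip_sphere (x0 m)) (fun k => phim_sphere (x0 k)).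
pose DA m := \int[mu]_(y in `]x m, x m.+1]) A y.
pose DB k := \int[mu]_(y in `]x k, x k.+1]) B y.
pose nu m k := \int[mu2]_(p in `]x m, x m.+1] `*` `]x k, x k.+1]) `|F0 p|.
have DA0 m : 0 <= DA m by exact: Rintegral_ge0.
have DB0 m : 0 <= DB m by exact: Rintegral_ge0.
have nu0 m k : 0 <= nu m k by exact: Rintegral_ge0.
have stepU m k : (m < M)%N -> (k <= M)%N -> `|phi (x m.+1, x k) - phi (x m, x k)| <= DA m.
  move=> mM kM; apply: normr_row_le => // i; rewrite !mxE.
  by apply: incU => //; [exact: xM|exact: xin].
have stepV m k : (m <= M)%N -> (k < M)%N -> `|phi (x m, x k.+1) - phi (x m, x k)| <= DB k.
  move=> mM kM; apply: normr_row_le => // i; rewrite !mxE.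
  by apply: incV => //; [exact: xin|exact: xM].
have x00 : x 0%N = 0 by rewrite /x mulr0.
(* Conservation moves the increment to the axis, where the datum agrees with [phi]; the comparison
   of the Euclidean with the maximum norm costs [c]. *)
have YstepU m k : (m < M)%N -> `|Y m.+1 k - Y m k| <= c * DA m.
  move=> mM; apply: le_trans (normr_le_enorm _) _; rewrite enU.
  apply: le_trans (enorm_le_normr _) _; apply: ler_wpM2l => //.
  by rewrite -!ax_p ?xin ?(ltnW mM)// -x00; exact: stepU.
have YstepV m k : (k < M)%N -> `|Y m k.+1 - Y m k| <= c * DB k.
  move=> kM; apply: le_trans (normr_le_enorm _) _; rewrite enV.
  apply: le_trans (enorm_le_normr _) _; apply: ler_wpM2l => //.
  by rewrite -!ax_m ?xin ?(ltnW kM)// -x00; exact: stepV.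
have DAw m : DA m <= w' by apply: mA' => //; rewrite xS addrAC subrr add0r.
have DBw m : DB m <= w' by apply: mB' => //; rewrite xS addrAC subrr add0r.
pose E m k := Y m k - phi (x m, x k).
pose err m k := 2 * c * w' * (3 * c ^+ 3 * (DA m * DB k) + C * nu m k).
have E0k k : (k <= M)%N -> E 0%N k = 0.
  by move=> kM; rewrite /E Yr x00 ax_m ?subrr// xin.
have Em0 m : (m <= M)%N -> E m 0%N = 0.
  by move=> mM; rewrite /E Yl x00 ax_p ?subrr// xin.
have err0 m k : 0 <= err m k by rewrite !(mulr_ge0, addr_ge0, exprn_ge0)// ltW.
have small' : 2 * c * c * w' <= 1.
  by apply: le_trans small; rewrite ler_wpM2l// !mulr_ge0.
have al0 m : 0 <= c ^+ 2 * DA m by rewrite mulr_ge0// exprn_ge0.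
have be0 m : 0 <= c ^+ 2 * DB m by rewrite mulr_ge0// exprn_ge0.
have boxE m k : (m < M)%N -> (k < M)%N ->
    `|E m.+1 k.+1 - E m.+1 k - E m k.+1 + E m k| <=
    c ^+ 2 * DB k * `|E m.+1 k - E m k| + c ^+ 2 * DA m * `|E m k.+1 - E m k|
    + c ^+ 2 * DA m * (c ^+ 2 * DB k) * `|E m k| + err m k.
  move=> mM kM; apply: (@box_error R n (phi (x m, x k)) (phi (x m.+1, x k))
    (phi (x m, x k.+1)) (phi (x m.+1, x k.+1)) (Y m k) (Y m.+1 k) (Y m k.+1) (Y m.+1 k.+1)) => //.
  - exact: stepU (ltnW kM).
  - exact: stepV (ltnW mM) _.
  - exact: YstepU.
  - exact: YstepV.
  - apply: normr_row_le => [|i]; first by rewrite !(mulr_ge0, addr_ge0).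
    rewrite [X in `|X|](_ : _ = phi (x m.+1, x k.+1) 0 i - phi (x m.+1, x k) 0 i
      - phi (x m, x k.+1) 0 i + phi (x m, x k) 0 i +
      dot (phi (x m.+1, x k) - phi (x m, x k)) (phi (x m, x k.+1) - phi (x m, x k))
        * phi (x m, x k) 0 i); last by rewrite !mxE.
    by apply: cell => //; exact: xM.
move=> m k mM kM.
apply: le_trans (discrete_gronwall E0k Em0 al0 be0 err0 boxE mM kM) _.
have sumA : \sum_(i < M) DA i <= IA.
  apply: (@sum_Rintegral_disjoint _ _ R mu M (fun i => `]x i, x i.+1]%classic) setT A) => //.
  exact: grid_cells_disjoint.
have sumB : \sum_(i < M) DB i <= IB.
  apply: (@sum_Rintegral_disjoint _ _ R mu M (fun i => `]x i, x i.+1]%classic) setT B) => //.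
  exact: grid_cells_disjoint.
have sumnu : \sum_(i < M) \sum_(j < M) nu i j <= IF.
  apply: (@le_trans _ _ (\sum_(i < M) \int[mu2]_(p in `]x i, x i.+1] `*` setT) `|F0 p|)).
    apply: ler_sum => i _.
    apply: (@sum_Rintegral_disjoint _ _ R mu2 M
      (fun j => `]x i, x i.+1]%classic `*` `]x j, x j.+1]%classic)
      (`]x i, x i.+1]%classic `*` setT) (fun p => `|F0 p|)) => //.
    - by move=> j; exact: measurableX.
    - exact: measurableX.
    - by move=> j p [].
    - move=> j1 j2 _ _ [p [[_ p1] [_ p2]]]; apply: (grid_cells_disjoint h0) => //.
      by exists p.2.
  apply: (@sum_Rintegral_disjoint _ _ R mu2 M (fun i => `]x i, x i.+1]%classic `*` setT)
    setT (fun p => `|F0 p|)) => //.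
  - by move=> j; exact: measurableX.
  - move=> j1 j2 _ _ [p [[p1 _] [p2 _]]]; apply: (grid_cells_disjoint h0) => //.
    by exists p.1.
have sumAB0 : 0 <= \sum_(i < M) DA i by apply: sumr_ge0 => i _; exact: DA0.
have sumBB0 : 0 <= \sum_(i < M) DB i by apply: sumr_ge0 => i _; exact: DB0.
have sumerr : \sum_(i < M) \sum_(j < M) err i j <= w' * (2 * c * (3 * c ^+ 3 * (IA * IB) + C * IF)).
  have -> : \sum_(i < M) \sum_(j < M) err i j = 2 * c * w' *
      (3 * c ^+ 3 * ((\sum_(i < M) DA i) * (\sum_(j < M) DB j)) +
       C * (\sum_(i < M) \sum_(j < M) nu i j)).
    rewrite big_distrlr/= !mulr_sumr -big_split/= mulr_sumr; apply: eq_bigr => i _.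
    by rewrite !mulr_sumr -big_split/= mulr_sumr.
  have -> : w' * (2 * c * (3 * c ^+ 3 * (IA * IB) + C * IF)) =
    2 * c * w' * (3 * c ^+ 3 * (IA * IB) + C * IF) by ring.
  apply: ler_wpM2l; first by rewrite !mulr_ge0// ltW.
  by apply: lerD; apply: ler_wpM2l; rewrite ?mulr_ge0 ?exprn_ge0//; exact: ler_pM.
have -> : w' * Kc = 4 * (w' * (2 * c * (3 * c ^+ 3 * (IA * IB) + C * IF))) *
    (expR (4 * (c ^+ 2 * IA)) * expR (4 * (c ^+ 2 * IB))) by rewrite /Kc; ring.
apply: ler_pM.
- by rewrite mulr_ge0//; apply: sumr_ge0 => i _; apply: sumr_ge0 => j _; exact: err0.
- by rewrite mulr_ge0// expR_ge0.
- exact: ler_wpM2l.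
- apply: ler_pM; rewrite ?expR_ge0// ler_expR; apply: ler_wpM2l => //;
    by rewrite -mulr_sumr; apply: ler_wpM2l; rewrite ?exprn_ge0.
Qed.

(** The interpolated value is a convex combination of four grid values, each close to [phi] at its
    grid point, and [phi] varies little over one cell. *)
Lemma numerical_approx_close (S : nat) (e : R) : 0 < e -> exists N0 : nat, forall N, (N0 <= N)%N ->
  forall p : R * R, 0 <= p.1 <= S%:R -> 0 <= p.2 <= S%:R ->
    `|numerical_approx N phip phim p - phi p| < e.
Proof.
move=> e0; pose w : R := (2 * c * c)^-1.
have cc0 : 0 < 2 * c * c by rewrite !mulr_gt0// ltr0n.
have w0 : 0 < w by rewrite invr_gt0.
have small : 2 * c * c * w <= 1 by rewrite mulfV// gt_eqF.
have [Kc [Kc0 HK]] := grid_error S w0 small.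
(* The total error is [w' * (Kc + 2)]: [w' * Kc] at the grid points and [2 * w'] for moving from a
   grid point to [p]. *)
pose w' := Num.min w (e / (2 * (Kc + 3))).
have Kc3 : 0 < 2 * (Kc + 3) by lra.
have w'0 : 0 < w' by rewrite lt_min w0 divr_gt0.
have w'w : w' <= w by rewrite ge_min lexx.
have w'e : w' * (Kc + 2) < e.
  apply: (@le_lt_trans _ _ (e / (2 * (Kc + 3)) * (Kc + 2))).
    by apply: ler_wpM2r; [lra|rewrite ge_min lexx orbT].
  by rewrite mulrAC ltr_pdivrMr//; nra.
have [N0 HN] := HK w' w'0 w'w.
exists N0 => N N0N [u v] /= uS vS; have [grid near_] := HN N N0N.
set h : R := 2 ^- N in grid near_.
set Y := discrete_wave_map _ _ in grid.
have N2 : 0 < (2 : R) ^+ N by rewrite exprn_gt0.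
have cellP (z : R) : 0 <= z <= S%:R -> let i := Num.truncn (2 ^+ N * z) in let s := Defs.frac (2 ^+ N * z) in
    [/\ 0 <= s, 0 <= 1 - s, (i.+1 <= S.+1 * 2 ^ N)%N, `|h * i%:R - z| <= h & `|h * i.+1%:R - z| <= h].
  move=> /andP[z0 zS] i s; have y0 : 0 <= 2 ^+ N * z by rewrite mulr_ge0// ltW.
  have /andP[i1 i2] := truncn_itv y0; rewrite -/i in i1 i2.
  have sE : s = 2 ^+ N * z - i%:R.
    rewrite /s /Defs.frac; congr (_ - _); rewrite (@floor_def _ _ i%:Z)//.
    by rewrite rmorphD/= -pmulrn i1 natr1.
  have zE : z = h * (2 ^+ N * z) by rewrite mulKf// gt_eqF.
  have h0 : 0 < h by rewrite invr_gt0.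
  rewrite -natr1 in i2; split.
  - by rewrite sE; lra.
  - by rewrite sE; lra.
  (* The index is at most [S * 2 ^ N]; its successor fits because the extra unit contains at least
     one cell. *)
  - rewrite mulSn addnC -addn1; apply: leq_add; last by rewrite expn_gt0.
    rewrite -(ler_nat R) natrM natrX mulrC; apply: le_trans i1 _.
    by apply: ler_wpM2l => //; exact: ltW.
  - rewrite [in leLHS]zE -mulrBr normrM gtr0_norm//.
    by apply: ler_piMr; [exact: ltW|rewrite ler_norml; apply/andP; split; lra].
  - rewrite [in leLHS]zE -natr1 -mulrBr normrM gtr0_norm//.
    by apply: ler_piMr; [exact: ltW|rewrite ler_norml; apply/andP; split; lra].
have inS (z : R) : 0 <= z <= S%:R -> 0 <= z <= S.+1%:R.
  by move=> /andP[-> zS]; apply: le_trans zS _; rewrite ler_nat.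
have xin k : (k <= S.+1 * 2 ^ N)%N -> 0 <= h * k%:R <= S.+1%:R.
  move=> kM; have h0 : 0 < h by rewrite invr_gt0.
  rewrite mulr_ge0 ?(ltW h0)//=; apply: (@le_trans _ _ (h * (S.+1 * 2 ^ N)%N%:R)).
    by rewrite ler_wpM2l ?(ltW h0)// ler_nat.
  by rewrite natrM natrX mulrC mulfK// gt_eqF.
have [s0 s1 iM iu iu'] := cellP u uS; have [t0 t1 jM jv jv'] := cellP v vS.
set i := Num.truncn _ in iM iu iu'; set s := Defs.frac _ in s0 s1.
set j := Num.truncn _ in jM jv jv'; set t := Defs.frac _ in t0 t1.
have close m k : (m <= S.+1 * 2 ^ N)%N -> (k <= S.+1 * 2 ^ N)%N ->
    `|h * m%:R - u| <= h -> `|h * k%:R - v| <= h -> `|Y m k - phi (u, v)| <= w' * (Kc + 2).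
  move=> mM kM mu_ kv; rewrite -(subrK (phi (h * m%:R, h * k%:R)) (Y m k)) -addrA mulrDr.
  apply: le_trans (ler_normD _ _) _; apply: lerD; first exact: grid.
  by rewrite [leRHS]mulrC; apply: near_ => //; [exact: xin|exact: inS|exact: xin|exact: inS].
(* The four weights add up to 1, so [phi (u, v)] can be subtracted inside each term. *)
have -> : numerical_approx N phip phim (u, v) - phi (u, v) =
    ((1 - s) * (1 - t)) *: (Y i j - phi (u, v)) + (s * (1 - t)) *: (Y i.+1 j - phi (u, v))
    + ((1 - s) * t) *: (Y i j.+1 - phi (u, v)) + (s * t) *: (Y i.+1 j.+1 - phi (u, v)).
  rewrite /numerical_approx /bilinear_ext /= -/i -/j -/s -/t -/h -/Y.
  by apply/rowP => l; rewrite !mxE; ring.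
apply: le_lt_trans w'e; set r := w' * _ in close *.
have scaled (a : R) (P : 'rV[R]_n.+1) : 0 <= a -> `|P| <= r -> `|a *: P| <= a * r.
  by move=> a0 Pr; rewrite normrZ ger0_norm//; exact: ler_wpM2l.
have iM' := ltnW iM; have jM' := ltnW jM.
have b1 := scaled _ _ (mulr_ge0 s1 t1) (close i j iM' jM' iu jv).
have b2 := scaled _ _ (mulr_ge0 s0 t1) (close i.+1 j iM jM' iu' jv).
have b3 := scaled _ _ (mulr_ge0 s1 t0) (close i j.+1 iM' jM iu jv').
have b4 := scaled _ _ (mulr_ge0 s0 t0) (close i.+1 j.+1 iM jM iu' jv').
apply: le_trans (ler_normD _ _) _.
apply: le_trans (lerD (le_trans (ler_normD _ _) (lerD (le_trans (ler_normD _ _) (lerD b1 b2)) b3)) b4) _.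
by rewrite le_eqVlt; apply/orP; left; apply/eqP; ring.
Qed.

End Convergence.

Theorem theorem2 (R : realType) (d : nat) (d_ge1 : (1 <= d)%N)
    (phip phim : R -> 'rV[R]_d.+1) (phi : R * R -> 'rV[R]_d.+1)
    (phip_sphere : forall u : R, 0 <= u -> unit_sphere d.+1 (phip u))
    (phim_sphere : forall v : R, 0 <= v -> unit_sphere d.+1 (phim v))
    (phip_ac : loc_abs_continuous phip)
    (phim_ac : loc_abs_continuous phim)
    (phi_corner : phip 0 = phim 0)
    (phi_wave : is_global_wave_map phip phim phi)
    (K : set (R * R)) (K_compact : compact K)
    (K_quadrant : K `<=` [set p : R * R | 0 <= p.1 /\ 0 <= p.2]) :
  {uniform K, (fun N : nat => numerical_approx N phip phim) @ \oo --> phi}.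
Proof.
(* The norm of a pair is the larger of the two absolute values, so this places [K] in the square of
   side [S]. *)
have [S HS] : exists S : nat, forall p, K p -> `|p| <= S%:R.
  have [B [_ HB]] := compact_bounded K_compact.
  have B1 : B < `|B| + 1 by rewrite (le_lt_trans (ler_norm B))// ltrDl.
  exists (Num.truncn (`|B| + 1)).+1 => p Kp; apply: le_trans (HB _ B1 p Kp) _.
  by have /andP[_ /ltW] := @truncn_itv R (`|B| + 1) (addr_ge0 (normr_ge0 _) ler01).
move=> U /uniform_nbhs[W [entW WU]].
have [e /= e0 eW] : exists2 e : R, 0 < e & [set xy | ball xy.1 e xy.2] `<=` W.
  by move: entW; rewrite -entourage_ballE.
have [N0 HN] := numerical_approx_close phip_sphere phim_sphere phip_ac phim_ac phi_corner
  phi_wave S e0.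
exists N0 => // N N0N; apply: WU => p Kp; apply: eW; rewrite /= -ball_normE /ball_/= distrC.
have [p1 p2] := K_quadrant p Kp; have := HS p Kp; rewrite prod_normE ge_max => /andP[n1 n2].
apply: HN => //; first by rewrite p1 (le_trans (ler_norm _)).
by rewrite p2 (le_trans (ler_norm _)).
Qed.
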